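(* Let $k\ge2$ be an integer, $\gamma>\frac32$, $m\ge7$ and $0<T<t_c$. For $\varepsilon\in(0,1]$ let $u$ be the real-valued solution of $$\partial_t u+\varepsilon^2\partial_x^3u+\tfrac1k\partial_x(u^k)=0,\quad x\in\mathbb T,\ t>0,\qquad u(\cdot,0)=u_0 .$$ Suppose that $u\in L^\infty(0,T;H^{\gamma+m}(\mathbb T))$, $\partial_tu\in L^\infty(0,T;H^{\gamma+4}(\mathbb T))$, $\partial_t^2u\in L^\infty(0,T;H^{\gamma+1}(\mathbb T))$, and that there is a constant $M>1$ independent of $\varepsilon$ such that $$\max_{0\le t\le T}\bigl\{\|u\|_{H^{\gamma+m}},\ \|\partial_tu\|_{H^{\gamma+4}},\ \|\partial_t^2u\|_{H^{\gamma+1}}\bigr\}\le M-1 .$$ Assume $\tau\lesssim N^{-2}$. Let $v_N^n\in Y_N$ be computed by the Lawson–Runge–Kutta scheme $$v_{N,1}^{n+1}=v_N^n-\tau P_NF(t_n,v_N^n),\qquad v_N^{n+1}=v_N^n-\frac\tau2P_N\bigl[F(t_n,v_N^n)+F(t_{n+1},v_{N,1}^{n+1})\bigr],$$ with $v_N^0=P_NI_{2N}u_0$ and $F(t,v)=\frac1ke^{t\varepsilon^2\partial_x^3}\partial_x\bigl(e^{-t\varepsilon^2\partial_x^3}v\bigr)^k$, and set $u_N^n=e^{-t_n\varepsilon^2\partial_x^3}v_N^n$. Then there exist $N_2>0$ and $\tau_2>0$ such that, for $N\ge N_2$ and $0<\tau\le\tau_2$, $$\|u(\cdot,t_n)-u_N^n\|_{H^\gamma}\le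 C\bigl(\tau^2+N^{-m+1}\bigr),\qquad 0\le n\le T/\tau,$$ where $N_2,\tau_2,C>0$ depend on $M$ and $T$, but are independent of $\varepsilon$, $N$ and $\tau$.
   Context: $\mathbb T=(-\pi,\pi)$ with periodic boundary conditions; $\tau>0$ is the time step, $t_n=n\tau$; $N$ is an even positive integer. $u_0$ is a given real-valued periodic initial datum (independent of $\varepsilon$). $t_c>0$ denotes the critical time, independent of $\varepsilon$ but depending on $u_0$, such that the solution $u$ remains smooth for all $t<t_c$ (before the gradient catastrophe / dispersive shock formation in the limit $\varepsilon\to0$). Fourier coefficients: $\widehat u(\xi)=\frac1{2\pi}\int_{\mathbb T}u(x)e^{-\mathrm i\xi(x+\pi)}\,dx$. Norm: $\|u\|_{H^\gamma}=\bigl(\sum_{\xi\in\mathbb Z}(1+\xi^2)^\gamma|\widehat u(\xi)|^2\bigr)^{1/2}$. The operator $e^{t\varepsilon^2\partial_x^3}$ is the Fourier multiplier with symbol $e^{-\mathrm it\varepsilon^2\xi^3}$. $Y_N=\operatorname{span}\{e^{\mathrm i\xi(x+\pi)}:\xi=-\frac N2,\dots,\frac N2\}$ and $P_N:L^2(\mathbb T)\to Y_N$ is the orthogonal projection $P_Nu=\sum_{\xi=-N/2}^{N/2}\widehat u(\xi)e^{\mathrm i\xi(x+\pi)}$. For even $L$, $I_L$ is trigonometric interpolation at $x_j=-\pi+2\pi j/L$, $j=0,\dots,L-1$: $(I_Lu)(x)=\sum_{\xi=-L/2}^{L/2-1}\widetilde u(\xi)e^{\mathrm i\xi(x+\pi)}$,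 $\widetilde u(\xi)=\frac1L\sum_{j=0}^{L-1}u(x_j)e^{-\mathrm i\xi(x_j+\pi)}$; $I_{2N}$ is the case $L=2N$. $A\lesssim B$ means $|A|\le C_0B$ for some constant $C_0>0$ independent of $\varepsilon,\tau,N$. The quantities $k,\gamma,m$ and the constant implied in $\tau\lesssim N^{-2}$ are regarded as fixed. *)

(* Defs.v *)
From HB Require Import structures.
From mathcomp Require Import all_boot all_order all_algebra.
From mathcomp Require Import complex.
From mathcomp Require Import all_classical all_reals all_analysis.
Set Implicit Arguments.
Unset Strict Implicit.
Unset Printing Implicit Defensive.
Import Order.TTheory GRing.Theory Num.Theory.
Import numFieldNormedType.Exports.
Local Open Scope classical_set_scope.
Local Open Scope ring_scope.
Local Open Scope complex_scope.

(* Functions on the torus T = (-pi, pi) with periodic boundary conditions are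
   functions R -> R (real-valued) or R -> R[i] (complex-valued); periodicity
   is stated separately where it is required.  Integrals, limits and
   derivatives of complex-valued functions are taken componentwise. *)

Section Complex.
Context {R : realType}.

Definition torus : set R := `]-pi, pi[.

Definition expi (theta : R) : R[i] := cos theta +i* sin theta.

Definition of_real (f : R -> R) : R -> R[i] := fun x => (f x)%:C.

Definition integralC (A : set R) (f : R -> R[i]) : R[i] :=
  (\int[lebesgue_measure]_(x in A) complex.Re (f x))
  +i* (\int[lebesgue_measure]_(x in A) complex.Im (f x)).

Definition limC (s : nat -> R[i]) : R[i] :=
  lim ((fun n => complex.Re (s n)) @ \oo)
  +i* lim ((fun n => complex.Im (s n)) @ \oo).

Definition derivC (f : R -> R[i]) : R -> R[i] := fun x =>
  derive1 (fun y => complex.Re (f y)) x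
  +i* derive1 (fun y => complex.Im (f y)) x.

End Complex.

Section Fourier.
Context {R : realType}.
Implicit Types (f : R -> R[i]) (s t x T : R) (xi : int) (c : int -> R[i]).

Definition mode xi x : R[i] := expi (xi%:~R * (x + pi)).

Definition fourier f xi : R[i] :=
  ((2 * pi)^-1)%:C *
  integralC torus (fun x => f x * expi (- (xi%:~R * (x + pi)))).

(* sum of c xi * mode xi x over the integers xi with |xi| <= n *)
Definition trig_sum (n : nat) c x : R[i] :=
  \sum_(j < n.*2.+1) c (j%:Z - n%:Z) * mode (j%:Z - n%:Z) x.

(* The Fourier series is summed by symmetric partial sums; these are
   eventually constant when f is a trigonometric polynomial. *)
Definition fourier_multiplier (symb : int -> R[i]) f : R -> R[i] := fun x =>
  limC (fun n => trig_sum n (fun xi => symb xi * fourier f xi) x).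

(* exp (t eps^2 d_x^3) *)
Definition airy (eps t : R) f : R -> R[i] :=
  fourier_multiplier (fun xi => expi (- (t * eps ^+ 2 * (xi%:~R) ^+ 3))) f.

(* P_N, for even N: the frequencies are -N/2, ..., N/2 *)
Definition proj (N : nat) f : R -> R[i] := trig_sum N./2 (fourier f).

(* I_L, for even L: the frequencies are -L/2, ..., L/2 - 1 *)
Definition node (L j : nat) : R := - pi + 2 * pi * j%:R / L%:R.

Definition discrete_fourier (L : nat) f xi : R[i] :=
  L%:R^-1 *
  \sum_(j < L) f (node L j) * expi (- (xi%:~R * (node L j + pi))).

Definition interp (L : nat) f : R -> R[i] := fun x =>
  \sum_(j < L) discrete_fourier L f (j%:Z - (L./2)%:Z)
               * mode (j%:Z - (L./2)%:Z) x.

(* Extended-real-valued; it is the H^s norm of f only when f is in L^2, which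
   is part of in_sobolev. *)
Definition sobolev_norm s f : \bar R :=
  sqrte (\esum_(xi in [set: int])
    ((1 + (xi%:~R) ^+ 2) `^ s * ComplexField.Normc.normc (fourier f xi) ^+ 2)%:E).

Definition in_L2 f : Prop :=
  [/\ measurable_fun torus (fun x => complex.Re (f x)),
      measurable_fun torus (fun x => complex.Im (f x)) &
      (\int[lebesgue_measure]_(x in torus)
          (ComplexField.Normc.normc (f x) ^+ 2)%:E < +oo)%E].

Definition in_sobolev s f : Prop := in_L2 f /\ (sobolev_norm s f < +oo)%E.

(* w in L^infty(0, T; H^s).  As H^s is separable, strong (Bochner)
   measurability of w amounts to measurability of its Fourier coefficients. *)
Definition Linfty_sobolev T s (w : R -> R -> R[i]) : Prop :=
  (forall xi,
     measurable_fun `]0, T[ (fun t => complex.Re (fourier (w t) xi)) /\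
     measurable_fun `]0, T[ (fun t => complex.Im (fourier (w t) xi))) /\
  exists K : R, {ae lebesgue_measure, forall t, t \in `]0, T[ ->
    in_sobolev s (w t) /\ (sobolev_norm s (w t) <= K%:E)%E}.

End Fourier.

Section Equation.
Context {R : realType}.
Implicit Types (eps t T x : R) (k : nat) (w : R -> R -> R).

Definition diff_quot w t x : R -> R := fun r => (w r x - w t x) / (r - t).

(* Time derivative on the closed interval [0, T]: one-sided at the endpoints *)
Definition time_derivable T w : Prop := forall t x, 0 <= t <= T ->
  cvg (diff_quot w t x r @[r --> within `[0, T] t^']).

Definition dt T w : R -> R -> R := fun t x =>
  lim (diff_quot w t x r @[r --> within `[0, T] t^']).

(* Classical solution, on the time interval [0, tc), of
     d_t w + eps^2 d_x^3 w + (1/k) d_x (w^k) = 0,  w(., 0) = u0: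
   w and its space derivatives up to order 3 are continuous up to t = 0; the
   continuity of d_t w for t > 0 then follows from the equation. *)
Record classical_solution k eps (u0 : R -> R) (tc : R) w : Prop := {
  sol_periodic : forall t, 0 <= t < tc -> periodic (w t) (pi *+ 2) ;
  sol_init : forall x, w 0 x = u0 x ;
  sol_dx : forall (j : nat) t x, (j < 3)%N -> 0 <= t < tc ->
    derivable (derive1n j (w t)) x 1 ;
  sol_cont : forall j : nat, (j <= 3)%N ->
    {within `[0, tc[ `*` [set: R],
      continuous (fun p : R * R => derive1n j (w p.1) p.2)} ;
  sol_dt : forall t x, 0 < t < tc -> derivable (fun r => w r x) t 1 ;
  sol_eq : forall t x, 0 < t < tc ->
    derive1 (fun r => w r x) t + eps ^+ 2 * derive1n 3 (w t) x
    + k%:R^-1 * derive1 (fun y => w t y ^+ k) x = 0 }.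

(* w in L^infty(0, T; H^s), with H^s norm at most K at every t in [0, T] *)
Definition sobolev_bounded T s (K : R) w : Prop :=
  Linfty_sobolev T s (fun t => of_real (w t)) /\
  forall t, 0 <= t <= T ->
    in_sobolev s (of_real (w t)) /\
    (sobolev_norm s (of_real (w t)) <= K%:E)%E.

Definition regular_up_to T (gamma m M : R) w : Prop :=
  [/\ time_derivable T w, time_derivable T (dt T w),
      sobolev_bounded T (gamma + m) (M - 1) w,
      sobolev_bounded T (gamma + 4) (M - 1) (dt T w) &
      sobolev_bounded T (gamma + 1) (M - 1) (dt T (dt T w))].

End Equation.

Section Scheme.
Context {R : realType}.
Implicit Types (eps tau t : R) (k N n : nat) (v : R -> R[i]).

(* F(t, v) *)
Definition nonlin k eps t v : R -> R[i] := fun x =>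
  k%:R^-1 * airy eps t (derivC (fun y => airy eps (- t) v y ^+ k)) x.

(* the first stage v_{N,1}^{n+1}, computed from v = v_N^n at t = t_n *)
Definition lawson_stage k eps tau N t v : R -> R[i] := fun x =>
  v x - tau%:C * proj N (nonlin k eps t v) x.

Definition lawson_step k eps tau N t t' v : R -> R[i] := fun x =>
  v x - (tau / 2)%:C *
    proj N (fun y => nonlin k eps t v y
                     + nonlin k eps t' (lawson_stage k eps tau N t v) y) x.

Fixpoint lawson_rk k eps tau N (u0 : R -> R) n : R -> R[i] :=
  match n with
  | 0 => proj N (interp (2 * N) (of_real u0))
  | n'.+1 => lawson_step k eps tau N (n'%:R * tau) (n'.+1%:R * tau)
               (lawson_rk k eps tau N u0 n')
  end.

(* u_N^n *)
Definition numerical_solution k eps tau N (u0 : R -> R) n : R -> R[i] :=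
  airy eps (- (n%:R * tau)) (lawson_rk k eps tau N u0 n).

End Scheme.

(* Main.v *)
Require Import Defs.
From HB Require Import structures.
From mathcomp Require Import all_boot all_order all_algebra.
From mathcomp Require Import complex.
From mathcomp Require Import all_classical all_reals all_analysis.
From mathcomp Require Import measurable_realfun.
From mathcomp Require Import ring lra zify.
Set Implicit Arguments.
Unset Strict Implicit.
Unset Printing Implicit Defensive.
Import Order.TTheory GRing.Theory Num.Theory.
Import numFieldNormedType.Exports.
Local Open Scope classical_set_scope.
Local Open Scope ring_scope.
Local Open Scope complex_scope.

(** The whole proof takes place on Fourier coefficients, in the balls [hball] of
    H^s, and in the variable u = exp (- t eps^2 d_x^3) v, in which the Airy flow
    acts at each step as an isometry of every H^s. All constants are therefore
    uniform in eps.

    In this variable one step of the scheme is the average of the free flow of u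
    and of E (A (E u)), where A is the free flow over one step and E the forward
    Euler step of the projected equation without dispersion ([heun],
    [numerical_solution_trig]). Stability thus reduces to that of E in H^gamma
    ([euler_stable], [heun_stable]). The nonlinearity loses a derivative, but
    what the difference e of two solutions contributes at the highest order is a
    transport term w d_x e with w real, and the H^gamma inner product of that term
    with e is bounded by |e|^2: this is a commutator estimate on weights
    ([kernel_le], [hball_energy]). The square of the increment loses two
    derivatives at order tau^2, which the restriction tau <= c N^(-2) compensates.

    For consistency, the projected exact solution satisfies the projected
    equation up to a remainder, due to the frequencies above N/2 in the
    nonlinearity, whose H^(gamma + 1) norm is O(N^(1 - m)) ([power_tail],
    [hball_tail]). After conjugation by the free flow a step of the scheme is a
    trapezoidal rule with predictor, and its error is tau O(tau^2 + N^(1 - m))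
    ([trapezoid], [euler_quad], [local_error]). Time derivatives of the solution
    are replaced by space derivatives through the equation, at the cost of seven
    derivatives beyond H^gamma.

    The initial error is the aliasing error of interpolation, again O(N^(1 - m))
    ([aliasing]). A discrete Gronwall argument adds up the local errors; it is
    closed by a bootstrap: for N large and tau small the accumulated error stays
    below 1, and so the numerical solution remains in a fixed ball of H^gamma
    ([coefficient_convergence]). The discarded frequencies of the exact solution
    add O(N^(- m)).

    The link with functions is made by the differential equation of the Fourier
    coefficients of a classical solution ([uhat_ode]) and by Fourier inversion
    with a rate ([trig_approx]), which extends the estimates from trigonometric
    polynomials to the powers and the nodal values of the exact solution. *)

Notation normc := ComplexField.Normc.normc.

(** * Sums over finite sets of frequencies *)

Section FiniteSums.
Context {R : realType}.

(** The Cauchy-Schwarz inequality, from Lagrange's identity. *)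
Lemma cs_wsum (I : Type) (r : seq I) (k x y : I -> R) :
  (forall i, 0 <= k i) ->
  (\sum_(i <- r) k i * x i * y i) ^+ 2 <=
  (\sum_(i <- r) k i * x i ^+ 2) * (\sum_(i <- r) k i * y i ^+ 2).
Proof.
move=> k0; rewrite -subr_ge0.
suff -> : (\sum_(i <- r) k i * x i ^+ 2) * (\sum_(i <- r) k i * y i ^+ 2) -
  (\sum_(i <- r) k i * x i * y i) ^+ 2 =
  2^-1 * \sum_(i <- r) \sum_(j <- r) k i * k j * (x i * y j - x j * y i) ^+ 2.
  apply: mulr_ge0; first by lra.
  apply: sumr_ge0 => i _; apply: sumr_ge0 => j _.
  by apply: mulr_ge0; [exact: mulr_ge0|exact: sqr_ge0].
set A := \sum_(i <- r) k i * x i ^+ 2; set D := \sum_(i <- r) k i * y i ^+ 2.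
set B := \sum_(i <- r) k i * x i * y i.
have -> : \sum_(i <- r) \sum_(j <- r) k i * k j * (x i * y j - x j * y i) ^+ 2
   = A * D + D * A - (B * B) *+ 2.
  rewrite /A /B /D !big_distrlr /= -big_split -sumrMnl -sumrB /=.
  apply: eq_bigr => i _; rewrite -big_split -sumrMnl -sumrB /=.
  by apply: eq_bigr => j _; ring.
by rewrite expr2 -[_ *+ 2]mulr_natl; field.
Qed.

Lemma le_sqr_of (a b : R) : 0 <= b -> a ^+ 2 <= b ^+ 2 -> a <= b.
Proof.
move=> b0 h; case: (leP 0 a) => a0; last by apply: le_trans (ltW a0) b0.
by rewrite -(ler_pXn2r (n:=2)) // nnegrE.
Qed.

Lemma cs_wsum_le (I : Type) (r : seq I) (k x y : I -> R) (A B : R) :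
  (forall i, 0 <= k i) -> 0 <= A -> 0 <= B ->
  \sum_(i <- r) k i * x i ^+ 2 <= A ^+ 2 ->
  \sum_(i <- r) k i * y i ^+ 2 <= B ^+ 2 ->
  \sum_(i <- r) k i * x i * y i <= A * B.
Proof.
move=> k0 A0 B0 hA hB; apply: le_sqr_of; first exact: mulr_ge0.
apply: le_trans (cs_wsum _ _ _ k0) _; rewrite exprMn.
by apply: ler_pM => //; apply: sumr_ge0 => i _; rewrite mulr_ge0 ?sqr_ge0.
Qed.

Lemma cs_sum_le (I : Type) (r : seq I) (x y : I -> R) (A B : R) :
  0 <= A -> 0 <= B ->
  \sum_(i <- r) x i ^+ 2 <= A ^+ 2 -> \sum_(i <- r) y i ^+ 2 <= B ^+ 2 ->
  \sum_(i <- r) x i * y i <= A * B.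
Proof.
move=> A0 B0 hA hB.
have := @cs_wsum_le I r (fun=> 1) x y A B (fun=> ler01) A0 B0.
under eq_bigr do rewrite mul1r; move=> /(_ hA).
under eq_bigr do rewrite mul1r; move=> /(_ hB).
by under eq_bigr do rewrite mul1r.
Qed.

(** Minkowski's inequality in l^2. *)
Lemma l2_add (I : Type) (r : seq I) (x y : I -> R) (A B : R) :
  0 <= A -> 0 <= B ->
  \sum_(i <- r) x i ^+ 2 <= A ^+ 2 -> \sum_(i <- r) y i ^+ 2 <= B ^+ 2 ->
  \sum_(i <- r) (x i + y i) ^+ 2 <= (A + B) ^+ 2.
Proof.
move=> A0 B0 hA hB; have h := cs_sum_le A0 B0 hA hB.
have -> : \sum_(i <- r) (x i + y i) ^+ 2 = \sum_(i <- r) x i ^+ 2 +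
   \sum_(i <- r) y i ^+ 2 + 2 * \sum_(i <- r) x i * y i.
  by rewrite mulr_sumr -!big_split /=; apply: eq_bigr => i _; ring.
lra.
Qed.

(** Sums over Z are bounded through all finite duplicate-free lists of indices,
    so that summability never has to be discussed. *)
Definition l1le (a : int -> R) (A : R) :=
  forall s : seq int, uniq s -> \sum_(x <- s) a x <= A.

Definition l2le (a : int -> R) (A : R) := l1le (fun x => a x ^+ 2) (A ^+ 2).

Lemma l1le_shift (a : int -> R) A y : l1le a A -> l1le (fun x => a (x - y)) A.
Proof.
move=> h s us; rewrite -(big_map (fun x => x - y) xpredT a); apply: h.
by rewrite map_inj_uniq // => u v /addIr.
Qed.

Lemma l1le_refl (a : int -> R) A y : l1le a A -> l1le (fun x => a (y - x)) A.
Proof.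
move=> h s us; rewrite -(big_map (fun x => y - x) xpredT a); apply: h.
by rewrite map_inj_uniq // => u v /addrI /oppr_inj.
Qed.

Lemma l1le_ge0 a A : l1le a A -> 0 <= A.
Proof. by move=> /(_ [::] isT); rewrite big_nil. Qed.

(** Young's inequality for the form sum k (x - y) a x b y, in the three cases in
    which one of the factors is in l^1 and the two others in l^2. *)
Lemma young_221 (k a b : int -> R) (s t : seq int) (A B K : R) :
  (forall x, 0 <= k x) -> uniq s -> uniq t -> 0 <= A -> 0 <= B ->
  \sum_(x <- s) a x ^+ 2 <= A ^+ 2 -> \sum_(y <- t) b y ^+ 2 <= B ^+ 2 ->
  l1le k K ->
  \sum_(x <- s) \sum_(y <- t) k (x - y) * a x * b y <= K * A * B.
Proof.
move=> k0 us ut A0 B0 hA hB hK; have K0 := l1le_ge0 hK.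
have sK : 0 <= Num.sqrt K by exact: sqrtr_ge0.
have KE : K = Num.sqrt K ^+ 2 by rewrite sqr_sqrtr.
have := @cs_wsum_le _ [seq (x, y) | x <- s, y <- t] (fun p => k (p.1 - p.2))
  (fun p => a p.1) (fun p => b p.2) (Num.sqrt K * A) (Num.sqrt K * B).
rewrite !big_allpairs /= => h.
have -> : K * A * B = Num.sqrt K * A * (Num.sqrt K * B) by rewrite [in LHS]KE; ring.
apply: h => //; rewrite ?mulr_ge0 // exprMn -KE.
- under eq_bigr do rewrite -mulr_suml.
  apply: le_trans (_ : \sum_(x <- s) K * a x ^+ 2 <= _).
    apply: ler_sum => x _; apply: ler_wpM2r; first exact: sqr_ge0.
    exact: (l1le_refl x hK).
  by rewrite -mulr_sumr ler_wpM2l.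
- rewrite exchange_big /=; under eq_bigr do rewrite -mulr_suml.
  apply: le_trans (_ : \sum_(y <- t) K * b y ^+ 2 <= _).
    apply: ler_sum => y _; apply: ler_wpM2r; first exact: sqr_ge0.
    exact: (l1le_shift y hK).
  by rewrite -mulr_sumr ler_wpM2l.
Qed.

Lemma young_212 (k a b : int -> R) (s t : seq int) (A B K : R) :
  (forall x, 0 <= b x) -> uniq s -> uniq t -> 0 <= A -> 0 <= K ->
  \sum_(x <- s) a x ^+ 2 <= A ^+ 2 -> l1le b B -> l2le k K ->
  \sum_(x <- s) \sum_(y <- t) k (x - y) * a x * b y <= K * A * B.
Proof.
move=> b0 us ut A0 K0 hA hB hK; rewrite exchange_big /=.
apply: le_trans (_ : \sum_(y <- t) K * A * b y <= _); last first.
  by rewrite -mulr_sumr ler_wpM2l ?mulr_ge0 //; exact: hB.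
apply: ler_sum => y _; rewrite -mulr_suml ler_wpM2r //.
apply: cs_sum_le => //; exact: (l1le_shift y hK).
Qed.

Lemma young_122 (k a b : int -> R) (s t : seq int) (A B K : R) :
  (forall x, 0 <= a x) -> uniq s -> uniq t -> 0 <= B -> 0 <= K ->
  l1le a A -> \sum_(x <- t) b x ^+ 2 <= B ^+ 2 -> l2le k K ->
  \sum_(x <- s) \sum_(y <- t) k (x - y) * a x * b y <= K * B * A.
Proof.
move=> a0 us ut B0 K0 hA hB hK.
apply: le_trans (_ : \sum_(x <- s) K * B * a x <= _); last first.
  by rewrite -mulr_sumr ler_wpM2l ?mulr_ge0 //; exact: hA.
apply: ler_sum => x _.
rewrite (_ : \sum_(y <- t) _ = (\sum_(y <- t) k (x - y) * b y) * a x); last first.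
  by rewrite mulr_suml; apply: eq_bigr => y _; ring.
rewrite ler_wpM2r //; apply: cs_sum_le => //; exact: (l1le_refl x hK).
Qed.

End FiniteSums.

(** * The weights of Sobolev norms *)

Section Weights.
Context {R : realType}.
Implicit Types (x y : int) (s : R).

(** the Japanese bracket <x> *)
Definition jb x : R := Num.sqrt (1 + x%:~R ^+ 2).

Definition wt s x : R := jb x `^ s.

Lemma jb_sqr x : jb x ^+ 2 = 1 + x%:~R ^+ 2.
Proof. by rewrite sqr_sqrtr // addr_ge0 ?sqr_ge0. Qed.

Lemma jb_ge0 x : 0 <= jb x. Proof. exact: sqrtr_ge0. Qed.

Lemma jb_ge1 x : 1 <= jb x.
Proof.
apply: le_sqr_of; first exact: jb_ge0.
by rewrite jb_sqr expr1n lerDl sqr_ge0.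
Qed.

Lemma jb_gt0 x : 0 < jb x. Proof. exact: lt_le_trans ltr01 (jb_ge1 x). Qed.

Lemma jbN x : jb (- x) = jb x. Proof. by rewrite /jb mulrNz sqrrN. Qed.

Lemma jb_norm x : `|x%:~R : R| <= jb x.
Proof.
apply: le_sqr_of; first exact: jb_ge0.
by rewrite jb_sqr real_normK ?num_real // lerDr.
Qed.

Lemma jb_le1D x : jb x <= 1 + `|x%:~R|.
Proof.
apply: le_sqr_of; first by rewrite addr_ge0.
rewrite jb_sqr -[X in _ + X <= _]real_normK ?num_real //.
have := normr_ge0 (x%:~R : R); nra.
Qed.

Lemma jb_lip x y : jb x <= jb y + `|(x - y)%:~R|.
Proof.
apply: le_sqr_of; first by rewrite addr_ge0 ?jb_ge0.
rewrite sqrrD !jb_sqr real_normK ?num_real // intrB.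
have h1 : y%:~R * (x%:~R - y%:~R) <= jb y * `|(x%:~R - y%:~R) : R|.
  apply: le_trans (ler_norm _) _; rewrite normrM; apply: ler_wpM2r => //.
  exact: jb_norm.
move: h1; rewrite -mulr_natl; nra.
Qed.

Lemma jb_add x y : jb x <= jb (x - y) + jb y.
Proof.
by apply: le_trans (jb_lip x y) _; rewrite addrC lerD2r jb_norm.
Qed.

Lemma wt_gt0 s x : 0 < wt s x. Proof. by rewrite powR_gt0 // jb_gt0. Qed.
Lemma wt_ge0 s x : 0 <= wt s x. Proof. exact: ltW (wt_gt0 s x). Qed.
Lemma wtN s x : wt s (- x) = wt s x. Proof. by rewrite /wt jbN. Qed.
Lemma wtD s t x : wt (s + t) x = wt s x * wt t x.
Proof. by rewrite /wt powRD // (gt_eqF (jb_gt0 x)) implybT. Qed.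
Lemma wt_le s t x : s <= t -> wt s x <= wt t x.
Proof. by move=> h; apply: ler_powR => //; exact: jb_ge1. Qed.
Lemma wt1 x : wt 1 x = jb x. Proof. by rewrite /wt powRr1 // jb_ge0. Qed.
Lemma wt0 x : wt 0 x = 1. Proof. by rewrite /wt powRr0. Qed.
Lemma wtn n x : wt n%:R x = jb x ^+ n. Proof. by rewrite /wt powR_mulrn // jb_ge0. Qed.
Lemma wt_sqr s x : wt s x ^+ 2 = (1 + x%:~R ^+ 2) `^ s.
Proof.
rewrite -jb_sqr -(powR_mulrn _ (jb_ge0 x)) -powRrM mulrC powRrM.
by rewrite (powR_mulrn _ (wt_ge0 s x)).
Qed.

Lemma powR_addr_le (a b p : R) : 0 <= a -> 0 <= b -> 0 <= p ->
  (a + b) `^ p <= 2 `^ p * (a `^ p + b `^ p).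
Proof.
move=> a0 b0 p0; wlog ab : a b a0 b0 / a <= b.
  move=> h; case: (leP a b) => [|/ltW] ab; first exact: h.
  by rewrite addrC [X in _ * X]addrC; exact: h.
apply: le_trans (_ : (2 * b) `^ p <= _).
  by apply: ge0_ler_powR => //; rewrite ?nnegrE; lra.
by rewrite powRM // ler_wpM2l ?powR_ge0 // lerDr powR_ge0.
Qed.

Lemma wt_sub s x y : 0 <= s -> wt s x <= 2 `^ s * (wt s (x - y) + wt s y).
Proof.
move=> s0; apply: le_trans (powR_addr_le (jb_ge0 _) (jb_ge0 _) s0).
by apply: ge0_ler_powR => //; rewrite ?nnegrE ?addr_ge0 ?jb_ge0 ?jb_add.
Qed.

(** If [y < x / 2] then [z] exceeds [x / 2] and the crude bound [x `^ p] suffices;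
    otherwise Bernoulli's inequality for [(y / x) `^ p] applies. *)
Lemma powR_diff_le (x y z p : R) : 1 <= y -> y <= x -> x <= y + z -> 1 <= p ->
  x `^ p - y `^ p <= 2 * p * z * x `^ (p - 1).
Proof.
move=> y1 yx xz p1.
have x0 : 0 < x by lra.
have xp0 := powR_ge0 x (p - 1).
have xpE : x `^ p = x * x `^ (p - 1) by rewrite mulr_powRB1 //; lra.
case: (leP (x / 2) y) => hy; last first.
  apply: le_trans (_ : x `^ p <= _); first by rewrite gerBl powR_ge0.
  rewrite xpE; apply: ler_wpM2r => //; nra.
have yE : y `^ p = x `^ p * (y / x) `^ p.
  rewrite -powRM ?divr_ge0; [|lra..]; congr (_ `^ _); field; lra.
have hq : 1 - p * (x / y - 1) <= (y / x) `^ p.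
  have q0 : 0 < y / x by rewrite divr_gt0 //; lra.
  rewrite /powR gt_eqF //; apply: le_trans (expR_ge1Dx _).
  rewrite lerD2l -mulrN; apply: ler_wpM2l; first lra.
  rewrite -[y / x]invrK lnV ?posrE ?invr_gt0 // lerN2 invf_div.
  have -> : x / y = 1 + (x / y - 1) by ring.
  rewrite [X in _ <= X](_ : _ = x / y - 1); last by ring.
  apply: le_ln1Dx; rewrite ltrBrDl subrr divr_gt0 //; lra.
rewrite yE -{1}[x `^ p]mulr1 -mulrBr xpE.
apply: le_trans (_ : x * x `^ (p - 1) * (p * (x / y - 1)) <= _).
  apply: ler_wpM2l; first by rewrite mulr_ge0 //; lra.
  lra.
rewrite -subr_ge0.
have -> : 2 * p * z * x `^ (p - 1) - x * x `^ (p - 1) * (p * (x / y - 1)) =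
  p * x `^ (p - 1) * (2 * z - (x - y) * (x / y)) by field; lra.
apply: mulr_ge0; first by rewrite mulr_ge0 //; lra.
have : x / y <= 2 by rewrite ler_pdivrMr; lra.
have : 0 <= x / y by rewrite divr_ge0; lra.
nra.
Qed.

(** The next lemma with real variables: [X], [Y], [Z] stand for the brackets of
    the frequencies [x], [y], [x - y]. The difference of the weights produces a
    factor [Z] in exchange for one power of [X]. *)
Lemma kernel_real (g X Y Z y z : R) : 1 <= g -> 1 <= Y -> Y <= X -> 1 <= Z ->
  X <= Y + Z -> `|y| <= Y -> `|z| <= Z ->
  `|y * ((X `^ g) ^+ 2 - (Y `^ g) ^+ 2) + z * (Y `^ g) ^+ 2| <=
  (4 * g * 2 `^ g + 1) * (Z * X `^ g * Y `^ g + Z `^ g * X `^ g * Y +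
     Z `^ g * X * Y `^ g).
Proof.
move=> g1 Y1 YX Z1 XYZ nY nZ.
have g0 : 0 <= g by lra.
have X0 : 0 <= X by lra.
have Y0 : 0 <= Y by lra.
have Z0 : 0 <= Z by lra.
have hX : Y * X `^ (g + g - 1) <=
    2 `^ g * (X `^ g * (Y `^ g + Y / Z * Z `^ g)).
  have -> : g + g - 1 = g + (g - 1) by ring.
  rewrite powRD; last by apply/implyP => _; rewrite gt_eqF //; lra.
  have h1 : X `^ (g - 1) <= 2 `^ g * (Y `^ (g - 1) + Z `^ (g - 1)).
    apply: le_trans (_ : (Y + Z) `^ (g - 1) <= _).
      by apply: ge0_ler_powR => //; rewrite ?nnegrE; lra.
    apply: le_trans (powR_addr_le _ _ _) _ => //; first lra.
    apply: ler_wpM2r; first by rewrite addr_ge0 ?powR_ge0.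
    by apply: ler_powR; lra.
  have yE : Y `^ g = Y * Y `^ (g - 1) by rewrite mulr_powRB1 //; lra.
  have zE : Z `^ g = Z * Z `^ (g - 1) by rewrite mulr_powRB1 //; lra.
  rewrite yE zE.
  have -> : 2 `^ g * (X `^ g * (Y * Y `^ (g - 1) + Y / Z * (Z * Z `^ (g - 1)))) =
    Y * (X `^ g * (2 `^ g * (Y `^ (g - 1) + Z `^ (g - 1)))) by field; lra.
  apply: ler_wpM2l => //; apply: ler_wpM2l => //; exact: powR_ge0.
have hd : (X `^ g) ^+ 2 - (Y `^ g) ^+ 2 <= 2 * (g + g) * Z * X `^ (g + g - 1).
  have e u : 1 <= u -> (u `^ g) ^+ 2 = u `^ (g + g).
    by move=> u1; rewrite expr2 powRD //; apply/implyP => _; rewrite gt_eqF //; lra.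
  by rewrite !e; [|lra..]; apply: powR_diff_le => //; lra.
have YXg : Y `^ g <= X `^ g by apply: ge0_ler_powR.
move: hd hX YXg (powR_ge0 X g) (powR_ge0 Y g) (powR_ge0 Z g).
move: (powR_ge0 X (g + g - 1)) (powR_ge0 2 g).
move: (X `^ g) (Y `^ g) (Z `^ g) (X `^ (g + g - 1)) (2 `^ g) => P Q W V c V0 c0.
move=> hd hX QP P0 Q0 W0.
have d0 : 0 <= P ^+ 2 - Q ^+ 2 by rewrite subr_ge0 ler_pXn2r ?nnegrE.
apply: le_trans (ler_normD _ _) _.
rewrite normrM (ger0_norm d0) [X in _ + X <= _]normrM (ger0_norm (sqr_ge0 Q)).
have a1 : 0 <= Z * P * Q by rewrite !mulr_ge0.
have a2 : 0 <= W * P * Y by rewrite !mulr_ge0.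
have a3 : 0 <= W * X * Q by rewrite !mulr_ge0.
have a4 : 0 <= 4 * g * c by rewrite !mulr_ge0.
have b1 : `|y| * (P ^+ 2 - Q ^+ 2) <= 4 * g * c * (Z * P * Q + W * P * Y).
  apply: le_trans (_ : Y * (2 * (g + g) * Z * V) <= _); first exact: ler_pM.
  have -> : 4 * g * c * (Z * P * Q + W * P * Y) =
    4 * g * Z * (c * (P * (Q + Y / Z * W))) by field; lra.
  have -> : Y * (2 * (g + g) * Z * V) = 4 * g * Z * (Y * V) by ring.
  by apply: ler_wpM2l => //; rewrite !mulr_ge0.
have b2 : `|z| * Q ^+ 2 <= Z * P * Q.
  rewrite expr2 mulrA; apply: ler_wpM2r => //.
  exact: ler_pM.
apply: le_trans (lerD b1 b2) _.
have := mulr_ge0 a4 a3; lra.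
Qed.

(** The cancellation behind the energy estimate: symmetrising the transport term
    in its two outer frequencies replaces a derivative by a difference of
    weights, in which the derivative has moved to the frequency [x - y]. *)
Lemma kernel_le (g : R) x y : 1 <= g ->
  `|y%:~R * wt g x ^+ 2 - x%:~R * wt g y ^+ 2| <=
  (4 * g * 2 `^ g + 1) * (jb (x - y) * wt g x * wt g y +
     wt g (x - y) * wt g x * jb y + wt g (x - y) * jb x * wt g y).
Proof.
move=> g1; wlog xy : x y / jb y <= jb x.
  move=> h; case: (leP (jb y) (jb x)) => [|/ltW] xy; first exact: h.
  rewrite distrC; apply: le_trans (h _ _ xy) _.
  rewrite -opprB jbN wtN le_eqVlt; apply/orP; left; apply/eqP.
  move: (wt g x) (wt g y) (wt g _) (jb _) (jb _) (jb _) (2 `^ g).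
  by clear => *; ring.
have -> : y%:~R * wt g x ^+ 2 - x%:~R * wt g y ^+ 2 =
  y%:~R * (wt g x ^+ 2 - wt g y ^+ 2) + (y - x)%:~R * wt g y ^+ 2 :> R.
  by rewrite intrB; move: (wt g x) (wt g y) => *; ring.
apply: kernel_real => //; try exact: jb_ge1; try exact: jb_norm.
  by rewrite addrC; exact: jb_add.
by rewrite -normrN -mulrNz opprB; exact: jb_norm.
Qed.

End Weights.

(** * Summability of the weights *)

Section Series.
Context {R : realType}.

(** Bernoulli's inequality compares the series with a telescoping one. *)
Lemma pseries_step (q : R) (n : nat) : 0 < q ->
  q * (n.+2%:R `^ (- (q + 1))) <= n.+1%:R `^ (- q) - n.+2%:R `^ (- q).
Proof.
move=> q0.
have a0 : 0 < n.+1%:R :> R by rewrite ltr0n.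
have b0 : 0 < n.+2%:R :> R by rewrite ltr0n.
have -> : - (q + 1) = - q + - 1 by ring.
rewrite powRD; last by rewrite (gt_eqF b0) implybT.
rewrite powR_inv1; last exact: ltW.
rewrite lerBrDr.
have -> : n.+1%:R `^ (- q) = n.+2%:R `^ (- q) * (n.+1%:R / n.+2%:R) `^ (- q).
  by rewrite -powRM ?divr_ge0 ?ltW //; congr (_ `^ _); field; lra.
rewrite mulrCA -[X in _ + X]mulr1 -mulrDr ler_wpM2l ?powR_ge0 //.
have c0 : 0 < n.+1%:R / n.+2%:R :> R by rewrite divr_gt0.
rewrite /powR gt_eqF // addrC; apply: le_trans (expR_ge1Dx _).
rewrite lerD2l mulNr -mulrN; apply: ler_wpM2l; first exact: ltW.
rewrite lerNr.
have -> : n.+1%:R / n.+2%:R = 1 + (- n.+2%:R^-1) :> R.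
  by rewrite -[n.+2]addn1 natrD; field; lra.
apply: le_ln1Dx; rewrite ltrN2 invf_lt1 // ltr1n //.
Qed.

Lemma pseries_bound (q : R) (n : nat) : 0 < q ->
  \sum_(j < n) j.+1%:R `^ (- (q + 1)) <= 1 + q^-1.
Proof.
move=> q0; case: n => [|n]; first by rewrite big_ord0 addr_ge0 // invr_ge0 ltW.
rewrite big_ord_recl /= powR1 lerD2l.
rewrite -[leRHS]mul1r ler_pdivlMr // mulrC mulr_sumr.
apply: le_trans (_ : \sum_(j < n) (j.+1%:R `^ (- q) - j.+2%:R `^ (- q)) <= _).
  by apply: ler_sum => j _; exact: pseries_step.
have -> : \sum_(j < n) (j.+1%:R `^ (- q) - j.+2%:R `^ (- q)) =
    1 - n.+1%:R `^ (- q) :> R.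
  elim: n => [|n IH]; first by rewrite big_ord0 powR1 subrr.
  by rewrite big_ord_recr /= IH; ring.
by rewrite gerBl powR_ge0.
Qed.

Lemma ler_sum_sub (T : eqType) (s t : seq T) (f : T -> R) :
  uniq s -> {subset s <= t} -> (forall x, 0 <= f x) ->
  \sum_(x <- s) f x <= \sum_(x <- t) f x.
Proof.
move=> us st f0; elim: s t us st => [|a s IH] t /=.
  by move=> _ _; rewrite big_nil sumr_ge0.
move=> /andP[as_ us] st.
have at_ : a \in t by apply: st; rewrite inE eqxx.
rewrite big_cons (perm_big _ (perm_to_rem at_)) big_cons lerD2l.
apply: IH => // x xs; have := st x; rewrite inE xs orbT => /(_ isT) xt.
have xa : x != a by apply: contraNneq as_ => <-.
have := perm_mem (perm_to_rem at_) x; rewrite inE (negbTE xa) /= => <-.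
exact: xt.
Qed.

(** Locked, so that conversion never expands the list of frequencies. *)
Definition win (n : nat) : seq int := locked [seq j%:Z - n%:Z | j <- iota 0 n.*2.+1].

Lemma win_uniq n : uniq (win n).
Proof.
by rewrite /win -lock map_inj_uniq ?iota_uniq // => i j /addIr [].
Qed.

Lemma mem_win n (x : int) : (x \in win n) = (`|x| <= n)%N.
Proof.
rewrite /win -lock; apply/mapP/idP => [[j]|h].
  by rewrite mem_iota => hj ->; lia.
exists (absz (x + n%:Z)); first by rewrite mem_iota; lia.
lia.
Qed.

Lemma sum_win (V : nmodType) n (F : int -> V) :
  \sum_(x <- win n) F x = \sum_(j < n.*2.+1) F (j%:Z - n%:Z).
Proof.
by rewrite /win -lock big_map -[in iota _ _](subn0 n.*2.+1) -/(index_iota _ _) big_mkord.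
Qed.

Lemma win_sup (s : seq int) : exists n, {subset s <= win n}.
Proof.
exists (\max_(x <- s) `|x|)%N => x xs; rewrite mem_win.
by rewrite (leq_bigmax_seq (F := fun x : int => `|x|%N)).
Qed.

Lemma sum_winS n (F : int -> R) :
  \sum_(x <- win n.+1) F x = \sum_(x <- win n) F x + F n.+1%:Z + F (- n.+1%:Z).
Proof.
have P : perm_eq (win n.+1) [:: n.+1%:Z, - n.+1%:Z & win n].
  apply: uniq_perm; first exact: win_uniq.
    by rewrite cons_uniq in_cons !mem_win cons_uniq mem_win win_uniq; lia.
  suff e (x : int) : (x \in win n.+1) = (x \in [:: n.+1%:Z, - n.+1%:Z & win n]) by exact: e.
  by rewrite mem_win 2!in_cons mem_win; lia.
by rewrite (perm_big _ P) 2!big_cons /=; ring.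
Qed.

Lemma wt_summable (p : R) : 1 < p -> exists2 S, 0 < S & l1le (wt (- p)) S.
Proof.
move=> p1; exists (1 + 2 * (1 + (p - 1)^-1)).
  have : 0 < (p - 1)^-1 by rewrite invr_gt0; lra.
  lra.
move=> s us; have [n sn] := win_sup s.
apply: le_trans (ler_sum_sub us sn (wt_ge0 _)) _.
suff h : \sum_(x <- win n) wt (- p) x <=
    1 + 2 * \sum_(j < n) j.+1%:R `^ (- (p - 1 + 1)) :> R.
  apply: le_trans h _; rewrite lerD2l ler_wpM2l //; apply: pseries_bound; lra.
elim: n {sn} => [|n IH].
  rewrite big_ord0 mulr0 addr0 sum_win big_ord1.
  by rewrite /wt /jb /= expr0n /= addr0 sqrtr1 powR1.
rewrite sum_winS big_ord_recr /= wtN.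
have h : wt (- p) n.+1%:Z <= n.+1%:R `^ (- (p - 1 + 1)) :> R.
  have -> : p - 1 + 1 = p by ring.
  rewrite /wt !powRN lef_pV2 ?posrE ?powR_gt0 ?jb_gt0 //.
  apply: ge0_ler_powR; rewrite ?nnegrE ?jb_ge0 //; first lra.
  by apply: le_trans (jb_norm _); rewrite ger0_norm.
rewrite mulrDr; lra.
Qed.

End Series.

(** * The modulus *)

Section ComplexNorm.
Context {R : realType}.
Implicit Types z w : R[i].

Lemma normc_ge0 z : 0 <= normc z.
Proof. by case: z => a b /=; exact: sqrtr_ge0. Qed.

Lemma normc_sqr z : normc z ^+ 2 = complex.Re z ^+ 2 + complex.Im z ^+ 2.
Proof. by case: z => a b /=; rewrite sqr_sqrtr // addr_ge0 ?sqr_ge0. Qed.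

Lemma normcD z w : normc (z + w) <= normc z + normc w.
Proof. exact: le_normcD. Qed.

Lemma normcB z w : normc (z - w) <= normc z + normc w.
Proof. by apply: le_trans (normcD _ _) _; rewrite normcN. Qed.

Lemma normc_sum (I : Type) (r : seq I) (F : I -> R[i]) :
  normc (\sum_(i <- r) F i) <= \sum_(i <- r) normc (F i).
Proof.
elim: r => [|a r IH]; first by rewrite !big_nil ComplexField.Normc.normc0.
by rewrite !big_cons; apply: le_trans (normcD _ _) _; rewrite lerD2l.
Qed.

Lemma Re_le_normc z : `|complex.Re z| <= normc z.
Proof.
apply: le_sqr_of; first exact: normc_ge0.
by rewrite real_normK ?num_real // normc_sqr lerDl sqr_ge0.
Qed.

Lemma Im_le_normc z : `|complex.Im z| <= normc z.
Proof.
apply: le_sqr_of; first exact: normc_ge0.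
by rewrite real_normK ?num_real // normc_sqr lerDr sqr_ge0.
Qed.

Lemma normc_le z : normc z <= `|complex.Re z| + `|complex.Im z|.
Proof.
apply: le_sqr_of; first by rewrite addr_ge0.
rewrite normc_sqr -(real_normK (num_real (complex.Re z))).
rewrite -(real_normK (num_real (complex.Im z))).
have := normr_ge0 (complex.Re z); have := normr_ge0 (complex.Im z); nra.
Qed.

Lemma normc_real (x : R) : normc x%:C = `|x|.
Proof. by rewrite /= expr0n /= addr0 sqrtr_sqr. Qed.

Lemma normc_conj z : normc (conjc z) = normc z.
Proof. by case: z => a b /=; rewrite sqrrN. Qed.

Lemma normcX z n : normc (z ^+ n) = normc z ^+ n.
Proof.
elim: n => [|n IH]; first exact: ComplexField.Normc.normc1.
by rewrite !exprS ComplexField.Normc.normcM IH.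
Qed.

Lemma conj_mul z : ((conjc z) * z) = (normc z ^+ 2)%:C.
Proof.
by case: z => a b; rewrite normc_sqr /=; apply/eqP; rewrite eq_complex /=;
   apply/andP; split; apply/eqP; ring.
Qed.

End ComplexNorm.

(** * Sobolev balls of coefficient sequences *)

Section Sobolev.
Context {R : realType}.
Implicit Types (a b c e q : int -> R[i]) (s t g A B : R).

(** The ball of radius [B] of H^s, in terms of Fourier coefficients. A sequence
    [c] is not required to come from a function. *)
Definition hball s c B :=
  0 <= B /\ l2le (fun x => wt s x * normc (c x)) B.

Lemma hball_ge0 s c B : hball s c B -> 0 <= B. Proof. by case. Qed.

Lemma hball_le s c A B : hball s c A -> A <= B -> hball s c B.
Proof.
move=> [A0 h] AB; split; first lra.
by move=> r ur; apply: le_trans (h r ur) _; rewrite ler_pXn2r ?nnegrE //; lra.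
Qed.

Lemma hball_dom s t c d K B : 0 <= K ->
  (forall x, wt s x * normc (c x) <= K * (wt t x * normc (d x))) ->
  hball t d B -> hball s c (K * B).
Proof.
move=> K0 h [B0 hB]; split; first exact: mulr_ge0.
move=> r ur; rewrite exprMn.
apply: le_trans (_ : \sum_(x <- r) K ^+ 2 * (wt t x * normc (d x)) ^+ 2 <= _).
  apply: ler_sum => x _; rewrite -exprMn ler_pXn2r ?nnegrE //.
    by rewrite mulr_ge0 ?wt_ge0 ?normc_ge0.
  by rewrite !mulr_ge0 ?wt_ge0 ?normc_ge0.
by rewrite -mulr_sumr ler_wpM2l ?sqr_ge0 //; exact: hB.
Qed.

Lemma hball_dom1 s t c d B :
  (forall x, wt s x * normc (c x) <= wt t x * normc (d x)) ->
  hball t d B -> hball s c B.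
Proof.
move=> h hB; rewrite -[B]mul1r; apply: hball_dom ler01 _ hB => x.
by rewrite mul1r.
Qed.

Lemma hball_weaken s t c B : s <= t -> hball t c B -> hball s c B.
Proof.
move=> st; apply: hball_dom1 => x; apply: ler_wpM2r; first exact: normc_ge0.
exact: wt_le.
Qed.

Lemma hball_coef s c d B : (forall x, normc (c x) <= normc (d x)) ->
  hball s d B -> hball s c B.
Proof.
by move=> h; apply: hball_dom1 => x; apply: ler_wpM2l => //; exact: wt_ge0.
Qed.

Lemma hball_ext s c d B : c =1 d -> hball s c B -> hball s d B.
Proof. by move=> cd; apply: hball_coef => x; rewrite cd. Qed.

Lemma hball_scale s c B z : hball s c B -> hball s (fun x => z * c x) (normc z * B).
Proof.
apply: hball_dom; first exact: normc_ge0.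
by move=> x; rewrite ComplexField.Normc.normcM mulrCA.
Qed.

Lemma hball_add s c d A B : hball s c A -> hball s d B ->
  hball s (fun x => c x + d x) (A + B).
Proof.
move=> [A0 hA] [B0 hB]; split; first exact: addr_ge0.
move=> r ur.
apply: le_trans (l2_add A0 B0 (hA r ur) (hB r ur)).
apply: ler_sum => x _.
rewrite ler_pXn2r ?nnegrE ?addr_ge0 ?mulr_ge0 ?wt_ge0 ?normc_ge0 //.
by rewrite -mulrDr ler_wpM2l ?wt_ge0 ?normcD.
Qed.

Lemma hball_opp s c B : hball s c B -> hball s (fun x => - c x) B.
Proof. by apply: hball_coef => x; rewrite normcN. Qed.

Lemma hball_sub s c d A B : hball s c A -> hball s d B ->
  hball s (fun x => c x - d x) (A + B).
Proof. by move=> hA /hball_opp hB; exact: hball_add. Qed.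

Lemma hb0 s : hball s (fun=> 0) 0.
Proof.
split => // r _; rewrite expr0n big1 // => x _.
by rewrite ComplexField.Normc.normc0 mulr0 expr0n.
Qed.

Lemma hball_delta s : hball s (fun x => (x == 0)%:R) 1.
Proof.
split => // r ur; rewrite expr1n.
have e x : (wt s x * normc ((x == 0)%:R : R[i])) ^+ 2 = (x == 0)%:R :> R.
  case: eqP => [->|_]; last by rewrite ComplexField.Normc.normc0 mulr0 expr0n.
  rewrite ComplexField.Normc.normc1 mulr1.
  by rewrite /wt /jb expr0n addr0 sqrtr1 powR1 expr1n.
under eq_bigr do rewrite e.
apply: le_trans (_ : (0 \in r)%:R <= _); last by case: (_ \in _).
elim: r ur => [|x r IH] /=; first by rewrite big_nil.
move=> /andP[xr /IH h]; rewrite big_cons in_cons eq_sym.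
case: eqVneq xr => [<-|] xr; last by rewrite add0r.
move: h; rewrite (negbTE xr) => h; rewrite -[leRHS]addr0; exact: lerD.
Qed.

(** Fatou's lemma on coefficients: every finite sum is a limit of bounded ones. *)
Lemma hball_lim s c B : 0 <= B ->
  (forall eps, 0 < eps -> exists2 d, hball s d B &
     forall x, normc (c x - d x) <= eps) -> hball s c B.
Proof.
move=> B0 h; split => // r ur.
set X := \sum_(x <- r) _.
have X0 : 0 <= X by apply: sumr_ge0 => x _; exact: sqr_ge0.
rewrite -(sqr_sqrtr X0) ler_pXn2r ?nnegrE ?sqrtr_ge0 //.
apply/ler_addgt0Pr => eps eps0.
set D := Num.sqrt (\sum_(x <- r) wt s x ^+ 2).
have D0 : 0 <= D by exact: sqrtr_ge0.
have D1 : 0 < D + 1 by rewrite ltr_wpDl.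
have e0 : 0 < eps / (D + 1) by rewrite divr_gt0.
have [d [_ hd] cd] := h _ e0.
have ea : \sum_(x <- r) (wt s x * (eps / (D + 1))) ^+ 2 <= (D * (eps / (D + 1))) ^+ 2.
  under eq_bigr do rewrite exprMn.
  rewrite -mulr_suml (exprMn _ D) ler_wpM2r ?sqr_ge0 // sqr_sqrtr //.
  by apply: sumr_ge0 => x _; exact: sqr_ge0.
have De0 : 0 <= D * (eps / (D + 1)) by rewrite mulr_ge0 // ltW.
apply: le_trans (_ : B + D * (eps / (D + 1)) <= _).
  apply: le_sqr_of; first exact: addr_ge0.
  rewrite sqr_sqrtr //.
  apply: le_trans (l2_add B0 De0 (hd r ur) ea).
  apply: ler_sum => x _.
  have e0' := ltW e0.
  apply: lerXn2r; rewrite ?nnegrE; first by rewrite mulr_ge0 ?wt_ge0 ?normc_ge0.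
    by apply: addr_ge0; apply: mulr_ge0; rewrite ?wt_ge0 ?normc_ge0.
  rewrite -mulrDr ler_wpM2l ?wt_ge0 //.
  rewrite -(subrK (d x) (c x)); apply: le_trans (normcD _ _) _.
  by rewrite addrC lerD2l.
rewrite lerD2l mulrA ler_pdivrMr //; nra.
Qed.

(** Cauchy-Schwarz against the summable weight <x>^(-2 (s - t)). *)
Lemma hball_l1 s t : 1 / 2 < s - t -> exists2 L, 0 < L &
  forall c B, hball s c B -> l1le (fun x => wt t x * normc (c x)) (L * B).
Proof.
move=> st.
have [S S0 hS] := @wt_summable R (2 * (s - t)) ltac:(lra).
exists (Num.sqrt S); first by rewrite sqrtr_gt0.
move=> c B [B0 hB] r ur.
have -> : \sum_(x <- r) wt t x * normc (c x) =
  \sum_(x <- r) wt (t - s) x * (wt s x * normc (c x)).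
  by apply: eq_bigr => x _; rewrite mulrA -wtD subrK.
apply: cs_sum_le; [exact: sqrtr_ge0|exact: B0| |exact: hB].
rewrite sqr_sqrtr; last exact: ltW.
apply: le_trans (hS r ur).
by apply: ler_sum => x _; rewrite expr2 -wtD; apply: wt_le; lra.
Qed.

(** H^s is an algebra for s > 1/2: <x>^s is at most a multiple of
    <x - y>^s + <y>^s, and the factor left without weight is in l^1. *)
Lemma hball_conv s : 1 / 2 < s -> exists2 K, 0 < K &
  forall a b c A B (r : seq int), uniq r -> hball s a A -> hball s b B ->
  (forall x, normc (c x) <= \sum_(y <- r) normc (a (x - y)) * normc (b y)) ->
  hball s c (K * A * B).
Proof.
move=> s2; have [L L0 hL] := @hball_l1 s 0 ltac:(lra).
have p0 : 0 < 2 `^ s :> R by rewrite powR_gt0.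
exists (2 * 2 `^ s * L); first by rewrite !mulr_gt0.
move=> a b c A B r ur ha hbb hc.
have [A0 ha2] := ha; have [B0 hb2] := hbb.
have l1 d D : hball s d D -> l1le (fun x => normc (d x)) (L * D).
  move=> /hL h q uq; apply: le_trans (h q uq).
  by apply: ler_sum => x _; rewrite wt0 mul1r.
have K0 : 0 <= 2 * 2 `^ s * L * A * B by rewrite !mulr_ge0 // ltW.
split => // q uq.
set X := \sum_(x <- q) _.
have X0 : 0 <= X by apply: sumr_ge0 => x _; exact: sqr_ge0.
set sX := Num.sqrt X; have sX0 : 0 <= sX by exact: sqrtr_ge0.
have XE : X = sX ^+ 2 by rewrite sqr_sqrtr.
(* tested against the convolution itself, the norm is a trilinear form *)
suff: sX * sX <= sX * (2 * 2 `^ s * L * A * B).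
  rewrite XE; case: (eqVneq sX 0) => [->|sn0]; first by rewrite expr0n sqr_ge0.
  rewrite ler_pM2l; last by rewrite lt_def sn0.
  by move=> h; rewrite ler_pXn2r ?nnegrE.
rewrite -expr2 -XE.
pose g x := wt s x * normc (c x).
have g0 x : 0 <= g x by rewrite mulr_ge0 ?wt_ge0 ?normc_ge0.
apply: le_trans (_ : \sum_(x <- q) \sum_(y <- r) 2 `^ s *
   ((wt s (x - y) * normc (a (x - y))) * g x * normc (b y) +
     normc (a (x - y)) * g x * (wt s y * normc (b y))) <= _).
  apply: ler_sum => x _.
  apply: le_trans (_ : g x * (wt s x * \sum_(y <- r) normc (a (x - y)) * normc (b y)) <= _).
    by rewrite expr2 -/(g x) ler_wpM2l // /g ler_wpM2l ?wt_ge0.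
  rewrite !mulr_sumr; apply: ler_sum => y _.
  have h := @wt_sub R s x y ltac:(lra).
  set w := wt s x in h *; set u := wt s (x - y) in h *; set v := wt s y in h *.
  set P := normc _; set Q := normc _.
  have -> : 2 `^ s * (u * P * g x * Q + P * g x * (v * Q)) =
    g x * ((2 `^ s * (u + v)) * (P * Q)) by ring.
  apply: ler_wpM2l => //; apply: ler_wpM2r => //.
  by rewrite mulr_ge0 ?normc_ge0.
under eq_bigr do rewrite -mulr_sumr big_split /=.
rewrite -mulr_sumr big_split /=.
have h1 := @young_212 R (fun x => wt s x * normc (a x)) g (fun y => normc (b y))
  q r sX (L * B) A (fun x => normc_ge0 _) uq ur sX0 A0.
have h2 := @young_221 R (fun x => normc (a x)) g (fun y => wt s y * normc (b y))
  q r sX B (L * A) (fun x => normc_ge0 _) uq ur sX0 B0.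
have gX : \sum_(x <- q) g x ^+ 2 <= sX ^+ 2 by rewrite -XE.
have {}h1 := h1 gX (l1 _ _ hbb) ha2.
have {}h2 := h2 gX (hb2 r ur) (l1 _ _ ha).
have -> : sX * (2 * 2 `^ s * L * A * B) =
  2 `^ s * (A * sX * (L * B) + L * A * sX * B) by ring.
by rewrite ler_pM2l // lerD.
Qed.

(** Energy estimate for transport by a real function with coefficients [q]: the
    derivative that falls on [e] costs nothing in the H^g inner product. *)
Lemma hball_energy g : 3 / 2 < g -> exists2 K, 0 < K &
  forall e q E Q (r : seq int), uniq r -> hball g e E -> hball g q Q ->
  (forall x, q (- x) = (conjc (q x))) ->
  `|\sum_(x <- r) \sum_(y <- r) wt g x ^+ 2 * y%:~R *
     complex.Re ((0 +i* 1) * ((conjc (e x)) * e y * q (x - y)))| <= K * Q * E ^+ 2.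
Proof.
move=> g32; have [L L0 hL] := @hball_l1 g 1 ltac:(lra).
have p0 : 0 < 2 `^ g :> R by rewrite powR_gt0.
set k := 4 * g * 2 `^ g + 1.
have k0 : 0 < k by rewrite /k; nra.
exists (3 / 2 * k * L); first by rewrite !mulr_gt0 //; lra.
move=> e q E Q r ur he hq qJ.
have [E0 he2] := he; have [Q0 hq2] := hq.
pose p x y := complex.Re ((0 +i* 1) * ((conjc (e x)) * e y * q (x - y))).
(* [q] being real, the form is antisymmetric up to the weights, hence equal to
   half of its commutator *)
have pN x y : p y x = - p x y.
  rewrite /p -(opprB x y) qJ.
  case: (e x) (e y) (q (x - y)) => [a1 a2] [b1 b2] [c1 c2] /=.
  by rewrite /=; ring.
set S := \sum_(x <- r) _.
have S2 : S = 2^-1 * \sum_(x <- r) \sum_(y <- r)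
    (y%:~R * wt g x ^+ 2 - x%:~R * wt g y ^+ 2) * p x y.
  have S1 : S = \sum_(x <- r) \sum_(y <- r) - (x%:~R * wt g y ^+ 2 * p x y).
    rewrite /S exchange_big /=; apply: eq_bigr => x _; apply: eq_bigr => y _.
    by rewrite -/(p y x) pN; ring.
  rewrite (_ : \sum_(x <- r) _ = S + S); first by field.
  rewrite [in X in _ = _ + X]S1 /S -big_split; apply: eq_bigr => x _.
  by rewrite -big_split; apply: eq_bigr => y _ /=; rewrite /p; ring.
have pb x y : `|p x y| <= normc (e x) * normc (e y) * normc (q (x - y)).
  apply: le_trans (Re_le_normc _) _.
  rewrite !ComplexField.Normc.normcM normc_conj.
  by rewrite (_ : normc (0 +i* 1) = 1) ?mul1r //= expr0n expr1n add0r sqrtr1.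
rewrite S2 normrM ger0_norm; last lra.
have h1 := @young_221 R (fun z => wt 1 z * normc (q z)) (fun x => wt g x * normc (e x))
  (fun x => wt g x * normc (e x)) r r E E (L * Q)
  (fun x => mulr_ge0 (wt_ge0 _ _) (normc_ge0 _)) ur ur E0 E0 (he2 r ur) (he2 r ur) (hL _ _ hq).
have h2 := @young_212 R (fun z => wt g z * normc (q z)) (fun x => wt g x * normc (e x))
  (fun x => wt 1 x * normc (e x)) r r E (L * E) Q
  (fun x => mulr_ge0 (wt_ge0 _ _) (normc_ge0 _)) ur ur E0 Q0 (he2 r ur) (hL _ _ he) hq2.
have h3 := @young_122 R (fun z => wt g z * normc (q z)) (fun x => wt 1 x * normc (e x))
  (fun x => wt g x * normc (e x)) r r (L * E) E Q
  (fun x => mulr_ge0 (wt_ge0 _ _) (normc_ge0 _)) ur ur E0 Q0 (hL _ _ he) (he2 r ur) hq2.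
have -> : 3 / 2 * k * L * Q * E ^+ 2 =
  2^-1 * (k * (L * Q * E * E + Q * E * (L * E) + Q * E * (L * E))) by field.
apply: ler_wpM2l; first lra.
apply: le_trans (ler_norm_sum _ _ _) _.
apply: le_trans (_ : k * (\sum_(x <- r) \sum_(y <- r)
    (wt 1 (x - y) * normc (q (x - y))) * (wt g x * normc (e x)) * (wt g y * normc (e y))
  + \sum_(x <- r) \sum_(y <- r)
    (wt g (x - y) * normc (q (x - y))) * (wt g x * normc (e x)) * (wt 1 y * normc (e y))
  + \sum_(x <- r) \sum_(y <- r)
    (wt g (x - y) * normc (q (x - y))) * (wt 1 x * normc (e x)) * (wt g y * normc (e y))) <= _);
  last by apply: ler_wpM2l; [exact: ltW|rewrite !lerD].
rewrite -!big_split mulr_sumr; apply: ler_sum => x _ /=.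
apply: le_trans (ler_norm_sum _ _ _) _.
rewrite -!big_split mulr_sumr; apply: ler_sum => y _ /=.
rewrite normrM.
apply: le_trans (ler_pM (normr_ge0 _) (normr_ge0 _) (@kernel_le R g x y ltac:(lra)) (pb x y)) _.
rewrite -/k !wt1 le_eqVlt; apply/orP; left; apply/eqP.
by move: (wt g x) (wt g y) (wt g _) (jb x) (jb y) (jb _) (normc _) (normc _) (normc _) => *; ring.
Qed.

End Sobolev.

(** * Integration over a period *)

Section RealIntegral.
Context {R : realType}.
Implicit Types (f g h : R -> R).

Definition rint h : R := \int[lebesgue_measure]_(x in (@torus R)) h x.

Definition rbmeas h :=
  measurable_fun (@torus R) h /\ exists K, forall x, torus x -> `|h x| <= K.

Lemma measurable_torus : measurable (@torus R).
Proof. exact: measurable_itv. Qed.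

Lemma torus_measure : lebesgue_measure (@torus R) = (2 * pi)%:E.
Proof.
rewrite /torus lebesgue_measure_itv /= lte_fin.
have p0 : 0 < (pi : R) by exact: pi_gt0.
case: ifP => [_|]; last by rewrite -subr_gt0 opprK addr_gt0.
by rewrite -EFinB; congr (_%:E); ring.
Qed.

Lemma rbmeas_integrable h : rbmeas h -> lebesgue_measure.-integrable (@torus R) (EFin \o h).
Proof.
move=> [mh [K hK]]; apply: measurable_bounded_integrable => //.
- exact: measurable_torus.
- exact: (eq_ind_r (fun z => (z < +oo)%E) (ltry _) torus_measure).
- exists K; split; first exact: num_real.
  move=> x Kx y ty; apply: le_trans (ltW Kx); exact: hK.
Qed.

Lemma rbmeasD f g : rbmeas f -> rbmeas g -> rbmeas (fun x => f x + g x).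
Proof.
move=> [mf [K hK]] [mg [L hL]]; split; first exact: measurable_funD.
exists (K + L) => x tx; apply: le_trans (ler_normD _ _) _.
by rewrite lerD ?hK ?hL.
Qed.

Lemma rbmeasM f g : rbmeas f -> rbmeas g -> rbmeas (fun x => f x * g x).
Proof.
move=> [mf [K hK]] [mg [L hL]]; split; first exact: measurable_funM.
exists (K * L) => x tx; rewrite normrM; apply: ler_pM => //.
  exact: hK.
exact: hL.
Qed.

Lemma rbmeas_cst (a : R) : rbmeas (fun=> a).
Proof. by split; [exact: measurable_cst|exists `|a|]. Qed.

Lemma rbmeasN f : rbmeas f -> rbmeas (fun x => - f x).
Proof.
move=> hf; have -> : (fun x => - f x) = (fun x => -1 * f x).
  by apply/funext => x; rewrite mulN1r.
exact: rbmeasM (rbmeas_cst _) hf.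
Qed.

Lemma rbmeasB f g : rbmeas f -> rbmeas g -> rbmeas (fun x => f x - g x).
Proof. by move=> hf hg; apply: rbmeasD => //; exact: rbmeasN. Qed.

Lemma rbmeas_cont f : continuous f -> rbmeas f.
Proof.
move=> cf; split.
  exact: measurable_funS (continuous_measurable_fun cf).
have p0 : - (pi : R) <= pi by rewrite -subr_ge0 opprK addr_ge0 // pi_ge0.
have cf' : {within `[- pi, pi], continuous f} by exact: continuous_subspaceT.
have cn : {within `[- pi, pi], continuous (fun x => - f x)}.
  by apply: continuous_subspaceT => x; apply: cvgN; exact: cf.
have [c _ hc] := EVT_max p0 cf'.
have [d _ hd] := EVT_max p0 cn.
exists (Num.max (f c) (- f d)) => x; rewrite /torus /= in_itv /= => /andP[/ltW a /ltW b].
have xi : x \in `[- (pi : R), pi] by rewrite in_itv /= a b.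
by rewrite ler_norml lerNl !le_max hc // hd // orbT.
Qed.

Lemma rintD f g : rbmeas f -> rbmeas g -> rint (fun x => f x + g x) = rint f + rint g.
Proof.
move=> hf hg; apply: RintegralD; [exact: measurable_torus|exact: rbmeas_integrable..].
Qed.

Lemma rintZ (a : R) f : rbmeas f -> rint (fun x => a * f x) = a * rint f.
Proof.
move=> hf; apply: RintegralZl; [exact: measurable_torus|exact: rbmeas_integrable].
Qed.

Lemma rintB f g : rbmeas f -> rbmeas g -> rint (fun x => f x - g x) = rint f - rint g.
Proof.
move=> hf hg; apply: RintegralB; [exact: measurable_torus|exact: rbmeas_integrable..].
Qed.

Lemma rint_cst (a : R) : rint (fun=> a) = a * (2 * pi).
Proof.
rewrite /rint Rintegral_cst; last exact: measurable_torus.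
by congr (_ * _); exact: (congr1 fine torus_measure).
Qed.

Lemma rint_le f g : rbmeas f -> rbmeas g -> (forall x, torus x -> f x <= g x) ->
  rint f <= rint g.
Proof.
move=> hf hg fg.
exact: (@le_Rintegral _ _ _ (@lebesgue_measure R) torus f g (measurable_itv _)
  (rbmeas_integrable hf) (rbmeas_integrable hg) fg).
Qed.

Lemma eq_rint f g : (forall x, torus x -> f x = g x) -> rint f = rint g.
Proof. by move=> fg; apply: eq_Rintegral => x /set_mem; exact: fg. Qed.

Lemma rint_norm f K : rbmeas f -> (forall x, torus x -> `|f x| <= K) ->
  `|rint f| <= K * (2 * pi).
Proof.
move=> hf hK; rewrite ler_norml -mulNr -!rint_cst; apply/andP; split.
  apply: rint_le => //; first exact: rbmeas_cst.
  by move=> x /hK; rewrite ler_norml => /andP[].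
apply: rint_le => //; first exact: rbmeas_cst.
by move=> x /hK; rewrite ler_norml => /andP[].
Qed.

Lemma rint_FTC (F f : R -> R) : (forall x : R, is_derive x (1 : R) F (f x)) ->
  continuous f -> rint f = F pi - F (- pi).
Proof.
move=> dF cf; have p0 : - (pi : R) < pi.
  by rewrite -subr_gt0 opprK addr_gt0 // pi_gt0.
have dc (x : R) : {for x, continuous F}.
  by apply/differentiable_continuous/derivable1_diffP; case: (dF x).
have cfi : {within `[- (pi : R), pi], continuous f} by exact: continuous_subspaceT.
have h := @continuous_FTC2 R f F (- pi) pi p0 cfi.
have {}h : (\int[lebesgue_measure]_(x in `[(- pi)%R, pi]) (f x)%:E = (F pi)%:E - (F (- pi))%:E)%E.
  apply: h.
    split.
    + by move=> x _; case: (dF x).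
    + exact: cvg_at_right_filter (dc _).
    + exact: cvg_at_left_filter (dc _).
  by move=> x _; rewrite derive1E; case: (dF x).
have hi := rbmeas_integrable (rbmeas_cont cf).
rewrite /rint /torus Rintegral_itv_bndo_bndc //.
rewrite Rintegral_itv_obnd_cbnd; first by rewrite /Rintegral h.
have ho : lebesgue_measure.-integrable `[- (pi : R), pi] (EFin \o f).
  by apply: continuous_compact_integrable => //; exact: segment_compact.
apply: integrableS ho => //.
by move=> x /=; rewrite !in_itv /= => /andP[/ltW -> ->].
Qed.

(** The boundary terms cancel because both functions take the same value at the
    two ends of the period. *)
Lemma rint_parts (F f G g : R -> R) :
  (forall x : R, is_derive x (1 : R) F (f x)) ->
  (forall x : R, is_derive x (1 : R) G (g x)) ->
  continuous f -> continuous g ->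
  F pi = F (- pi) -> G pi = G (- pi) ->
  rint (fun x => f x * G x) = - rint (fun x => F x * g x).
Proof.
move=> dF dG cf cg Fp Gp.
have cF : continuous F.
  by move=> x; apply/differentiable_continuous/derivable1_diffP; case: (dF x).
have cG : continuous G.
  by move=> x; apply/differentiable_continuous/derivable1_diffP; case: (dG x).
have cfG : continuous (fun x => f x * G x).
  by move=> x; apply: cvgM; [exact: cf|exact: cG].
have cFg : continuous (fun x => F x * g x).
  by move=> x; apply: cvgM; [exact: cF|exact: cg].
apply/eqP; rewrite -addr_eq0 -rintD; [|exact: rbmeas_cont..].
have dFG (x : R) : is_derive x (1 : R) (F * G) (f x * G x + F x * g x).
  apply: is_derive_eq (is_deriveM (dF x) (dG x)) _.
  by rewrite /GRing.scale /=; ring.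
apply/eqP; rewrite (rint_FTC dFG); first by rewrite !fctE Fp Gp subrr.
by move=> x; apply: cvgD; [exact: cfG|exact: cFg].
Qed.

End RealIntegral.

(** * The exponentials *)

Section Modes.
Context {R : realType}.
Implicit Types (x y : R) (xi eta : int).

Lemma expiD x y : expi (x + y) = expi x * expi y.
Proof.
rewrite /expi cosD sinD; apply/eqP; rewrite eq_complex /=.
by apply/andP; split; apply/eqP; ring.
Qed.

Lemma expi0 : expi 0 = 1 :> R[i].
Proof. by rewrite /expi cos0 sin0. Qed.

Lemma expi_conj x : (conjc (expi x)) = expi (- x).
Proof. by rewrite /expi cosN sinN. Qed.

Lemma normc_expi x : normc (expi x) = 1.
Proof. by rewrite /= cos2Dsin2 sqrtr1. Qed.

Lemma modeD xi eta x : mode (xi + eta) x = mode xi x * mode eta x.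
Proof. by rewrite /mode intrD mulrDl expiD. Qed.

Lemma mode0 x : mode 0 x = 1.
Proof. by rewrite /mode mul0r expi0. Qed.

Lemma mode_conj xi x : (conjc (mode xi x)) = mode (- xi) x.
Proof. by rewrite /mode expi_conj mulrNz mulNr. Qed.

Lemma normc_mode xi x : normc (mode xi x) = 1.
Proof. exact: normc_expi. Qed.

Lemma sin_2pin xi : sin (xi%:~R * (pi *+ 2)) = 0 :> R.
Proof.
have h (n : nat) : sin (n%:R * (pi *+ 2)) = 0 :> R.
  elim: n => [|n IH]; first by rewrite mul0r sin0.
  by rewrite -natr1 mulrDl mul1r sinD2pi.
by case: (intP xi) => [|n|n]; rewrite ?mul0r ?sin0 // ?mulrNz ?mulNr ?sinN h ?oppr0.
Qed.

Lemma cos_2pin xi : cos (xi%:~R * (pi *+ 2)) = 1 :> R.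
Proof.
have h (n : nat) : cos (n%:R * (pi *+ 2)) = 1 :> R.
  elim: n => [|n IH]; first by rewrite mul0r cos0.
  by rewrite -natr1 mulrDl mul1r cosD2pi.
by case: (intP xi) => [|n|n]; rewrite ?mul0r ?cos0 // ?mulrNz ?mulNr ?cosN h.
Qed.

Lemma is_derive_cosm xi x : is_derive x (1 : R) (fun y => cos (xi%:~R * (y + pi)))
  (- xi%:~R * sin (xi%:~R * (x + pi))).
Proof.
by apply: is_derive_eq; rewrite /GRing.scale /=; ring.
Qed.

Lemma is_derive_sinm xi x : is_derive x (1 : R) (fun y => sin (xi%:~R * (y + pi)))
  (xi%:~R * cos (xi%:~R * (x + pi))).
Proof.
by apply: is_derive_eq; rewrite /GRing.scale /=; ring.
Qed.

Lemma continuous_derive (F f : R -> R) :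
  (forall x : R, is_derive x (1 : R) F (f x)) -> continuous F.
Proof.
by move=> dF x; apply/differentiable_continuous/derivable1_diffP; case: (dF x).
Qed.

Lemma continuous_cosm xi : continuous (fun y : R => cos (xi%:~R * (y + pi))).
Proof. exact: continuous_derive (is_derive_cosm xi). Qed.

Lemma continuous_sinm xi : continuous (fun y : R => sin (xi%:~R * (y + pi))).
Proof. exact: continuous_derive (is_derive_sinm xi). Qed.

Lemma rint_cosm xi : rint (fun y : R => cos (xi%:~R * (y + pi))) = (xi == 0)%:R * (2 * pi).
Proof.
case: eqP => [->|/eqP xi0].
  rewrite mul1r -[RHS]mul1r -rint_cst; congr rint; apply/funext => y.
  by rewrite mul0r cos0.
have x0 : xi%:~R != 0 :> R by rewrite intr_eq0.
have d (x : R) : is_derive x (1 : R) (fun y => xi%:~R^-1 * sin (xi%:~R * (y + pi)))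
    (cos (xi%:~R * (x + pi))).
  have := @is_deriveZ _ _ _ _ (xi%:~R^-1 : R) x (1 : R) _ (is_derive_sinm xi x).
  by move/is_derive_eq; apply; rewrite /GRing.scale /= mulKf.
rewrite mul0r (rint_FTC d); last exact: continuous_cosm.
by rewrite addNr mulr0 sin0 mulr0 subr0 -mulr2n sin_2pin mulr0.
Qed.

Lemma rint_sinm xi : rint (fun y : R => sin (xi%:~R * (y + pi))) = 0.
Proof.
case: (eqVneq xi 0) => [->|xi0].
  rewrite -[RHS](mul0r (2 * pi)) -rint_cst; congr rint; apply/funext => y.
  by rewrite mul0r sin0.
have x0 : xi%:~R != 0 :> R by rewrite intr_eq0.
have d (x : R) : is_derive x (1 : R) (fun y => - xi%:~R^-1 * cos (xi%:~R * (y + pi)))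
    (sin (xi%:~R * (x + pi))).
  have := @is_deriveZ _ _ _ _ (- xi%:~R^-1 : R) x (1 : R) _ (is_derive_cosm xi x).
  by move/is_derive_eq; apply; rewrite /GRing.scale /=; field.
rewrite (rint_FTC d); last exact: continuous_sinm.
by rewrite addNr mulr0 cos0 -mulr2n cos_2pin subrr.
Qed.

End Modes.

(** * Fourier coefficients *)

Section FourierBasics.
Context {R : realType}.
Implicit Types (f g : R -> R[i]) (x : R) (xi eta : int) (c : int -> R[i]).

(** The class of functions on which all the linear and multiplicative rules for
    Fourier coefficients hold without further conditions. *)
Definition bmeas f := rbmeas (fun x => complex.Re (f x)) /\ rbmeas (fun x => complex.Im (f x)).

Lemma cReD (z w : R[i]) : complex.Re (z + w) = complex.Re z + complex.Re w.
Proof. by case: z; case: w. Qed.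
Lemma cImD (z w : R[i]) : complex.Im (z + w) = complex.Im z + complex.Im w.
Proof. by case: z; case: w. Qed.
Lemma cReM (z w : R[i]) : complex.Re (z * w) =
  complex.Re z * complex.Re w - complex.Im z * complex.Im w.
Proof. by case: z; case: w. Qed.
Lemma cImM (z w : R[i]) : complex.Im (z * w) =
  complex.Re z * complex.Im w + complex.Im z * complex.Re w.
Proof. by case: z; case: w. Qed.
Lemma conjcM (z w : R[i]) : conjc (z * w) = conjc z * conjc w.
Proof. exact: rmorphM. Qed.
Lemma conjcB (z w : R[i]) : conjc (z - w) = conjc z - conjc w.
Proof. exact: rmorphB. Qed.
Lemma Re_conj (z : R[i]) : complex.Re (conjc z) = complex.Re z. Proof. by case: z. Qed.
Lemma Im_conj (z : R[i]) : complex.Im (conjc z) = - complex.Im z. Proof. by case: z. Qed.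

Lemma bmeasD f g : bmeas f -> bmeas g -> bmeas (fun x => f x + g x).
Proof.
move=> [f1 f2] [g1 g2]; split.
  by under eq_fun do rewrite cReD; exact: rbmeasD.
by under eq_fun do rewrite cImD; exact: rbmeasD.
Qed.

Lemma bmeasM f g : bmeas f -> bmeas g -> bmeas (fun x => f x * g x).
Proof.
move=> [f1 f2] [g1 g2]; split.
  by under eq_fun do rewrite cReM; apply: rbmeasB; exact: rbmeasM.
by under eq_fun do rewrite cImM; apply: rbmeasD; exact: rbmeasM.
Qed.

Lemma bmeas_cst (z : R[i]) : bmeas (fun=> z).
Proof. by split; exact: rbmeas_cst. Qed.

Lemma bmeasZ z f : bmeas f -> bmeas (fun x => z * f x).
Proof. by move=> hf; apply: bmeasM => //; exact: bmeas_cst. Qed.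

Lemma bmeasN f : bmeas f -> bmeas (fun x => - f x).
Proof.
by move=> /(bmeasZ (-1)); under [X in bmeas X -> _]eq_fun do rewrite mulN1r.
Qed.

Lemma bmeasB f g : bmeas f -> bmeas g -> bmeas (fun x => f x - g x).
Proof. by move=> hf /bmeasN; exact: bmeasD. Qed.

Lemma bmeas_conj f : bmeas f -> bmeas (fun x => (conjc (f x))).
Proof.
move=> [f1 f2]; split; first by under eq_fun do rewrite Re_conj.
by under eq_fun do rewrite Im_conj; exact: rbmeasN.
Qed.

Lemma bmeasX f n : bmeas f -> bmeas (fun x => f x ^+ n).
Proof.
move=> hf; elim: n => [|n IH]; first exact: bmeas_cst.
by under eq_fun do rewrite exprS; exact: bmeasM.
Qed.

Lemma bmeas_mode xi : bmeas (mode xi).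
Proof.
split; apply: rbmeas_cont; [exact: continuous_cosm|exact: continuous_sinm].
Qed.

Lemma bmeas_sum (I : Type) (r : seq I) (F : I -> R -> R[i]) :
  (forall i, bmeas (F i)) -> bmeas (fun x => \sum_(i <- r) F i x).
Proof.
move=> h; elim: r => [|i r IH].
  by under eq_fun do rewrite big_nil; exact: bmeas_cst.
by under eq_fun do rewrite big_cons; exact: bmeasD.
Qed.

Lemma bmeas_real (h : R -> R) : rbmeas h -> bmeas (of_real h).
Proof. by move=> hh; split => //; exact: rbmeas_cst. Qed.

Lemma trig_sumE n c x : trig_sum n c x = \sum_(xi <- win n) c xi * mode xi x.
Proof. by rewrite sum_win. Qed.

Lemma bmeas_trig n c : bmeas (trig_sum n c).
Proof.
have -> : trig_sum n c = fun x => \sum_(xi <- win n) c xi * mode xi x.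
  by apply/funext => x; exact: trig_sumE.
by apply: bmeas_sum => xi; apply: bmeasZ; exact: bmeas_mode.
Qed.

Lemma integralCD f g : bmeas f -> bmeas g ->
  integralC torus (fun x => f x + g x) = integralC torus f + integralC torus g.
Proof.
move=> [f1 f2] [g1 g2]; rewrite /integralC -!/(rint _).
have -> : rint (fun x => complex.Re (f x + g x)) =
    rint (fun x => complex.Re (f x)) + rint (fun x => complex.Re (g x)).
  by rewrite -rintD //; apply: eq_rint => x _; rewrite cReD.
have -> : rint (fun x => complex.Im (f x + g x)) =
    rint (fun x => complex.Im (f x)) + rint (fun x => complex.Im (g x)).
  by rewrite -rintD //; apply: eq_rint => x _; rewrite cImD.
by [].
Qed.

Lemma integralCZ z f : bmeas f ->
  integralC torus (fun x => z * f x) = z * integralC torus f.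
Proof.
case: z => a b [f1 f2]; rewrite /integralC -!/(rint _).
have h (d : R) h : rbmeas h -> rbmeas (fun x => d * h x).
  by move=> hh; apply: rbmeasM => //; exact: rbmeas_cst.
set z := a +i* b.
have -> : rint (fun x => complex.Re (z * f x)) =
    a * rint (fun x => complex.Re (f x)) - b * rint (fun x => complex.Im (f x)).
  by rewrite -!rintZ // -rintB; [apply: eq_rint => x _; rewrite cReM|exact: h..].
have -> : rint (fun x => complex.Im (z * f x)) =
    a * rint (fun x => complex.Im (f x)) + b * rint (fun x => complex.Re (f x)).
  by rewrite -!rintZ // -rintD; [apply: eq_rint => x _; rewrite cImM|exact: h..].
by [].
Qed.

Lemma integralC_conj f : bmeas f ->
  integralC torus (fun x => (conjc (f x))) = (conjc (integralC torus f)).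
Proof.
move=> [f1 f2]; rewrite /integralC -!/(rint _) /=; congr (_ +i* _).
  by apply: eq_rint => x _; rewrite Re_conj.
rewrite -[RHS]mulN1r -rintZ //; apply: eq_rint => x _.
by rewrite Im_conj mulN1r.
Qed.

Lemma eq_integralC f g : (forall x, torus x -> f x = g x) ->
  integralC torus f = integralC torus g.
Proof.
by move=> fg; rewrite /integralC -!/(rint _); congr (_ +i* _);
  apply: eq_rint => x tx; rewrite fg.
Qed.

Lemma eq_fourier f g xi : (forall x, torus x -> f x = g x) ->
  fourier f xi = fourier g xi.
Proof.
by move=> fg; congr (_ * _); apply: eq_integralC => x tx; rewrite fg.
Qed.

Lemma fourierE f xi :
  fourier f xi = ((2 * pi)^-1)%:C * integralC torus (fun x => f x * mode (- xi) x).
Proof.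
rewrite /fourier; congr (_ * _); apply: eq_integralC => x _.
by rewrite /mode mulrNz mulNr.
Qed.

Lemma fourierD f g xi : bmeas f -> bmeas g ->
  fourier (fun x => f x + g x) xi = fourier f xi + fourier g xi.
Proof.
move=> hf hg; rewrite !fourierE -mulrDr; congr (_ * _).
have h u : bmeas u -> bmeas (fun x => u x * mode (- xi) x).
  by move=> hu; apply: bmeasM => //; exact: bmeas_mode.
rewrite -integralCD; [|exact: h..].
by apply: eq_integralC => x _; rewrite mulrDl.
Qed.

Lemma fourierZ z f xi : bmeas f -> fourier (fun x => z * f x) xi = z * fourier f xi.
Proof.
move=> hf; rewrite !fourierE mulrCA; congr (_ * _).
rewrite -integralCZ; last by apply: bmeasM => //; exact: bmeas_mode.
by apply: eq_integralC => x _; rewrite mulrA.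
Qed.

Lemma fourierN f xi : bmeas f -> fourier (fun x => - f x) xi = - fourier f xi.
Proof.
move=> hf; rewrite -[RHS]mulN1r -fourierZ //; apply: eq_fourier => x _.
by rewrite mulN1r.
Qed.

Lemma fourierB f g xi : bmeas f -> bmeas g ->
  fourier (fun x => f x - g x) xi = fourier f xi - fourier g xi.
Proof. by move=> hf hg; rewrite fourierD ?fourierN //; exact: bmeasN. Qed.

Lemma fourier_sum (I : Type) (r : seq I) (F : I -> R -> R[i]) xi :
  (forall i, bmeas (F i)) ->
  fourier (fun x => \sum_(i <- r) F i x) xi = \sum_(i <- r) fourier (F i) xi.
Proof.
move=> h; elim: r => [|i r IH].
  transitivity (0 * fourier (fun=> 0 : R[i]) xi); last by rewrite mul0r big_nil.
  rewrite -fourierZ; last exact: bmeas_cst.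
  by apply: eq_fourier => x _; rewrite big_nil mul0r.
rewrite big_cons -IH -fourierD //; last exact: bmeas_sum.
by apply: eq_fourier => x _; rewrite big_cons.
Qed.

Lemma fourier_shift f eta xi :
  fourier (fun x => f x * mode eta x) xi = fourier f (xi - eta).
Proof.
rewrite !fourierE; congr (_ * _); apply: eq_integralC => x _.
by rewrite -mulrA -modeD opprB.
Qed.

Lemma fourier_conj f xi : bmeas f -> fourier (fun x => (conjc (f x))) xi = (conjc (fourier f (- xi))).
Proof.
move=> hf; rewrite !fourierE conjcM conjc_real; congr (_ * _).
rewrite -integralC_conj; last by apply: bmeasM => //; exact: bmeas_mode.
apply: eq_integralC => x _.
by rewrite conjcM mode_conj opprK.
Qed.

Lemma fourier1 xi : fourier (fun=> 1 : R[i]) xi = (xi == 0)%:R.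
Proof.
have p0 : (2 * pi : R) != 0 by rewrite mulf_neq0 // gt_eqF // pi_gt0.
rewrite fourierE (@eq_integralC _ (mode (- xi))); last by move=> x _; rewrite mul1r.
rewrite /integralC -!/(rint _) /mode /=.
rewrite rint_cosm rint_sinm oppr_eq0.
case: eqP => _ /=; last by rewrite mul0r mulr0.
rewrite mul1r; apply/eqP; rewrite eq_complex /=.
by rewrite mulVf // !mulr0 mul0r subr0 addr0 !eqxx.
Qed.

(** Multiplication by a trigonometric polynomial is a finite convolution. Products
    of general functions are reached from here by approximation. *)
Lemma fourier_mul_trig f n c xi : bmeas f ->
  fourier (fun x => f x * trig_sum n c x) xi =
  \sum_(eta <- win n) c eta * fourier f (xi - eta).
Proof.
move=> hf.
rewrite (@eq_fourier _ (fun x => \sum_(eta <- win n) c eta * (f x * mode eta x)));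
  last by move=> x _; rewrite trig_sumE mulr_sumr; apply: eq_bigr => eta _; ring.
have h eta : bmeas (fun x => f x * mode eta x) by apply: bmeasM => //; exact: bmeas_mode.
rewrite fourier_sum => [|eta]; last exact: bmeasZ.
by apply: eq_bigr => eta _; rewrite fourierZ // fourier_shift.
Qed.

Lemma fourier_trig n c xi :
  fourier (trig_sum n c) xi = if (`|xi| <= n)%N then c xi else 0.
Proof.
rewrite (@eq_fourier _ (fun x => 1 * trig_sum n c x)); last by move=> x _; rewrite mul1r.
rewrite fourier_mul_trig; last exact: bmeas_cst.
under eq_bigr do rewrite fourier1 subr_eq0.
rewrite -mem_win; case: ifP => h.
  rewrite (bigD1_seq xi) ?win_uniq //= eqxx mulr1 big1 ?addr0 // => eta ne.
  by rewrite eq_sym (negbTE ne) mulr0.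
rewrite big1_seq // => eta /andP[_ he]; case: eqP => [e|]; last by rewrite mulr0.
by move: h; rewrite e he.
Qed.

Lemma normc_fourier_le f xi K : bmeas f -> (forall x, torus x -> normc (f x) <= K) ->
  normc (fourier f xi) <= 2 * K.
Proof.
move=> hf hK; have p0 : 0 < (2 * pi : R) by rewrite mulr_gt0 // pi_gt0.
have [h1 h2] : bmeas (fun x => f x * mode (- xi) x) by apply: bmeasM => //; exact: bmeas_mode.
have hq x : torus x -> normc (f x * mode (- xi) x) <= K.
  by move=> tx; rewrite ComplexField.Normc.normcM normc_mode mulr1 hK.
rewrite fourierE ComplexField.Normc.normcM normc_real ger0_norm; last first.
  by rewrite invr_ge0 ltW.
rewrite ler_pdivrMl //.
apply: le_trans (normc_le _) _; rewrite /integralC /= -!/(rint _).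
have -> : 2 * pi * (2 * K) = K * (2 * pi) + K * (2 * pi) by ring.
apply: lerD; apply: rint_norm => // x tx; apply: le_trans (hq x tx).
  exact: Re_le_normc.
exact: Im_le_normc.
Qed.

Lemma Re_mean_le (h : R -> R) K : rbmeas h -> (forall x, torus x -> h x <= K) ->
  complex.Re (fourier (of_real h) 0) <= K.
Proof.
move=> hh hK; have p0 : 0 < (2 * pi : R) by rewrite mulr_gt0 // pi_gt0.
rewrite fourierE oppr0.
rewrite (@eq_integralC _ (of_real h)); last by move=> x _; rewrite mode0 mulr1.
rewrite cReM /= mul0r subr0 ler_pdivrMl // mulrC -rint_cst.
by apply: rint_le => //; exact: rbmeas_cst.
Qed.

Lemma Re_mean_ge0 (h : R -> R) : rbmeas h -> (forall x, torus x -> 0 <= h x) ->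
  0 <= complex.Re (fourier (of_real h) 0).
Proof.
move=> hh hK; have p0 : 0 < (2 * pi : R) by rewrite mulr_gt0 // pi_gt0.
rewrite fourierE oppr0.
rewrite (@eq_integralC _ (of_real h)); last by move=> x _; rewrite mode0 mulr1.
rewrite cReM /= mul0r subr0; apply: mulr_ge0; first by rewrite invr_ge0 ltW.
rewrite -[X in X <= _](mul0r (2 * pi)) -rint_cst.
by apply: rint_le => //; exact: rbmeas_cst.
Qed.

(** Expand the mean of |g - S|^2, where S is the partial sum of g. *)
Lemma bessel g K n : 0 <= K -> bmeas g -> (forall x, torus x -> normc (g x) <= K) ->
  \sum_(xi <- win n) normc (fourier g xi) ^+ 2 <= K ^+ 2.
Proof.
move=> K0 hg hK; set S := trig_sum n (fourier g).
have hS : bmeas S by exact: bmeas_trig.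
set Q := (\sum_(xi <- win n) normc (fourier g xi) ^+ 2).
have sQ : forall c, (forall xi, xi \in win n -> c xi = (conjc (fourier g xi)) * fourier g xi) ->
   \sum_(xi <- win n) c xi = Q%:C.
  move=> c hc; rewrite rmorph_sum /=; rewrite [LHS]big_seq [RHS]big_seq.
  by apply: eq_bigr => xi /hc ->; exact: conj_mul.
have e1 : fourier (fun x => (conjc (g x)) * S x) 0 = Q%:C.
  rewrite fourier_mul_trig; last exact: bmeas_conj.
  apply: sQ => xi _.
  by rewrite fourier_conj // sub0r opprK mulrC.
have e2 : fourier (fun x => S x * (conjc (g x))) 0 = Q%:C.
  by rewrite -e1; apply: eq_fourier => x _; rewrite mulrC.
have e3 : fourier (fun x => (conjc (S x)) * S x) 0 = Q%:C.
  rewrite fourier_mul_trig; last exact: bmeas_conj.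
  apply: sQ => xi; rewrite mem_win => h.
  by rewrite fourier_conj // sub0r opprK fourier_trig h mulrC.
have e4 : fourier (fun x => g x * (conjc (S x))) 0 = Q%:C.
  have := fourier_conj 0 (bmeasM (bmeas_conj hg) hS).
  rewrite oppr0 e1 conjc_real => <-; apply: eq_fourier => x _.
  by rewrite conjcM conjcK.
have e5 : fourier (fun x => (conjc (g x - S x)) * (g x - S x)) 0 =
    fourier (fun x => (conjc (g x)) * g x) 0 - Q%:C.
  rewrite (@eq_fourier _
     (fun x => ((conjc (g x)) * g x - (conjc (g x)) * S x) - (g x * (conjc (S x)) - (conjc (S x)) * S x)));
    last by move=> x _; rewrite conjcB; ring.
  have b1 := bmeasM (bmeas_conj hg) hg; have b2 := bmeasM (bmeas_conj hg) hS.
  have b3 := bmeasM hg (bmeas_conj hS); have b4 := bmeasM (bmeas_conj hS) hS.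
  rewrite fourierB; [|exact: bmeasB..].
  by rewrite (fourierB _ b1 b2) (fourierB _ b3 b4) e1 e3 e4; ring.
have rE f : (fun x => (conjc (f x)) * f x) = of_real (fun x => normc (f x) ^+ 2).
  by apply/funext => x; exact: conj_mul.
have rr f : bmeas f -> rbmeas (fun x => normc (f x) ^+ 2).
  move=> [f1 f2]; under eq_fun do rewrite normc_sqr !expr2.
  by apply: rbmeasD; exact: rbmeasM.
have ReBQ (z : R[i]) (q : R) : complex.Re (z - q%:C) = complex.Re z - q by case: z.
move: e5; rewrite !rE => /(congr1 (@complex.Re R)); rewrite ReBQ.
have := Re_mean_ge0 (rr _ (bmeasB hg hS)) (fun x _ => sqr_ge0 _).
have : complex.Re (fourier (of_real (fun x => normc (g x) ^+ 2)) 0) <= K ^+ 2.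
  apply: Re_mean_le; first exact: rr.
  by move=> x tx; rewrite ler_pXn2r ?nnegrE ?normc_ge0 // hK.
move: (complex.Re _) (complex.Re _) => a b; lra.
Qed.

End FourierBasics.

(** * Fourier inversion *)

Section Inversion.
Context {R : realType}.
Implicit Types (f g : R -> R[i]) (h : R -> R) (x : R) (xi eta : int).

(** Under this factorisation the coefficients of [f] are differences of
    consecutive coefficients of [g], modulated by the phase at [x0], so that the
    partial sum at [x0] telescopes. *)
Lemma trig_telescope f g x0 n : bmeas f -> bmeas g ->
  (forall x, torus x -> f x - f x0 = g x * (mode 1 x * mode (-1) x0 - 1)) ->
  trig_sum n (fourier f) x0 - f x0 =
  mode (- n.+1%:Z) x0 * fourier g (- n.+1%:Z) - mode n%:Z x0 * fourier g n%:Z.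
Proof.
move=> hf hg h.
pose a k := mode (k - n.+1%:Z) x0 * fourier g (k - n.+1%:Z).
have e xi : fourier f xi = f x0 * (xi == 0)%:R +
   (mode (-1) x0 * fourier g (xi - 1) - fourier g xi).
  rewrite (@eq_fourier _ _ (fun x => f x0 * 1 + (mode (-1) x0 * (g x * mode 1 x) - g x))).
    have b1 : bmeas (fun x => f x0 * 1 : R[i]) by exact: bmeas_cst.
    have b2 : bmeas (fun x => g x * mode 1 x) by apply: bmeasM => //; exact: bmeas_mode.
    have b3 := bmeasZ (mode (-1) x0) b2.
    rewrite (fourierD _ b1 (bmeasB b3 hg)) (fourierB _ b3 hg) fourierZ; last exact: bmeas_cst.
    by rewrite fourier1 fourierZ // fourier_shift.
  by move=> x /h e; rewrite -[LHS](subrK (f x0)) e; ring.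
have -> : trig_sum n (fourier f) x0 - f x0 = \sum_(j < n.*2.+1) (a j%:Z - a j.+1%:Z).
  rewrite /trig_sum.
  have -> : f x0 = \sum_(j < n.*2.+1) f x0 * (j%:Z - n%:Z == 0)%:R * mode (j%:Z - n%:Z) x0.
    have hn : (n < n.*2.+1)%N by lia.
    rewrite (bigD1 (Ordinal hn)) //= subrr eqxx mode0 !mulr1 big1 ?addr0 // => j hj.
    rewrite subr_eq0; case: eqP => [[e']|]; last by rewrite mulr0 mul0r.
    by case/negP: hj; apply/eqP/val_inj.
  rewrite -sumrB; apply: eq_bigr => j _; rewrite e /a.
  have -> : j%:Z - n.+1%:Z = j%:Z - n%:Z - 1 by lia.
  have -> : j.+1%:Z - n.+1%:Z = j%:Z - n%:Z by lia.
  by rewrite (modeD (j%:Z - n%:Z) (-1)); ring.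
have -> : \sum_(j < n.*2.+1) (a j%:Z - a j.+1%:Z) = a 0 - a n.*2.+1%:Z.
  elim: n.*2.+1 => [|m IH]; first by rewrite big_ord0 subrr.
  by rewrite big_ord_recr /= IH; ring.
rewrite /a sub0r; have -> : n.*2.+1%:Z - n.+1%:Z = n%:Z by lia.
by [].
Qed.

(** A lower bound on all late coefficients contradicts Bessel's inequality. *)
Lemma bessel_small g K e p : 0 <= K -> 0 < e -> bmeas g ->
  (forall x, torus x -> normc (g x) <= K) ->
  exists2 n, (p <= n)%N &
    normc (fourier g (- n.+1%:Z)) + normc (fourier g n%:Z) <= e.
Proof.
move=> K0 e0 hg hK; apply: contrapT => h.
have big n : (p <= n)%N -> e ^+ 2 / 2 <=
   normc (fourier g (- n.+1%:Z)) ^+ 2 + normc (fourier g n%:Z) ^+ 2.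
  move=> pn; have : ~ (normc (fourier g (- n.+1%:Z)) + normc (fourier g n%:Z) <= e).
    by move=> hh; apply: h; exists n.
  move/negP; rewrite -ltNge.
  have := normc_ge0 (fourier g (- n.+1%:Z)); have := normc_ge0 (fourier g n%:Z).
  move: (normc _) (normc _) => a b a0 b0 hab.
  have : e ^+ 2 <= (a + b) ^+ 2.
    by rewrite ler_pXn2r ?nnegrE ?addr_ge0 ?(ltW e0) ?(ltW hab).
  have := sqr_ge0 (b - a); nra.
have sum_ge m : m%:R * (e ^+ 2 / 2) <= \sum_(xi <- win (p + m)) normc (fourier g xi) ^+ 2.
  have -> : m%:R * (e ^+ 2 / 2) = \sum_(n <- iota p m) (e ^+ 2 / 2).
    by rewrite big_const_seq count_predT size_iota iter_addr addr0 mulr_natl.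
  apply: le_trans (_ : \sum_(n <- iota p m)
    (normc (fourier g (- n.+1%:Z)) ^+ 2 + normc (fourier g n%:Z) ^+ 2) <= _).
    rewrite big_seq [leRHS]big_seq; apply: ler_sum => n.
    by rewrite mem_iota => /andP[/big].
  rewrite big_split /= -(big_map (fun n : nat => - n.+1%:Z) xpredT
     (fun xi => normc (fourier g xi) ^+ 2)).
  rewrite -(big_map (fun n : nat => n%:Z) xpredT
     (fun xi => normc (fourier g xi) ^+ 2)) -big_cat /=.
  apply: ler_sum_sub => [||xi]; last exact: sqr_ge0.
  - rewrite cat_uniq !map_inj_uniq ?iota_uniq //=; last 2 first.
    + by move=> i j []. 
    + by move=> i j /oppr_inj [].
    rewrite andbT; apply/hasPn => xi /mapP[i _ ->]; apply/negP => /mapP[j _]; lia.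
  - apply/allP; rewrite all_cat !all_map; apply/andP; split; apply/allP => i;
      rewrite mem_iota => hi.
      change (is_true (- i.+1%:Z \in win (p + m))); rewrite mem_win; lia.
    change (is_true (i%:Z \in win (p + m))); rewrite mem_win; lia.
have [m hm] : exists m : nat, K ^+ 2 < m%:R * (e ^+ 2 / 2).
  have e2 : 0 < e ^+ 2 / 2 by rewrite divr_gt0 // exprn_gt0.
  exists (Num.trunc (K ^+ 2 / (e ^+ 2 / 2))).+1.
  rewrite -ltr_pdivrMr //; exact: truncnS_gt.
have := bessel (p + m) K0 hg hK.
by move/(le_trans (sum_ge m)); rewrite leNgt hm.
Qed.

(** Makes e^(i (x - x0)) - 1 comparable with x - x0 over a whole period. *)
Lemma sin_lower (Y : R) : 0 < Y -> Y < pi ->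
  exists2 k, 0 < k & forall y, `|y| <= Y -> k * `|y| <= `|sin y|.
Proof.
move=> Y0 Ypi.
suff [k k0 hk] : exists2 k, 0 < k & forall y, 0 <= y <= Y -> k * y <= sin y.
  exists k => // y hy; case: (leP 0 y) => y0.
    rewrite (ger0_norm y0) in hy *; apply: le_trans (ler_norm _); apply: hk.
    by rewrite y0 hy.
  rewrite (ltr0_norm y0) in hy *; rewrite -normrN -sinN.
  by apply: le_trans (ler_norm _); apply: hk; rewrite hy oppr_ge0 ltW.
have c1 := cos1_gt0 R; have p2 := pi_ge2 R.
have [Y1|Y1] := leP Y 1.
  exists (cos 1) => // y /andP[y0 yY]; move: y0; rewrite le_eqVlt => /predU1P[<-|y0].
    by rewrite mulr0 sin0.
  have [z] := @MVT R sin cos 0 y y0 (fun x _ => is_derive_sin x)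
     (continuous_subspaceT (@continuous_sin R)).
  rewrite in_itv /= sin0 !subr0 => /andP[z0 zy] ->.
  by rewrite ler_pM2r //; apply: ltW; rewrite ltr_cos ?in_itv //=; lra.
have [d hd hmin] := @EVT_min R sin 1 Y (ltW Y1) (continuous_subspaceT (@continuous_sin R)).
have sd : 0 < sin d.
  by apply: sin_gt0_pi; move: hd; rewrite in_itv /= => /andP[]; lra.
exists (Num.min (cos 1) (sin d / Y)); first by rewrite lt_min c1 divr_gt0.
move=> y /andP[y0 yY]; case: (leP y 1) => y1.
  apply: le_trans (_ : cos 1 * y <= _); first by rewrite ler_wpM2r // ge_min lexx.
  move: y0; rewrite le_eqVlt => /predU1P[<-|y0]; first by rewrite mulr0 sin0.
  have [z] := @MVT R sin cos 0 y y0 (fun x _ => is_derive_sin x)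
     (continuous_subspaceT (@continuous_sin R)).
  rewrite in_itv /= sin0 !subr0 => /andP[z0 zy] ->.
  by rewrite ler_pM2r //; apply: ltW; rewrite ltr_cos ?in_itv //=; lra.
apply: le_trans (_ : sin d / Y * y <= _); first by rewrite ler_wpM2r // ge_min lexx orbT.
apply: le_trans (_ : sin d <= _); last by apply: hmin; rewrite in_itv /= yY ltW.
by rewrite mulrAC ler_pdivrMr // ler_pM2l.
Qed.

(** The quotient of [h x - h x0] by e^(i (x - x0)) - 1 is bounded because [h] is
    Lipschitz. *)
Lemma chernoff_quotient h (h' : R -> R) (x0 : R) :
  (forall x : R, is_derive x (1 : R) h (h' x)) -> continuous h' -> torus x0 ->
  exists g K, [/\ bmeas g, 0 <= K, forall x, torus x -> normc (g x) <= K &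
    forall x, torus x -> of_real h x - of_real h x0 =
      g x * (mode 1 x * mode (-1) x0 - 1)].
Proof.
move=> dh ch' tx0; have ch := continuous_derive dh.
have p0 := pi_gt0 R.
have [_ [L hL]] := rbmeas_cont ch'.
have tx0' := tx0; rewrite /torus /= in_itv /= in tx0'; move/andP: tx0' => [x01 x02].
have nx0 : `|x0| < pi by rewrite ltr_norml x01 x02.
have lip x : torus x -> `|h x - h x0| <= L * `|x - x0|.
  rewrite /torus /= in_itv /= => /andP[x1 x2].
  wlog suff H : / forall a b : R, - pi < a -> a < b -> b < pi -> `|h b - h a| <= L * `|b - a|.
    case: (ltgtP x x0) => [xx|xx|->]; last by rewrite !subrr normr0 mulr0.
      by rewrite distrC (distrC x); exact: H.
    exact: H.
  move=> a b a1 ab b2.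
  have [c] := MVT ab (fun y _ => dh y) (continuous_subspaceT ch).
  rewrite in_itv /= => /andP[ac cb] ->; rewrite normrM ler_wpM2r //.
  by apply: hL; rewrite /torus /= in_itv /=; lra.
have [k k0 hk] := @sin_lower ((pi + `|x0|) / 2) ltac:(have := normr_ge0 x0; lra) ltac:(lra).
(* [w] is the inverse of the sine of the half angle, with value 0 at [x0]; as a
   real power it is visibly measurable *)
pose s x := sin ((x - x0) / 2).
pose w x := s x * (s x ^+ 2) `^ (-1).
pose c x := cos ((x - x0) / 2).
pose d x := h x - h x0.
pose g x : R[i] := - (d x / 2) -i* (d x * w x * c x / 2).
have cs : continuous s.
  move=> x; apply: continuous_comp; last exact: continuous_sin.
  by apply: cvgMr_tmp; apply: cvgB; [exact: cvg_id|exact: cvg_cst].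
have cc : continuous c.
  move=> x; apply: continuous_comp; last exact: continuous_cos.
  by apply: cvgMr_tmp; apply: cvgB; [exact: cvg_id|exact: cvg_cst].
have cd : continuous d by move=> x; apply: cvgB; [exact: ch|exact: cvg_cst].
have wE x : s x != 0 -> w x = (s x)^-1.
  by move=> s0; rewrite /w powR_inv1 ?sqr_ge0 // expr2 invfM mulrA mulfV // mul1r.
have w0 : forall x, s x = 0 -> w x = 0 => [x|].
  by move=> s0; rewrite /w s0 mul0r.
have dw x : torus x -> `|d x * w x| <= L * (2 / k).
  move=> tx; have hl := lip x tx; have := tx; rewrite /torus /= in_itv /= => /andP[x1 x2].
  have L0 : 0 <= L by apply: le_trans (normr_ge0 _) (hL _ tx0).
  case: (eqVneq (s x) 0) => [/w0 ->|s0].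
    by rewrite mulr0 normr0 mulr_ge0 // divr_ge0 // ltW.
  rewrite wE // normrM normfV ler_pdivrMr ?normr_gt0 //.
  have hy : `|(x - x0) / 2| <= (pi + `|x0|) / 2.
    rewrite normrM [`|2^-1|]ger0_norm // ler_pM2r //.
    apply: le_trans (ler_normB _ _) _; rewrite lerD2r ler_norml; lra.
  have := hk _ hy; rewrite -/(s x) normrM [`|2^-1|]ger0_norm // => h1.
  apply: le_trans hl _.
  have -> : L * (2 / k) * `|s x| = L * (2 / k * `|s x|) by ring.
  apply: ler_wpM2l => //.
  have -> : `|x - x0| = 2 / k * (k * (`|x - x0| / 2)) by field; lra.
  apply: ler_wpM2l => //; by rewrite divr_ge0 // ltW.
have mw : rbmeas (fun x => d x * w x).
  split; last by exists (L * (2 / k)).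
  apply: measurable_funM; first exact: (rbmeas_cont cd).1.
  apply: measurable_funM; first exact: (rbmeas_cont cs).1.
  apply: (measurableT_comp (measurable_powR (-1))).
  by apply: measurable_funX; exact: (rbmeas_cont cs).1.
have bg : bmeas g.
  have b1 := rbmeasM (rbmeas_cont cd) (rbmeas_cst (- 2^-1)).
  have b2 := rbmeasM (rbmeasM mw (rbmeas_cont cc)) (rbmeas_cst (- 2^-1)).
  split => /=.
    by under eq_fun do rewrite -mulrN; exact: b1.
  by under eq_fun do rewrite -mulrN; exact: b2.
have [[_ [K1 hK1]] [_ [K2 hK2]]] := bg.
exists g, (K1 + K2); split => //.
- by rewrite addr_ge0 //; [have := hK1 _ tx0|have := hK2 _ tx0]; exact: le_trans.
- by move=> x tx; apply: le_trans (normc_le _) _; rewrite lerD ?hK1 ?hK2.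
move=> x tx.
have -> : mode 1 x * mode (-1) x0 - 1 = expi ((x - x0) / 2 *+ 2) - 1 :> R[i].
  rewrite /mode -expiD; congr (expi _ - 1).
  by rewrite mulrNz mul1r mulN1r; field.
rewrite /expi sin_mulr2n cos_mulr2n -/(s x) -/(c x).
have sc : s x ^+ 2 + c x ^+ 2 = 1 by rewrite addrC; exact: cos2Dsin2.
rewrite /of_real; apply/eqP; rewrite eq_complex /= -/(d x).
have dsw : s x * (d x * w x) = d x.
  case: (eqVneq (s x) 0) => s0; last by rewrite wE //; field.
  suff : x = x0 by rewrite /d => ->; rewrite subrr mul0r mulr0.
  have := tx; rewrite /torus /= in_itv /= => /andP[x1 x2].
  have hy : `|(x - x0) / 2| <= (pi + `|x0|) / 2.
    rewrite normrM [`|2^-1|]ger0_norm // ler_pM2r //.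
    apply: le_trans (ler_normB _ _) _; rewrite lerD2r ler_norml; lra.
  have := hk _ hy; rewrite -/(s x) s0 normr0.
  rewrite pmulr_rle0 // normr_le0 mulf_eq0 subr_eq0.
  by case/orP => [/eqP //|]; rewrite invr_eq0 => /eqP; lra.
move: (d x * w x) dsw => v dsw.
rewrite -dsw !mulr2n; apply/andP; split; apply/eqP; first by field.
transitivity (v * c x * (1 - (s x ^+ 2 + c x ^+ 2))); first by rewrite sc; ring.
by field.
Qed.

(** Chernoff's proof of Fourier inversion gives convergence at [x0] along a
    subsequence; the rate is then that of the l^1 tail of the coefficients. *)
Theorem trig_approx s : 3 / 2 < s -> exists2 L, 0 < L &
  forall h (h' : R -> R) B, (forall x : R, is_derive x (1 : R) h (h' x)) ->
    continuous h' -> hball s (fourier (of_real h)) B ->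
    forall x0 p, torus x0 ->
    normc (of_real h x0 - trig_sum p (fourier (of_real h)) x0) <= L * B / p.+1%:R.
Proof.
move=> s32; have [L L0 hL] := @hball_l1 R s 1 ltac:(lra).
exists L => // h h' B dh ch' hB x0 p tx0.
have bf : bmeas (of_real h) by apply: bmeas_real; apply: rbmeas_cont; exact: continuous_derive dh.
have [g [K [bg K0 hK hg]]] := chernoff_quotient dh ch' tx0.
set f := of_real h in bf hg hB *.
apply/ler_addgt0Pr => e e0.
have [n pn hn] := bessel_small p K0 e0 bg hK.
have -> : f x0 - trig_sum p (fourier f) x0 =
   (trig_sum n (fourier f) x0 - trig_sum p (fourier f) x0) -
   (trig_sum n (fourier f) x0 - f x0) by ring.
apply: le_trans (normcB _ _) _; apply: lerD; last first.
  rewrite (trig_telescope n bf bg hg); apply: le_trans (normcB _ _) _.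
  have e1 u v : normc (mode u x0 * v) = normc v.
    by rewrite ComplexField.Normc.normcM normc_mode mul1r.
  by rewrite !e1.
have perm : perm_eq (win n) (win p ++ [seq xi <- win n | (p < `|xi|)%N]).
  apply: uniq_perm; first exact: win_uniq.
    rewrite cat_uniq win_uniq filter_uniq ?win_uniq // andbT.
    apply/hasPn => xi; rewrite mem_filter => /andP[h1 _].
    suff e' (z : int) : (p < `|z|)%N -> z \notin win p by exact: e'.
    by rewrite mem_win -ltnNge.
  suff e' (z : int) : (z \in win n) = (z \in win p ++ [seq xi <- win n | (p < `|xi|)%N]).
    by move=> xi; exact: e'.
  by rewrite mem_cat mem_filter !mem_win; lia.
rewrite !trig_sumE (perm_big _ perm) big_cat /= addrAC subrr add0r.
apply: le_trans (normc_sum _ _) _.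
rewrite ler_pdivlMr // mulrC mulr_sumr.
apply: le_trans (hL _ _ hB [seq xi <- win n | (p < `|xi|)%N] _); last first.
  by rewrite filter_uniq ?win_uniq.
rewrite big_seq [leRHS]big_seq; apply: ler_sum => xi.
rewrite mem_filter => /andP[h1 _].
rewrite ComplexField.Normc.normcM normc_mode mulr1 wt1.
apply: ler_wpM2r; first exact: normc_ge0.
apply: le_trans (jb_norm _).
rewrite -intr_norm -[X in X <= _]/(p.+1%:Z%:~R) ler_int; lia.
Qed.

End Inversion.

(** * Trigonometric polynomials *)

Section TrigPoly.
Context {R : realType}.
Implicit Types (f g : R -> R[i]) (c a b : int -> R[i]) (s : R) (xi eta : int).

(** the symbol of d_x *)
Definition ik xi : R[i] := 0 +i* xi%:~R.

Lemma ikD xi eta : ik (xi + eta) = ik xi + ik eta.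
Proof. by rewrite /ik intrD; apply/eqP; rewrite eq_complex /= addr0 !eqxx. Qed.

Lemma ikN xi : ik (- xi) = conjc (ik xi).
Proof. by rewrite /ik mulrNz. Qed.

Lemma normc_ik xi : normc (ik xi) = `|xi%:~R|.
Proof. by rewrite /= expr0n add0r sqrtr_sqr. Qed.

Lemma normc_ik_le xi : normc (ik xi) <= jb xi.
Proof. by rewrite normc_ik; exact: jb_norm. Qed.

Definition dif c : int -> R[i] := fun xi => ik xi * c xi.

Lemma hball_dif s c B : hball (s + 1) c B -> hball s (dif c) B.
Proof.
apply: hball_dom1 => xi; rewrite /dif ComplexField.Normc.normcM wtD wt1 -mulrA.
apply: ler_wpM2l; first exact: wt_ge0.
by apply: ler_wpM2r; [exact: normc_ge0|exact: normc_ik_le].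
Qed.

Definition supp n c := forall xi, (n < `|xi|)%N -> c xi = 0.

Lemma fourier_supp n c : supp n c -> fourier (trig_sum n c) = c.
Proof.
move=> sc; apply/funext => xi; rewrite fourier_trig; case: leqP => // h.
by rewrite sc.
Qed.

Lemma suppB n a b : supp n a -> supp n b -> supp n (fun xi => a xi - b xi).
Proof. by move=> sa sb xi h; rewrite sa // sb // subrr. Qed.

Definition is_trig f := exists n c, f = trig_sum n c.

Lemma is_trig_bm f : is_trig f -> bmeas f.
Proof. by move=> [n [c ->]]; exact: bmeas_trig. Qed.

Lemma is_trig_trig n c : is_trig (trig_sum n c). Proof. by exists n, c. Qed.

Lemma trig_sum_ext n c a : (forall xi, (`|xi| <= n)%N -> c xi = a xi) ->
  trig_sum n c = trig_sum n a.
Proof.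
move=> h; apply/funext => x; rewrite !trig_sumE big_seq [RHS]big_seq.
by apply: eq_bigr => xi; rewrite mem_win => /h ->.
Qed.

Lemma trig_sum_widen n m c : (n <= m)%N ->
  trig_sum n c = trig_sum m (fun xi => if (`|xi| <= n)%N then c xi else 0).
Proof.
move=> nm; apply/funext => x; rewrite !trig_sumE.
have perm : perm_eq (win n) [seq xi <- win m | (`|xi| <= n)%N].
  apply: uniq_perm; rewrite ?filter_uniq ?win_uniq // => xi.
  suff e (z : int) : (z \in win n) = (z \in [seq xi <- win m | (`|xi| <= n)%N]) by exact: e.
  by rewrite mem_filter !mem_win; lia.
rewrite (perm_big _ perm) big_filter big_mkcond; apply: eq_bigr => xi _.
by case: ifP => // _; rewrite mul0r.
Qed.

Lemma trig_sumD n a b x :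
  trig_sum n a x + trig_sum n b x = trig_sum n (fun xi => a xi + b xi) x.
Proof. by rewrite !trig_sumE -big_split; apply: eq_bigr => xi _; rewrite mulrDl. Qed.

Lemma trig_sumB n a b x :
  trig_sum n a x - trig_sum n b x = trig_sum n (fun xi => a xi - b xi) x.
Proof. by rewrite !trig_sumE -sumrB; apply: eq_bigr => xi _; rewrite mulrBl. Qed.

Lemma trig_sumZ n z a x : z * trig_sum n a x = trig_sum n (fun xi => z * a xi) x.
Proof. by rewrite !trig_sumE mulr_sumr; apply: eq_bigr => xi _; rewrite mulrA. Qed.

Lemma is_trigD f g : is_trig f -> is_trig g -> is_trig (f + g).
Proof.
move=> [n [a ->]] [m [b ->]].
exists (maxn n m); rewrite (trig_sum_widen a (leq_maxl n m)) (trig_sum_widen b (leq_maxr n m)).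
exists (fun xi => (if (`|xi| <= n)%N then a xi else 0) + if (`|xi| <= m)%N then b xi else 0).
by apply/funext => x; rewrite -trig_sumD.
Qed.

Lemma is_trigZ z f : is_trig f -> is_trig (fun x => z * f x).
Proof.
by move=> [n [a ->]]; exists n; eexists; apply/funext => x; rewrite trig_sumZ.
Qed.

Lemma is_trig_mode xi : is_trig (mode xi).
Proof.
exists `|xi|%N, (fun eta => (eta == xi)%:R); apply/funext => x.
rewrite trig_sumE (bigD1_seq xi) ?win_uniq ?mem_win //= eqxx mul1r big1 ?addr0 // => i.
by move/negbTE ->; rewrite mul0r.
Qed.

Lemma is_trig0 : is_trig (fun=> 0).
Proof.
exists 0%N, (fun=> 0); apply/funext => x; rewrite trig_sumE big1 // => i _.
by rewrite mul0r.
Qed.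

Lemma is_trig1 : is_trig (fun=> 1).
Proof.
have := is_trig_mode 0; congr is_trig; apply/funext => x; exact: mode0.
Qed.

Lemma is_trig_sum (I : Type) (r : seq I) (F : I -> R -> R[i]) :
  (forall i, is_trig (F i)) -> is_trig (fun x => \sum_(i <- r) F i x).
Proof.
move=> h; elim: r => [|i r IH].
  have -> : (fun x => \sum_(i <- [::]) F i x) = fun=> 0.
    by apply/funext => x; rewrite big_nil.
  exact: is_trig0.
have -> : (fun x => \sum_(j <- i :: r) F j x) = F i + fun x => \sum_(j <- r) F j x.
  by apply/funext => x; rewrite big_cons.
exact: is_trigD.
Qed.

Lemma is_trigM f g : is_trig f -> is_trig g -> is_trig (f * g).
Proof.
move=> [n [a ->]] [m [b ->]].
have -> : trig_sum n a * trig_sum m b =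
  fun x => \sum_(i <- win n) \sum_(j <- win m) a i * b j * mode (i + j) x.
  apply/funext => x; rewrite !fctE !trig_sumE big_distrlr /=.
  by apply: eq_bigr => i _; apply: eq_bigr => j _; rewrite modeD; ring.
apply: is_trig_sum => i; apply: is_trig_sum => j.
by apply: is_trigZ; exact: is_trig_mode.
Qed.

Lemma is_trigX f j : is_trig f -> is_trig (f ^+ j).
Proof.
move=> hf; elim: j => [|j IH]; first exact: is_trig1.
by rewrite exprS; exact: is_trigM.
Qed.

Lemma is_trigB f g : is_trig f -> is_trig g -> is_trig (f - g).
Proof.
move=> hf hg; apply: is_trigD => //.
have -> : - g = (fun x => -1 * g x) by apply/funext => x; rewrite mulN1r.
exact: is_trigZ.
Qed.

Definition fball s f B := hball s (fourier f) B.

Lemma fball_mul s : 1 / 2 < s -> exists2 K, 1 <= K & forall f g A B,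
  bmeas f -> is_trig g -> fball s f A -> fball s g B -> fball s (f * g) (K * A * B).
Proof.
move=> s2; have [K K0 hK] := @hball_conv R s s2.
exists (K + 1) => [|f g A B bf [m [b ->]] hA hB]; first lra.
have [A0 _] := hA; have [B0 _] := hB.
apply: (@hball_le _ _ _ (K * A * B)); last first.
  by apply: ler_wpM2r => //; apply: ler_wpM2r => //; lra.
apply: hK (win_uniq m) hA hB _ => xi.
rewrite (fourier_mul_trig m b xi bf); apply: le_trans (normc_sum _ _) _.
rewrite big_seq [leRHS]big_seq; apply: ler_sum => eta; rewrite mem_win => h.
by rewrite ComplexField.Normc.normcM mulrC fourier_trig h.
Qed.

Lemma fball_le s f A B : fball s f A -> A <= B -> fball s f B. Proof. exact: hball_le. Qed.

Lemma fball_add s f g A B : bmeas f -> bmeas g -> fball s f A -> fball s g B -> fball s (f + g) (A + B).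
Proof.
move=> bf bg hA hB; apply: hball_ext (hball_add hA hB) => xi.
by rewrite -fourierD.
Qed.

Lemma fball1 s : fball s (1 : R -> R[i]) 1.
Proof.
apply: hball_ext (hball_delta s) => xi.
exact: (esym (fourier1 xi)).
Qed.

Lemma fball_pow s D j : 1 / 2 < s -> exists2 K, 0 < K &
  forall f, is_trig f -> fball s f D -> fball s (f ^+ j) K.
Proof.
move=> s2; have [K0 K01 hK0] := fball_mul s2.
elim: j => [|j [K K1 hK]].
  by exists 1 => // f _ _; rewrite expr0; exact: fball1.
exists (K0 * (`|D| + 1) * K) => [|f tf hf].
  by rewrite !mulr_gt0 //; have := normr_ge0 D; lra.
rewrite exprS; apply: hK0; [exact: is_trig_bm|exact: is_trigX| |exact: hK].
by apply: fball_le hf _; have := ler_norm D; lra.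
Qed.

Lemma fball_powB s D j : 1 / 2 < s -> exists2 K, 0 < K & forall f g B,
  is_trig f -> is_trig g -> fball s f D -> fball s g D -> fball s (f - g) B ->
  fball s (f ^+ j - g ^+ j) (K * B).
Proof.
move=> s2; have [K0 K01 hK0] := fball_mul s2.
elim: j => [|j [K K1 hK]].
  exists 1 => // f g B _ _ _ _ [B0 _]; rewrite subrr mul1r.
  apply: (@hball_le _ _ _ 0) => //; apply: hball_ext (hb0 s) => xi.
  transitivity (0 * fourier (fun=> 0 : R[i]) xi); first by rewrite mul0r.
  rewrite -fourierZ; last exact: bmeas_cst.
  by apply: eq_fourier => x _; rewrite mul0r.
have [P P0 hP] := @fball_pow s D j s2.
exists (K0 * (`|D| + 1) * K + K0 * P).
  by rewrite addr_gt0 // !mulr_gt0 //; have := normr_ge0 D; lra.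
move=> f g B tf tg hf hg hfg.
have -> : f ^+ j.+1 - g ^+ j.+1 = f * (f ^+ j - g ^+ j) + (f - g) * g ^+ j.
  by rewrite !exprS; ring.
rewrite [X in fball _ _ X]mulrDl; apply: fball_add.
- by apply: is_trig_bm; apply: is_trigM => //; apply: is_trigB; exact: is_trigX.
- by apply: is_trig_bm; apply: is_trigM; [exact: is_trigB|exact: is_trigX].
- rewrite -mulrA; apply: hK0; [exact: is_trig_bm|by apply: is_trigB; exact: is_trigX| |exact: hK].
  by apply: fball_le hf _; have := ler_norm D; lra.
- rewrite -mulrA (mulrC P) mulrA; apply: hK0; last exact: hP.
  + by apply: is_trig_bm; exact: is_trigB.
  + exact: is_trigX.
  + by [].
Qed.

(** Derivatives are recorded on coefficients, so that the product rule is an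
    identity between finite convolutions. *)
Definition is_dx f f1 := forall xi, fourier f1 xi = ik xi * fourier f xi.

Lemma is_dx_trig n c : is_dx (trig_sum n c) (trig_sum n (dif c)).
Proof. by move=> xi; rewrite !fourier_trig; case: ifP => // _; rewrite mulr0. Qed.

Lemma is_dxM f f1 n c : bmeas f -> bmeas f1 -> is_dx f f1 ->
  is_dx (f * trig_sum n c) (f1 * trig_sum n c + f * trig_sum n (dif c)).
Proof.
move=> bf bf1 df xi.
have bt c' : bmeas (trig_sum n c') by exact: bmeas_trig.
rewrite (fourierD _ (bmeasM bf1 (bt c)) (bmeasM bf (bt _))).
rewrite !fourier_mul_trig // -big_split mulr_sumr; apply: eq_bigr => eta _.
have -> : ik xi = ik (xi - eta) + ik eta by rewrite -ikD subrK.
by rewrite /= df /dif; ring.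
Qed.

Lemma is_dxX n c j : is_dx (trig_sum n c ^+ j.+1)
  (fun x => j.+1%:R * ((trig_sum n c ^+ j * trig_sum n (dif c)) x)).
Proof.
set f := trig_sum n c; set f1 := trig_sum n (dif c).
have tf : is_trig f by exact: is_trig_trig.
have tf1 : is_trig f1 by exact: is_trig_trig.
elim: j => [|j IH].
  have -> : (fun x => 1%:R * ((f ^+ 0 * f1) x)) = f1.
    by apply/funext => x; rewrite !fctE expr0 !mul1r.
  by rewrite expr1; exact: is_dx_trig.
have bj i : bmeas (f ^+ i * f1) by apply: is_trig_bm; apply: is_trigM => //; exact: is_trigX.
rewrite exprSr.
have := is_dxM n c (is_trig_bm (is_trigX j.+1 tf)) (bmeasZ j.+1%:R (bj j)) IH.
congr is_dx; rewrite -/f -/f1; apply/funext => x.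
change (j.+1%:R * ((f ^+ j) x * f1 x) * f x + (f ^+ j.+1) x * f1 x =
  j.+2%:R * ((f ^+ j.+1) x * f1 x)).
have -> : (f ^+ j.+1) x = (f ^+ j) x * f x by rewrite exprSr.
by rewrite -[j.+2%:R]natr1; ring.
Qed.

End TrigPoly.

(** * Stability of the Euler step *)

Section Scheme.
Context {R : realType}.
Implicit Types (a b c e : int -> R[i]) (s A B D : R) (xi eta : int).

Lemma hball_supp n s c B : supp n c -> 0 <= B ->
  \sum_(xi <- win n) (wt s xi * normc (c xi)) ^+ 2 <= B ^+ 2 -> hball s c B.
Proof.
move=> sc B0 h; split => // r ur; apply: le_trans h.
rewrite (bigID (fun xi : int => (`|xi| <= n)%N)) /= [X in _ + X]big1 ?addr0; last first.
  move=> xi; rewrite -ltnNge => /sc ->.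
  by rewrite ComplexField.Normc.normc0 mulr0 expr0n.
rewrite -big_filter; apply: ler_sum_sub => [||xi]; last exact: sqr_ge0.
  by rewrite filter_uniq.
move=> xi; rewrite mem_filter => /andP[h _].
suff e (z : int) : (`|z| <= n)%N -> z \in win n by exact: e.
by rewrite mem_win.
Qed.

(** The coefficients of P_n applied to (1/k) d_x (v^k), for v with coefficients
    [c] on the band. *)
Definition NL k n c xi : R[i] :=
  if (`|xi| <= n)%N then k%:R^-1 * ik xi * fourier (trig_sum n c ^+ k) xi else 0.

Lemma supp_NL k n c : supp n (NL k n c).
Proof. by move=> xi h; rewrite /NL ifN // -ltnNge. Qed.

Lemma NL_prod k n c xi : (`|xi| <= n)%N ->
  NL k.+1 n c xi = fourier (trig_sum n c ^+ k * trig_sum n (dif c)) xi.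
Proof.
move=> h; rewrite /NL h -mulrA -(is_dxX n c k) fourierZ; last first.
  by apply: is_trig_bm; apply: is_trigM; [apply: is_trigX|]; exact: is_trig_trig.
by rewrite mulrA mulVf ?mul1r // pnatr_eq0.
Qed.

(** The split used for stability: the difference of the powers multiplies the
    derivative of the smoother function [a], while the derivative of the error
    is multiplied by a power of [b] and is left to the energy estimate. *)
Lemma NL_diff k n a b xi : (`|xi| <= n)%N ->
  NL k.+1 n a xi - NL k.+1 n b xi =
  fourier ((trig_sum n a ^+ k - trig_sum n b ^+ k) * trig_sum n (dif a)) xi +
  fourier (trig_sum n b ^+ k * trig_sum n (dif (fun eta => a eta - b eta))) xi.
Proof.
move=> h; rewrite !NL_prod //.
have t c : is_trig (trig_sum n c) by exact: is_trig_trig.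
rewrite -fourierB; [|by apply: is_trig_bm; apply: is_trigM => //; exact: is_trigX..].
rewrite -fourierD; last first.
- by apply: is_trig_bm; apply: is_trigM => //; exact: is_trigX.
- by apply: is_trig_bm; apply: is_trigM => //; apply: is_trigB; exact: is_trigX.
apply: eq_fourier => x _; rewrite /dif.
have -> : trig_sum n (fun xi0 => ik xi0 * (a xi0 - b xi0)) =
   trig_sum n (fun xi0 => ik xi0 * a xi0) - trig_sum n (fun xi0 => ik xi0 * b xi0).
  apply/funext => y; rewrite [RHS]trig_sumB; congr (trig_sum _ _ _).
  by apply/funext => z; rewrite mulrBr.
set f := trig_sum n a; set g := trig_sum n b.
set f1 := trig_sum n (fun xi0 => ik xi0 * a xi0).
set g1 := trig_sum n (fun xi0 => ik xi0 * b xi0).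
change ((f ^+ k * f1 - g ^+ k * g1) x = ((f ^+ k - g ^+ k) * f1 + g ^+ k * (f1 - g1)) x).
by congr (_ x); ring.
Qed.

Definition real_seq c := forall xi, c (- xi) = conjc (c xi).

Lemma bmeas_pow n c k : bmeas (trig_sum n c ^+ k).
Proof. by apply: is_trig_bm; apply: is_trigX; exact: is_trig_trig. Qed.

Lemma trig_sum_conj n c x : real_seq c -> conjc (trig_sum n c x) = trig_sum n c x.
Proof.
move=> rc; rewrite trig_sumE.
have perm : perm_eq (win n) (map (fun xi => - xi) (win n)).
  apply: uniq_perm; rewrite ?map_inj_uniq ?win_uniq //; try exact: oppr_inj.
  suff e (z : int) : (z \in win n) = (z \in map (fun xi => - xi) (win n)) by move=> z; exact: e.
  rewrite -[in RHS](opprK z) mem_map; last exact: oppr_inj.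
  by rewrite !mem_win abszN.
rewrite [in RHS](perm_big _ perm) big_map (big_morph _ (rmorphD (@conjc R)) (rmorph0 _)).
apply: eq_bigr => xi _.
by transitivity (conjc (c xi) * conjc (mode xi x)); [exact: conjcM|rewrite mode_conj rc].
Qed.

Lemma real_pow n c k : real_seq c -> real_seq (fourier (trig_sum n c ^+ k)).
Proof.
move=> rc xi.
have := fourier_conj (- xi) (bmeas_pow n c k); rewrite opprK => e.
rewrite -e; apply: eq_fourier => x _.
have h : forall y, conjc ((trig_sum n c ^+ k) y) = (trig_sum n c ^+ k) y.
  move=> y; elim: k {e} => [|k IH]; first by rewrite expr0; exact: conjc1.
  rewrite exprS; change (conjc (trig_sum n c y * (trig_sum n c ^+ k) y) = trig_sum n c y * (trig_sum n c ^+ k) y).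
  by rewrite conjcM trig_sum_conj // IH.
by rewrite h.
Qed.

Lemma real_NL k n c : real_seq c -> real_seq (NL k n c).
Proof.
move=> rc xi; rewrite /NL abszN; case: ifP => h; last by rewrite conjc0.
rewrite (conjcM (k%:R^-1 * ik xi)) (conjcM k%:R^-1) real_pow // ikN.
by congr (_ * _ * _); rewrite conjc_inv conjc_nat.
Qed.

(** Forward Euler for the projected equation without dispersion. *)
Definition euler k n (tau : R) c xi : R[i] := c xi - tau%:C * NL k n c xi.

Lemma supp_euler k n tau c : supp n c -> supp n (euler k n tau c).
Proof.
move=> sc xi h; rewrite /euler sc // supp_NL // mulr0 subr0 //.
Qed.

Lemma jb_win n xi : (`|xi| <= n)%N -> jb xi <= (1 + n%:R : R).
Proof.
move=> h; apply: le_trans (jb_le1D _) _; rewrite lerD2l -intr_norm.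
by rewrite -[X in _ <= X]/(n%:Z%:~R) ler_int; lia.
Qed.

(** Inverse inequality: the bracket is at most 1 + n on the band. *)
Lemma hball_inverse n s c B : supp n c -> hball s c B -> hball (s + 1) c ((1 + n%:R) * B).
Proof.
move=> sc; apply: hball_dom; first by rewrite addr_ge0.
move=> xi; case: (leqP `|xi|%N n) => h; last first.
  by rewrite sc // ComplexField.Normc.normc0 !mulr0.
rewrite wtD wt1 mulrAC mulrC; apply: ler_wpM2r; last exact: jb_win.
by rewrite mulr_ge0 ?wt_ge0 ?normc_ge0.
Qed.

Lemma re_sum_sqr (z w : R[i]) (t : R) :
  normc (z - t%:C * w) ^+ 2 = normc z ^+ 2 - 2 * t * complex.Re (conjc z * w) + t ^+ 2 * normc w ^+ 2.
Proof. by case: z w => [a b] [c d]; rewrite !normc_sqr /=; ring. Qed.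

Lemma fball_bound n s f B : fball s f B ->
  hball s (fun xi => if (`|xi| <= n)%N then fourier f xi else 0) B.
Proof.
apply: hball_coef => xi; case: ifP => // _.
by rewrite ComplexField.Normc.normc0 normc_ge0.
Qed.

Lemma fball_trig n s c B : hball s c B -> fball s (trig_sum n c) B.
Proof.
apply: hball_coef => xi; rewrite fourier_trig; case: ifP => // _.
by rewrite ComplexField.Normc.normc0 normc_ge0.
Qed.

(** Forward Euler loses a derivative, but at first order in [tau] the energy
    estimate absorbs the loss, and at second order the parabolic step
    restriction pays for the two derivatives of the squared increment. *)
Lemma euler_stable (k : nat) (g cfl D : R) : 3 / 2 < g -> 0 < cfl ->
  exists2 K, 0 < K & forall n tau a b B, supp n a -> supp n b -> real_seq b ->
    hball (g + 1) a D -> hball g b D -> hball g (fun xi => a xi - b xi) B ->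
    0 < tau -> tau * (1 + n%:R) ^+ 2 <= cfl ->
    hball g (fun xi => euler k.+1 n tau a xi - euler k.+1 n tau b xi) ((1 + K * tau) * B).
Proof.
move=> g32 c0.
have g12 : 1 / 2 < g by lra.
have [K0 K01 hM] := @fball_mul R g g12.
have [P P0 hP] := @fball_pow R g D k g12.
have [Q Q0 hQ] := @fball_powB R g D k g12.
have [E E0 hE] := @hball_energy R g g32.
pose K1 := K0 * Q * (`|D| + 1).
pose K2 := K0 * P.
pose K3 := 2 * (E * P) + cfl * K2 ^+ 2.
have D1 : 0 < `|D| + 1 by rewrite ltr_wpDl.
have K10 : 0 < K1 by rewrite !mulr_gt0 //; lra.
have K20 : 0 < K2 by rewrite mulr_gt0 //; lra.
have K30 : 0 < K3.
  by apply: addr_gt0; apply: mulr_gt0 => //; [exact: mulr_gt0|exact: exprn_gt0].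
exists (K3 + K1) => [|n tau a b B sa sb rb ha hb' he tau0 htau]; first exact: addr_gt0.
pose e xi := a xi - b xi.
have se : supp n e by exact: suppB.
have [B0 _] := he.
pose cut f xi : R[i] := if (`|xi| <= n)%N then fourier f xi else 0.
(* [d1] is harmless, as [a] is smooth; [d2] is the transport of the error *)
pose d1 := cut ((trig_sum n a ^+ k - trig_sum n b ^+ k) * trig_sum n (dif a)).
pose d2 := cut (trig_sum n b ^+ k * trig_sum n (dif e)).
have sd1 : supp n d1 by move=> xi h; rewrite /d1 /cut ifN // -ltnNge.
have sd2 : supp n d2 by move=> xi h; rewrite /d2 /cut ifN // -ltnNge.
have t c' : is_trig (trig_sum n c') by exact: is_trig_trig.
have hd1 : hball g d1 (K1 * B).
  rewrite /K1 -mulrA (mulrC _ B) mulrA -(mulrA K0); apply: fball_bound; apply: hM => //.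
  - by apply: is_trig_bm; apply: is_trigB; exact: is_trigX.
  - apply: hQ => //; [apply: fball_trig|exact: fball_trig|].
      by apply: hball_weaken ha; lra.
    apply: (@hball_ext _ _ (fourier (trig_sum n e))); last exact: fball_trig.
    move=> xi; apply: eq_fourier => x _; exact: esym (trig_sumB _ _ _ _).
  - apply: fball_trig; apply: hball_dif; apply: hball_le ha _.
    by have := ler_norm D; lra.
have hb2 : fball g (trig_sum n b ^+ k) P by apply: hP => //; exact: fball_trig.
have hd2 : hball g d2 (K2 * ((1 + n%:R) * B)).
  apply: fball_bound; apply: hM => //; first exact: bmeas_pow.
  by apply: fball_trig; apply: hball_dif; exact: hball_inverse.
(* the cross term of the square is the energy form, although [d2] is bounded in
   H^g only by the inverse inequality *)
have en : `|\sum_(xi <- win n) wt g xi ^+ 2 * complex.Re (conjc (e xi) * d2 xi)| <= E * P * B ^+ 2.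
  have := hE e _ B P (win n) (win_uniq n) he hb2 (real_pow n k rb).
  congr (`|_| <= _); rewrite big_seq [RHS]big_seq; apply: eq_bigr => xi.
  rewrite mem_win => hx; rewrite /d2 /cut hx fourier_mul_trig; last exact: bmeas_pow.
  rewrite mulr_sumr (big_morph _ (@cReD R) (erefl _ : complex.Re (0 : R[i]) = 0)) mulr_sumr.
  apply: eq_bigr => eta _; rewrite -mulrA; congr (_ * _).
  rewrite /dif; case: (conjc (e xi)) (e eta) (fourier _ _) => [x1 x2] [y1 y2] [z1 z2].
  by rewrite /ik /=; ring.
have hs : hball g (fun xi => e xi - tau%:C * d2 xi) ((1 + K3 * tau) * B).
  apply: (@hball_supp n).
  - by move=> xi h; rewrite se // sd2 // mulr0 subr0.
  - by rewrite mulr_ge0 // addr_ge0 // mulr_ge0 // ltW.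
  have e1 : \sum_(xi <- win n) (wt g xi * normc (e xi - tau%:C * d2 xi)) ^+ 2 =
     \sum_(xi <- win n) (wt g xi * normc (e xi)) ^+ 2
     - 2 * tau * \sum_(xi <- win n) wt g xi ^+ 2 * complex.Re (conjc (e xi) * d2 xi)
     + tau ^+ 2 * \sum_(xi <- win n) (wt g xi * normc (d2 xi)) ^+ 2.
    rewrite !mulr_sumr -sumrB -big_split; apply: eq_bigr => xi _ /=.
    by rewrite !exprMn re_sum_sqr; ring.
  rewrite e1.
  have s1 := he.2 _ (win_uniq n); have s2 := hd2.2 _ (win_uniq n).
  set S1 := \sum_(xi <- win n) _ in s1 *.
  set S3 := \sum_(xi <- win n) _ in s2 *.
  set S2 := \sum_(xi <- win n) _ in en *.
  have h2 : - (2 * tau * S2) <= 2 * tau * (E * P * B ^+ 2).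
    rewrite -mulrN; apply: ler_wpM2l; first by rewrite mulr_ge0 // ltW.
    by apply: le_trans en; rewrite -normrN; exact: ler_norm.
  have h3 : tau ^+ 2 * S3 <= tau * (cfl * K2 ^+ 2 * B ^+ 2).
    apply: le_trans (_ : tau ^+ 2 * (K2 * ((1 + n%:R) * B)) ^+ 2 <= _).
      by apply: ler_wpM2l => //; exact: sqr_ge0.
    have -> : tau ^+ 2 * (K2 * ((1 + n%:R) * B)) ^+ 2 =
       tau * ((tau * (1 + n%:R) ^+ 2) * (K2 ^+ 2 * B ^+ 2)) by ring.
    apply: ler_wpM2l; first exact: ltW.
    rewrite -[leRHS]mulrA; apply: ler_wpM2r => //.
    by rewrite mulr_ge0 ?sqr_ge0.
  have -> : ((1 + K3 * tau) * B) ^+ 2 =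
     B ^+ 2 + 2 * tau * (E * P * B ^+ 2) + tau * (cfl * K2 ^+ 2 * B ^+ 2) +
     (K3 * tau + K3 ^+ 2 * tau ^+ 2) * B ^+ 2 by rewrite /K3; ring.
  apply: le_trans (_ : B ^+ 2 + 2 * tau * (E * P * B ^+ 2) + tau * (cfl * K2 ^+ 2 * B ^+ 2) <= _).
    by rewrite !lerD.
  rewrite lerDl mulr_ge0 ?sqr_ge0 // addr_ge0 ?mulr_ge0 ?sqr_ge0 //; exact: ltW.
apply: (@hball_ext _ _ (fun xi => (e xi - tau%:C * d2 xi) - tau%:C * d1 xi)).
  move=> xi; rewrite /euler /e.
  have e3 (p q u v w : R[i]) : p - w * u - (q - w * v) = p - q - w * (u - v) by ring.
  rewrite e3.
  case: (leqP `|xi|%N n) => h.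
    rewrite NL_diff // /d1 /d2 /cut h.
    by move: (fourier _ xi) (fourier _ xi) => u v; ring.
  by rewrite !supp_NL // sd2 // sd1 // subrr !mulr0 !subr0.
have -> : (1 + (K3 + K1) * tau) * B = (1 + K3 * tau) * B + normc tau%:C * (K1 * B).
  by rewrite normc_real gtr0_norm //; ring.
by apply: hball_sub => //; exact: hball_scale.
Qed.

End Scheme.

(** * Coefficients depending on time *)

Section TimeDerivative.
Context {R : realType}.
Implicit Types (a b x t : R) (f g : R -> R) (y z : R -> R[i]).

(** The hypotheses of the mean value theorem. Nothing is asked at the end points,
    since at time 0 the coefficients of the solution are only continuous. *)
Definition drv a b f f' := {within `[a, b], continuous f} /\
  forall x, x \in `]a, b[ -> is_derive x (1 : R) f (f' x).

Lemma drv_mvi a b f f' K : a <= b -> drv a b f f' ->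
  (forall x, x \in `]a, b[ -> `|f' x| <= K) -> `|f b - f a| <= K * (b - a).
Proof.
move=> ab [cf df] hK; move: ab; rewrite le_eqVlt => /predU1P[->|ab].
  by rewrite !subrr normr0 mulr0.
have [c hc ->] := MVT ab df cf.
rewrite normrM [`|b - a|]ger0_norm ?subr_ge0; last exact: ltW.
by apply: ler_wpM2r; [rewrite subr_ge0 ltW|exact: hK].
Qed.

Lemma drv_derive a b f f' : (forall x : R, is_derive x (1 : R) f (f' x)) -> drv a b f f'.
Proof.
by move=> df; split => [|x _]; [apply: continuous_subspaceT; exact: continuous_derive df|].
Qed.

Lemma drv_eq a b f g f' g' : drv a b f f' -> f =1 g ->
  (forall x, x \in `]a, b[ -> f' x = g' x) -> drv a b g g'.
Proof.
move=> [cf df] /funext fg fg'; rewrite -fg; split => // x hx.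
by rewrite -fg' //; exact: df.
Qed.

Lemma drv_sub a b c d f f' : a <= c -> d <= b -> drv a b f f' -> drv c d f f'.
Proof.
move=> ac db [cf df]; split.
  apply: continuous_subspaceW cf => x /=; rewrite !in_itv /= => /andP[h1 h2].
  by rewrite (le_trans ac h1) (le_trans h2 db).
move=> x; rewrite in_itv /= => /andP[h1 h2]; apply: df; rewrite in_itv /=.
by rewrite (le_lt_trans ac h1) (lt_le_trans h2 db).
Qed.

Lemma drv_cst a b (k : R) : drv a b (fun=> k) (fun=> 0).
Proof. by apply: drv_derive => x; exact: is_derive_cst. Qed.

Lemma drv_add a b f g f' g' : drv a b f f' -> drv a b g g' ->
  drv a b (fun x => f x + g x) (fun x => f' x + g' x).
Proof.
move=> [cf df] [cg dg]; split; first by move=> x; apply: cvgD; [exact: cf|exact: cg].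
by move=> x hx; exact: is_deriveD (df x hx) (dg x hx).
Qed.

Lemma drv_mul a b f g f' g' : drv a b f f' -> drv a b g g' ->
  drv a b (fun x => f x * g x) (fun x => f' x * g x + f x * g' x).
Proof.
move=> [cf df] [cg dg]; split; first by move=> x; apply: cvgM; [exact: cf|exact: cg].
move=> x hx; apply: is_derive_eq (is_deriveM (df x hx) (dg x hx)) _.
by rewrite /GRing.scale /=; ring.
Qed.

Lemma drv_opp a b f f' : drv a b f f' -> drv a b (fun x => - f x) (fun x => - f' x).
Proof.
move=> h; apply: drv_eq (drv_mul (drv_cst a b (-1)) h) _ _ => x; first by rewrite mulN1r.
by move=> _; ring.
Qed.

Definition drvC a b y y' :=
  drv a b (fun x => complex.Re (y x)) (fun x => complex.Re (y' x)) /\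
  drv a b (fun x => complex.Im (y x)) (fun x => complex.Im (y' x)).

Lemma drvC_eq a b y z y' z' : drvC a b y y' -> y =1 z ->
  (forall x, x \in `]a, b[ -> y' x = z' x) -> drvC a b z z'.
Proof.
by move=> [h1 h2] yz yz'; split; [apply: drv_eq h1 _ _|apply: drv_eq h2 _ _] => x;
  rewrite ?yz // => hx; rewrite yz'.
Qed.

Lemma drvC_sub a b c d y y' : a <= c -> d <= b -> drvC a b y y' -> drvC c d y y'.
Proof. by move=> ac db [h1 h2]; split; apply: drv_sub ac db _. Qed.

Lemma drvC_cst a b (k : R[i]) : drvC a b (fun=> k) (fun=> 0).
Proof. by split; exact: drv_cst. Qed.

Lemma drvC_add a b y z y' z' : drvC a b y y' -> drvC a b z z' ->
  drvC a b (fun x => y x + z x) (fun x => y' x + z' x).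
Proof.
move=> [h1 h2] [h3 h4]; split.
  by apply: drv_eq (drv_add h1 h3) _ _ => x *; rewrite cReD.
by apply: drv_eq (drv_add h2 h4) _ _ => x *; rewrite cImD.
Qed.

Lemma drvC_mul a b y z y' z' : drvC a b y y' -> drvC a b z z' ->
  drvC a b (fun x => y x * z x) (fun x => y' x * z x + y x * z' x).
Proof.
move=> [h1 h2] [h3 h4]; split.
  apply: drv_eq (drv_add (drv_mul h1 h3) (drv_opp (drv_mul h2 h4))) _ _ => x *.
    by rewrite cReM.
  by rewrite cReD !cReM; ring.
apply: drv_eq (drv_add (drv_mul h1 h4) (drv_mul h2 h3)) _ _ => x *.
  by rewrite cImM.
by rewrite cImD !cImM; ring.
Qed.

Lemma drvC_scale a b (k : R[i]) y y' : drvC a b y y' ->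
  drvC a b (fun x => k * y x) (fun x => k * y' x).
Proof.
move=> h; apply: drvC_eq (drvC_mul (drvC_cst a b k) h) _ _ => // x _.
by rewrite mul0r add0r.
Qed.

Lemma drvC_opp a b y y' : drvC a b y y' -> drvC a b (fun x => - y x) (fun x => - y' x).
Proof.
by move=> h; apply: drvC_eq (drvC_scale (-1) h) _ _ => x *; rewrite mulN1r.
Qed.

Lemma drvC_sum a b (I : Type) (r : seq I) (y y' : I -> R -> R[i]) :
  (forall i, drvC a b (y i) (y' i)) ->
  drvC a b (fun x => \sum_(i <- r) y i x) (fun x => \sum_(i <- r) y' i x).
Proof.
move=> h; elim: r => [|i r IH].
  by apply: drvC_eq (drvC_cst a b 0) _ _ => x *; rewrite big_nil.
by apply: drvC_eq (drvC_add (h i) IH) _ _ => x *; rewrite big_cons.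
Qed.

Lemma drvC_id a b : drvC a b (fun x => x%:C) (fun=> 1).
Proof. by split; [apply: drv_derive => x; exact: is_derive_id|exact: drv_cst]. Qed.

Lemma drvC_expi a b (l t : R) :
  drvC a b (fun x => expi (l * (x - t))) (fun x => (0 +i* l) * expi (l * (x - t))).
Proof.
have d (x : R) : is_derive x (1 : R) (fun x => l * (x - t)) l.
  have := @is_deriveZ _ _ _ _ l x (1 : R) _ (@is_deriveB _ _ _ id (cst t) x 1 _ _ (is_derive_id _ _) (is_derive_cst _ _ _)).
  by move/is_derive_eq; apply; rewrite subr0 /GRing.scale /= mulr1.
split; apply: drv_derive => x /=.
  apply: is_derive_eq (is_derive1_comp (is_derive_cos _) (d x)) _.
  by ring.
apply: is_derive_eq (is_derive1_comp (is_derive_sin _) (d x)) _.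
by ring.
Qed.

(** The scalar mean value theorem for the H^s inner product of [y] with its own
    total increment. *)
Lemma hball_mvi n s (y y' : R -> int -> R[i]) a b Y : a <= b -> 0 <= Y ->
  (forall xi, drvC a b (y^~ xi) (y'^~ xi)) -> (forall x, supp n (y x)) ->
  (forall x, x \in `]a, b[ -> hball s (y' x) Y) ->
  hball s (fun xi => y b xi - y a xi) (Y * (b - a)).
Proof.
move=> ab Y0 hy sy hY.
pose Z xi := y b xi - y a xi.
have Yb : 0 <= Y * (b - a) by rewrite mulr_ge0 // subr_ge0.
apply: (@hball_supp R n) => //; first by move=> xi h; rewrite !sy // subrr.
set S := \sum_(xi <- win n) _.
have S0 : 0 <= S by apply: sumr_ge0 => xi _; exact: sqr_ge0.
pose ph x := \sum_(xi <- win n) wt s xi ^+ 2 * complex.Re (conjc (Z xi) * y x xi).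
pose ph' x := \sum_(xi <- win n) wt s xi ^+ 2 * complex.Re (conjc (Z xi) * y' x xi).
have dph : drv a b ph ph'.
  rewrite /ph /ph'; elim: (win n) => [|xi r IH].
    by apply: drv_eq (drv_cst a b 0) _ _ => x *; rewrite big_nil.
  have h := (drvC_scale (conjc (Z xi)) (hy xi)).1.
  have {}h := drv_mul (drv_cst a b (wt s xi ^+ 2)) h.
  by apply: drv_eq (drv_add h IH) _ _ => x *; rewrite big_cons // mul0r add0r.
have ZE : ph b - ph a = S.
  rewrite /ph /S -sumrB; apply: eq_bigr => xi _.
  rewrite exprMn normc_sqr -/(Z xi) -mulrBr; congr (_ * _).
  rewrite /Z; case: (y b xi) (y a xi) => [p q] [u v] /=; ring.
have := drv_mvi ab dph.
move=> /(_ (Num.sqrt S * Y)) h.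
have {}h : `|ph b - ph a| <= Num.sqrt S * Y * (b - a).
  apply: h => x /hY [_ hx]; rewrite /ph'.
  apply: le_trans (ler_norm_sum _ _ _) _.
  apply: le_trans (_ : \sum_(xi <- win n) (wt s xi * normc (Z xi)) * (wt s xi * normc (y' x xi)) <= _).
    apply: ler_sum => xi _; rewrite normrM ger0_norm ?sqr_ge0 //.
    have -> : wt s xi * normc (Z xi) * (wt s xi * normc (y' x xi)) =
      wt s xi ^+ 2 * (normc (Z xi) * normc (y' x xi)) by ring.
    rewrite ler_wpM2l ?sqr_ge0 //; apply: le_trans (Re_le_normc _) _.
    by rewrite ComplexField.Normc.normcM normc_conj.
  apply: cs_sum_le; [exact: sqrtr_ge0|exact: Y0|by rewrite sqr_sqrtr|].
  by apply: hx; exact: win_uniq.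
move: h; rewrite ZE ger0_norm // -mulrA.
have sS := sqrtr_ge0 S.
rewrite -{1 3}(sqr_sqrtr S0) expr2.
case: (eqVneq (Num.sqrt S) 0) => [->|n0].
  by move=> _; rewrite mul0r sqr_ge0.
rewrite ler_pM2l; last by rewrite lt_def n0.
by move=> h; rewrite -expr2 ler_pXn2r ?nnegrE.
Qed.

(** Carries the chain rule for powers of trigonometric polynomials with
    time-dependent coefficients: each product is a finite convolution. *)
Definition drvF a b (f f1 : R -> R -> R[i]) := [/\ forall t, bmeas (f t), forall t, bmeas (f1 t) &
  forall xi, drvC a b (fun t => fourier (f t) xi) (fun t => fourier (f1 t) xi)].

Lemma drvF_mul a b n (f f1 : R -> R -> R[i]) (c c1 : R -> int -> R[i]) : drvF a b f f1 ->
  (forall xi, drvC a b (c^~ xi) (c1^~ xi)) ->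
  drvF a b (fun t => f t * trig_sum n (c t))
         (fun t => f1 t * trig_sum n (c t) + f t * trig_sum n (c1 t)).
Proof.
move=> [bf bf1 df] dc.
have b1 t : bmeas (f1 t * trig_sum n (c t)) by apply: bmeasM => //; exact: bmeas_trig.
have b2 t : bmeas (f t * trig_sum n (c1 t)) by apply: bmeasM => //; exact: bmeas_trig.
split=> [t|t|xi].
- by apply: bmeasM => //; exact: bmeas_trig.
- exact: bmeasD.
have h eta := drvC_mul (dc eta) (df (xi - eta)).
apply: drvC_eq (drvC_sum (win n) h) _ _ => t *.
  by rewrite fourier_mul_trig.
rewrite (fourierD _ (b1 t) (b2 t)) !fourier_mul_trig // -big_split.
by apply: eq_bigr => eta _ /=; rewrite addrC.
Qed.

Lemma drvF_pow a b n (c c1 : R -> int -> R[i]) j :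
  (forall xi, drvC a b (c^~ xi) (c1^~ xi)) ->
  drvF a b (fun t => trig_sum n (c t) ^+ j)
    (fun t => fun x => j%:R * ((trig_sum n (c t) ^+ j.-1 * trig_sum n (c1 t)) x)).
Proof.
move=> dc; have bt i t : bmeas (trig_sum n (c t) ^+ i) by exact: bmeas_pow.
have bt' i t : bmeas (trig_sum n (c t) ^+ i * trig_sum n (c1 t)).
  by apply: bmeasM => //; exact: bmeas_trig.
elim: j => [|j IH].
  split=> [t|t|xi] //.
    by apply: bmeasZ.
  apply: drvC_eq (drvC_cst a b (fourier (1 : R -> R[i]) xi)) _ _ => t *.
    by rewrite expr0.
  by rewrite fourierZ // mul0r.
have [_ _ h] := drvF_mul n IH dc.
split=> [t|t|xi] //; first exact: bmeasZ.
apply: drvC_eq (h xi) _ _ => t *; apply: eq_fourier => x _; first by rewrite exprSr.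
set f := trig_sum n (c t); set f1 := trig_sum n (c1 t).
change (j%:R * ((f ^+ j.-1) x * f1 x) * f x + (f ^+ j) x * f1 x =
  j.+1%:R * ((f ^+ j) x * f1 x)).
case: j {IH h} => [|j]; first by ring.
have -> : (f ^+ j.+1) x = (f ^+ j) x * f x by rewrite exprSr.
by rewrite -[j.+2%:R]natr1 /=; ring.
Qed.

End TimeDerivative.

(** * Quadrature in time *)

Section Quadrature.
Context {R : realType}.
Implicit Types (t tau s : R) (xi : int).

Lemma hball_half s (c : int -> R[i]) B (z : R) : 0 <= z -> hball s c B ->
  hball s (fun xi => z%:C * c xi) (z * B).
Proof.
move=> z0 h; rewrite -{2}(ger0_norm z0) -normc_real; exact: hball_scale.
Qed.

(** The mean value inequality for [w x + (x - t) g t], whose derivative is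
    [- (g x - g t) - r x]. *)
Lemma euler_quad n s t tau (w g g' r : R -> int -> R[i]) Rr G :
  0 <= tau -> 0 <= Rr -> 0 <= G ->
  (forall xi, drvC t (t + tau) (w^~ xi) (fun x => - (g x xi + r x xi))) ->
  (forall xi, drvC t (t + tau) (g^~ xi) (g'^~ xi)) ->
  (forall x, supp n (w x)) -> (forall x, supp n (g x)) ->
  (forall x, x \in `]t, t + tau[ -> hball s (r x) Rr) ->
  (forall x, x \in `]t, t + tau[ -> hball s (g' x) G) ->
  hball s (fun xi => w (t + tau) xi - w t xi + tau%:C * g t xi) (tau * (Rr + tau * G)).
Proof.
move=> tau0 Rr0 G0 dw dg sw sg hr hg.
have tt : t <= t + tau by rewrite lerDl.
pose y x xi := w x xi + (x - t)%:C * g t xi.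
have dy xi : drvC t (t + tau) (y^~ xi) (fun x => - (g x xi - g t xi) - r x xi).
  have h := drvC_mul (drvC_add (drvC_id t (t + tau)) (drvC_cst t (t + tau) (- t%:C))) (drvC_cst _ _ (g t xi)).
  apply: drvC_eq (drvC_add (dw xi) h) _ _ => x *.
    by rewrite /y rmorphB.
  by ring.
have sy x : supp n (y x) by move=> xi h; rewrite /y sw // sg // mulr0 addr0.
have := @hball_mvi R n s y _ t (t + tau) (tau * G + Rr) tt _ dy sy.
have -> : (tau * G + Rr) * (t + tau - t) = tau * (Rr + tau * G) by ring.
move=> h; apply: hball_ext (h _ _).
- by move=> xi; rewrite /y subrr mul0r addr0 addrAC [t + tau]addrC addrK; ring.
- by rewrite addr_ge0 // mulr_ge0.
move=> x hx; have := hx; rewrite in_itv /= => /andP[x1 x2].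
apply: hball_sub; last exact: hr.
apply: hball_opp; apply: hball_le (_ : hball s _ (G * (x - t))) _.
  apply: (@hball_mvi R n s g g') => //; first exact: ltW.
    by move=> xi; apply: drvC_sub (dg xi) => //; exact: ltW.
  move=> z; rewrite in_itv /= => /andP[z1 z2]; apply: hg.
  by rewrite in_itv /= z1 (lt_trans z2).
by rewrite mulrC; apply: ler_wpM2r => //; lra.
Qed.

(** The mean value inequality for [w x + (x - t) (g t + g x) / 2]: its derivative
    is a first order remainder of [g], which needs a Lipschitz bound on the
    regular part [beta] of [g'] only. The rough part [rho] enters with its size,
    and no second derivative of [g] is taken. *)
Lemma trapezoid n s t tau (w g beta rho dl r : R -> int -> R[i]) Rr P D :
  0 <= tau -> 0 <= Rr -> 0 <= P -> 0 <= D ->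
  (forall xi, drvC t (t + tau) (w^~ xi) (fun x => - (g x xi + r x xi))) ->
  (forall xi, drvC t (t + tau) (g^~ xi) (fun x => beta x xi + rho x xi)) ->
  (forall xi, drvC t (t + tau) (beta^~ xi) (dl^~ xi)) ->
  (forall x, supp n (w x)) -> (forall x, supp n (g x)) -> (forall x, supp n (beta x)) ->
  (forall x, x \in `]t, t + tau[ -> hball s (r x) Rr) ->
  (forall x, x \in `]t, t + tau[ -> hball s (rho x) P) ->
  (forall x, x \in `]t, t + tau[ -> hball s (dl x) D) ->
  hball s (fun xi => w (t + tau) xi - w t xi + (tau / 2)%:C * (g t xi + g (t + tau) xi))
    (tau * (Rr + tau * P + tau ^+ 2 * D)).
Proof.
move=> tau0 Rr0 P0 D0 dw dg db sw sg sb hr hrho hdl.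
have tt : t <= t + tau by rewrite lerDl.
pose y x xi := w x xi + (2^-1)%:C * ((x - t)%:C * (g t xi + g x xi)).
pose y' x xi := (2^-1)%:C * ((x - t)%:C * rho x xi - (g x xi - x%:C * beta x xi - (g t xi - t%:C * beta x xi))) - r x xi.
have dy xi : drvC t (t + tau) (y^~ xi) (y'^~ xi).
  have h1 := drvC_add (drvC_id t (t + tau)) (drvC_cst t (t + tau) (- t%:C)).
  have h2 := drvC_add (drvC_cst t (t + tau) (g t xi)) (dg xi).
  apply: drvC_eq (drvC_add (dw xi) (drvC_scale (2^-1)%:C (drvC_mul h1 h2))) _ _ => x *.
    by rewrite /y rmorphB.
  have e : g x xi = (2^-1)%:C * (g x xi + g x xi).
    rewrite -mulr2n -[g x xi *+ 2]mulr_natl mulrA.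
    by rewrite -(rmorph_nat (real_complex R)) -rmorphM mulVf ?mul1r // pnatr_eq0.
  by rewrite /y' rmorphB /= [X in - (X + _)]e; ring.
have sy x : supp n (y x) by move=> xi h; rewrite /y sw // !sg // addr0 !mulr0 addr0.
have hb1 x : x \in `]t, t + tau[ -> forall z, z \in `]t, x[ ->
    hball s (fun xi => beta z xi + rho z xi - beta x xi) (tau * D + P).
  rewrite in_itv /= => /andP[x1 x2] z; rewrite in_itv /= => /andP[z1 z2].
  apply: hball_ext (_ : hball s (fun xi => - (beta x xi - beta z xi) + rho z xi) _).
    by move=> xi; ring.
  apply: hball_add; last by apply: hrho; rewrite in_itv /= z1 (lt_trans z2).
  apply: hball_opp; apply: hball_le (_ : hball s _ (D * (x - z))) _.
    apply: (@hball_mvi R n s beta dl) => //; first exact: ltW.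
      by move=> xi; apply: drvC_sub (db xi); exact: ltW.
    move=> v; rewrite in_itv /= => /andP[v1 v2]; apply: hdl.
    by rewrite in_itv /= (lt_trans z1) //= (lt_trans v2).
  by rewrite mulrC; apply: ler_wpM2r => //; lra.
have h2 x : x \in `]t, t + tau[ ->
    hball s (fun xi => g x xi - x%:C * beta x xi - (g t xi - t%:C * beta x xi)) ((tau * D + P) * tau).
  move=> hx; have := hx; rewrite in_itv /= => /andP[x1 x2].
  apply: hball_le (_ : hball s _ ((tau * D + P) * (x - t))) _; last first.
    by apply: ler_wpM2l; [rewrite addr_ge0 // mulr_ge0|lra].
  apply: (@hball_mvi R n s (fun z xi => g z xi - z%:C * beta x xi)
     (fun z xi => beta z xi + rho z xi - beta x xi)).
  - exact: ltW.
  - by rewrite addr_ge0 // mulr_ge0.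
  - move=> xi; have h := drvC_opp (drvC_mul (drvC_id t x) (drvC_cst t x (beta x xi))).
    have hg : drvC t x (g^~ xi) (fun x => beta x xi + rho x xi).
      by apply: drvC_sub (dg xi) => //; exact: ltW.
    by apply: drvC_eq (drvC_add hg h) _ _ => v * //; ring.
  - by move=> z xi h; rewrite sg // sb // mulr0 subrr.
  - exact: hb1.
have := @hball_mvi R n s y y' t (t + tau) (Rr + tau * P + tau ^+ 2 * D) tt _ dy sy.
have -> : (Rr + tau * P + tau ^+ 2 * D) * (t + tau - t) =
   tau * (Rr + tau * P + tau ^+ 2 * D) by ring.
move=> h; apply: hball_ext (h _ _).
- move=> xi; rewrite /y subrr mul0r mulr0 addr0 [t + tau]addrC addrK [tau + t]addrC.
  by rewrite rmorphM /=; ring.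
- by rewrite !addr_ge0 // mulr_ge0 // sqr_ge0.
move=> x hx; have := hx; rewrite in_itv /= => /andP[x1 x2].
have := hball_sub (hball_half (_ : 0 <= 2^-1) (hball_sub (hball_half (_ : 0 <= x - t) (hrho x hx)) (h2 x hx))) (hr x hx).
move=> /(_ ltac:(lra) ltac:(lra)) h'; apply: hball_le h' _.
have a1 : (x - t) * P <= tau * P by apply: ler_wpM2r => //; lra.
have a2 : 0 <= tau ^+ 2 * D by rewrite mulr_ge0 ?sqr_ge0.
have -> : (tau * D + P) * tau = tau ^+ 2 * D + tau * P by ring.
lra.
Qed.

End Quadrature.

(* From here on a Fourier coefficient is never to be unfolded to an integral by
   conversion. *)
Opaque fourier.

(** * The local error *)

Section Consistency.
Context {R : realType}.
Implicit Types (a b c : int -> R[i]) (s t tau eps A B D : R) (xi eta : int).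

Definition cut n c xi : R[i] := if (`|xi| <= n)%N then c xi else 0.

Lemma supp_cut n c : supp n (cut n c).
Proof. by move=> xi h; rewrite /cut ifN // -ltnNge. Qed.

Lemma cut_id n c xi : (`|xi| <= n)%N -> cut n c xi = c xi.
Proof. by rewrite /cut => ->. Qed.

Lemma hball_cut n s c B : hball s c B -> hball s (cut n c) B.
Proof.
apply: hball_coef => xi; rewrite /cut; case: ifP => // _.
by rewrite ComplexField.Normc.normc0 normc_ge0.
Qed.

Lemma trig_sum_cut n c : trig_sum n (cut n c) = trig_sum n c.
Proof. by apply: trig_sum_ext => xi h; rewrite cut_id. Qed.

(** [dNL] is the linearisation c |-> P_n d_x (a^k c) of the nonlinearity, and
    [d2NL] its variation in the direction [b] of the base point [a]. *)
Definition dNL (k n : nat) a c : int -> R[i] :=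
  cut n (dif (fourier (trig_sum n a ^+ k * trig_sum n c))).

Definition d2NL (k n : nat) a b c : int -> R[i] :=
  cut n (dif (fourier ((fun x => k%:R * ((trig_sum n a ^+ k.-1 * trig_sum n b) x))
     * trig_sum n c))).

Lemma supp_dNL k n a c : supp n (dNL k n a c). Proof. exact: supp_cut. Qed.

Lemma dNL_bound k s D : - 1 / 2 < s -> exists2 K, 0 < K & forall n a c B,
  hball (s + 1) a D -> hball (s + 1) c B -> hball s (dNL k n a c) (K * B).
Proof.
move=> hs; have s1 : 1 / 2 < s + 1 by lra.
have [K K1 hK] := @fball_mul R _ s1.
have [P P0 hP] := @fball_pow R _ D k s1.
exists (K * P) => [|n a c B ha hc]; first by rewrite mulr_gt0 //; lra.
apply: hball_cut; apply: hball_dif; apply: hK; first exact: bmeas_pow.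
- exact: is_trig_trig.
- by apply: hP; [exact: is_trig_trig|exact: fball_trig].
- exact: fball_trig.
Qed.

Lemma fball_scale s f B (z : R[i]) : bmeas f -> fball s f B ->
  fball s (fun x => z * f x) (normc z * B).
Proof.
move=> bf h; apply: hball_ext (hball_scale z h) => xi.
by rewrite fourierZ.
Qed.

Lemma d2NL_bound k s D : - 1 / 2 < s -> exists2 K, 0 < K & forall n a b c A B,
  hball (s + 1) a D -> hball (s + 1) b A -> hball (s + 1) c B -> hball s (d2NL k n a b c) (K * A * B).
Proof.
move=> hs; have s1 : 1 / 2 < s + 1 by lra.
have [K K1 hK] := @fball_mul R _ s1.
have [P P0 hP] := @fball_pow R _ D k.-1 s1.
have k0 := normc_ge0 (k%:R : R[i]).
exists (K * ((normc (k%:R : R[i]) + 1) * (K * P))) => [|n a b c A B ha hb' hc].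
  by rewrite !mulr_gt0 //; lra.
have [A0 _] := hb'; have [B0 _] := hc.
have ti c' : is_trig (trig_sum n c') by exact: is_trig_trig.
have bp : bmeas (trig_sum n a ^+ k.-1 * trig_sum n b).
  by apply: is_trig_bm; apply: is_trigM => //; exact: is_trigX.
apply: (@hball_le _ _ _ (K * (normc (k%:R : R[i]) * (K * P * A)) * B)).
  apply: hball_cut; apply: hball_dif; apply: (hK) => //.
  - exact: bmeasZ.
  - apply: fball_scale => //; apply: (hK) => //; first exact: bmeas_pow.
      by apply: hP => //; exact: fball_trig.
    exact: fball_trig.
  - exact: fball_trig.
have q0 : 0 <= K * (K * P * A) * B by rewrite !mulr_ge0 //; lra.
rewrite -subr_ge0.
by have -> : K * ((normc (k%:R : R[i]) + 1) * (K * P)) * A * B -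
  K * (normc (k%:R : R[i]) * (K * P * A)) * B = K * (K * P * A) * B by ring.
Qed.

Lemma NLE k n c : NL k n c = cut n (fun xi => k%:R^-1 * dif (fourier (trig_sum n c ^+ k)) xi).
Proof.
apply/funext => xi; rewrite /NL /cut /dif; case: ifP => // _.
by move: (fourier _ xi) => F; rewrite mulrA.
Qed.

Lemma normc_invn k : normc (k.+1%:R^-1 : R[i]) <= 1.
Proof.
have -> : (k.+1%:R^-1 : R[i]) = (k.+1%:R^-1)%:C by rewrite fmorphV /= rmorph_nat.
by rewrite normc_real ger0_norm ?invr_ge0 // invf_le1 ?ltr0n // ler1n.
Qed.

Lemma hball_invn k s c B : hball s c B -> hball s (fun xi => k.+1%:R^-1 * c xi) B.
Proof.
apply: hball_coef => xi; rewrite ComplexField.Normc.normcM ler_piMl ?normc_ge0 //.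
exact: normc_invn.
Qed.

Lemma NL_bound k s D : - 1 / 2 < s -> exists2 K, 0 < K & forall n a,
  hball (s + 1) a D -> hball s (NL k.+1 n a) K.
Proof.
move=> hs; have s1 : 1 / 2 < s + 1 by lra.
have [P P0 hP] := @fball_pow R _ D k.+1 s1.
exists P => // n a ha; rewrite NLE; apply: hball_cut; apply: hball_invn; apply: hball_dif.
by apply: hP; [exact: is_trig_trig|exact: fball_trig].
Qed.

Lemma NL_lip k s D : - 1 / 2 < s -> exists2 K, 0 < K & forall n a b B,
  hball (s + 1) a D -> hball (s + 1) b D -> hball (s + 1) (fun xi => a xi - b xi) B ->
  hball s (fun xi => NL k.+1 n a xi - NL k.+1 n b xi) (K * B).
Proof.
move=> hs; have s1 : 1 / 2 < s + 1 by lra.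
have [P P0 hP] := @fball_powB R _ D k.+1 s1.
exists P => // n a b B ha hb' hab.
have ti c' : is_trig (trig_sum n c') by exact: is_trig_trig.
have h : fball (s + 1) (trig_sum n a ^+ k.+1 - trig_sum n b ^+ k.+1) (P * B).
  apply: hP => //; [exact: fball_trig|exact: fball_trig|].
  apply: (@hball_ext _ _ (fourier (trig_sum n (fun xi => a xi - b xi)))); last exact: fball_trig.
  by move=> xi; apply: eq_fourier => x _; exact: esym (trig_sumB _ _ _ _).
apply: hball_ext (hball_cut n (hball_invn k (hball_dif h))) => xi.
rewrite !NLE /cut; case: ifP => _; last by rewrite subrr.
rewrite /dif (fourierB _ (bmeas_pow n a _) (bmeas_pow n b _)).
by rewrite !mulrBr.
Qed.

Lemma drvC_cut n y y' t1 t2 : (forall xi, drvC t1 t2 (y^~ xi) (y'^~ xi)) ->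
  forall xi, drvC t1 t2 (fun t => cut n (y t) xi) (fun t => cut n (y' t) xi).
Proof.
move=> h xi; rewrite /cut; case: (_ <= _)%N; [exact: h|exact: drvC_cst].
Qed.

Lemma drvC_NL k n (a a1 : R -> int -> R[i]) t1 t2 : (forall xi, drvC t1 t2 (a^~ xi) (a1^~ xi)) ->
  forall xi, drvC t1 t2 (fun t => NL k.+1 n (a t) xi) (fun t => dNL k n (a t) (a1 t) xi).
Proof.
move=> h xi; have [_ _ hp] := drvF_pow n k.+1 h.
have hc := @drvC_cut n (fun t xi => k.+1%:R^-1 * dif (fourier (trig_sum n (a t) ^+ k.+1)) xi)
  _ t1 t2 (fun xi => drvC_scale k.+1%:R^-1 (drvC_scale (ik xi) (hp xi))) xi.
apply: drvC_eq hc _ _ => t * /=; first by rewrite NLE.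
rewrite /dNL /cut; case: ifP => // _; rewrite /dif fourierZ; last first.
  by apply: bmeasM; [exact: bmeas_pow|exact: bmeas_trig].
move: (fourier _ xi) => F.
by rewrite mulrCA (mulrA _ _ F) mulVf ?pnatr_eq0 // mul1r.
Qed.

Lemma drvC_dNL k n (a a1 c c1 : R -> int -> R[i]) t1 t2 :
  (forall xi, drvC t1 t2 (a^~ xi) (a1^~ xi)) -> (forall xi, drvC t1 t2 (c^~ xi) (c1^~ xi)) ->
  forall xi, drvC t1 t2 (fun t => dNL k n (a t) (c t) xi)
    (fun t => d2NL k n (a t) (a1 t) (c t) xi + dNL k n (a t) (c1 t) xi).
Proof.
move=> ha hc xi; have [_ _ h] := drvF_mul n (drvF_pow n k ha) hc.
apply: drvC_eq (drvC_cut n (fun xi => drvC_scale (ik xi) (h xi)) xi) _ _ => t * //.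
rewrite /dNL /d2NL /cut; case: ifP => // _; last by rewrite addr0.
have bp : bmeas (trig_sum n (a t) ^+ k.-1 * trig_sum n (a1 t)).
  by apply: bmeasM; [exact: bmeas_pow|exact: bmeas_trig].
have b1 := bmeasM (bmeasZ k%:R bp) (bmeas_trig n (c t)).
have b2 := bmeasM (bmeas_pow n (a t) k) (bmeas_trig n (c1 t)).
by rewrite /dif -mulrDr -(fourierD _ b1 b2).
Qed.

Lemma dNL_sub k n a c d xi : dNL k n a (fun eta => c eta - d eta) xi =
  dNL k n a c xi - dNL k n a d xi.
Proof.
rewrite /dNL /cut; case: ifP => // _; last by rewrite subrr.
rewrite /dif -mulrBr; congr (_ * _).
have b c' : bmeas (trig_sum n a ^+ k * trig_sum n c').
  by apply: bmeasM; [exact: bmeas_pow|exact: bmeas_trig].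
rewrite -(fourierB _ (b c) (b d)); apply: eq_fourier => x _.
change ((trig_sum n a ^+ k) x * trig_sum n (fun eta => c eta - d eta) x =
  (trig_sum n a ^+ k) x * trig_sum n c x - (trig_sum n a ^+ k) x * trig_sum n d x).
by rewrite -mulrBr trig_sumB.
Qed.

(** the symbol of - eps^2 d_x^3 *)
Definition airy_sym eps xi : R[i] := - (eps ^+ 2)%:C * ik xi ^+ 3.

Lemma airy_sym_im eps xi : airy_sym eps xi = 0 +i* (eps ^+ 2 * xi%:~R ^+ 3).
Proof.
rewrite /airy_sym /ik; apply/eqP; rewrite eq_complex; apply/andP; split; apply/eqP => /=; ring.
Qed.

Lemma hball_airy_sym s eps c B : 0 < eps <= 1 -> hball (s + 3) c B ->
  hball s (fun xi => airy_sym eps xi * c xi) B.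
Proof.
move=> /andP[e0 e1]; apply: hball_dom1 => xi.
rewrite ComplexField.Normc.normcM wtD -mulrA; apply: ler_wpM2l; first exact: wt_ge0.
apply: ler_wpM2r; first exact: normc_ge0.
rewrite wtn /airy_sym ComplexField.Normc.normcM normcN normc_real normcX.
rewrite ger0_norm ?sqr_ge0 // -[leRHS]mul1r; apply: ler_pM => //.
- exact: sqr_ge0.
- by rewrite exprn_ge0 // normc_ge0.
- by rewrite expr_le1 // ltW.
- by rewrite ler_pXn2r ?nnegrE ?normc_ge0 ?jb_ge0 ?normc_ik_le.
Qed.

(** the symbol of exp (x eps^2 d_x^3) *)
Definition phase eps (x : R) xi : R[i] := expi (- (eps ^+ 2 * xi%:~R ^+ 3) * x).

Lemma phase0 eps xi : phase eps 0 xi = 1.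
Proof. by rewrite /phase mulr0 expi0. Qed.

Lemma phaseNK eps x xi : phase eps (- x) xi * phase eps x xi = 1.
Proof. by rewrite /phase -expiD mulrN addNr expi0. Qed.

Lemma hball_phase s eps x c B : hball s c B -> hball s (fun xi => phase eps x xi * c xi) B.
Proof.
by apply: hball_coef => xi; rewrite ComplexField.Normc.normcM normc_expi mul1r.
Qed.

Lemma drvC_phase eps t t1 t2 xi :
  drvC t1 t2 (fun x => phase eps (x - t) xi) (fun x => - airy_sym eps xi * phase eps (x - t) xi).
Proof.
apply: drvC_eq (drvC_expi t1 t2 (- (eps ^+ 2 * xi%:~R ^+ 3)) t) _ _ => // x _.
by rewrite airy_sym_im; congr (_ * _); apply/eqP; rewrite eq_complex /= oppr0 !eqxx.
Qed.

(** One step of the scheme in the variable u = exp (- t eps^2 d_x^3) v. In this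
    form, the average of the free flow and of two Euler steps, it inherits the
    stability of the Euler step. *)
Definition heun k n eps tau c xi : R[i] :=
  (2^-1)%:C * (phase eps (- tau) xi * c xi +
    euler k n tau (fun eta => phase eps (- tau) eta * euler k n tau c eta) xi).


(** Conjugated by the free flow, the projected exact solution satisfies
    w' = - (g + r), where g is the conjugated nonlinearity and r the effect of
    the discarded frequencies on the nonlinearity. The scheme is the trapezoidal
    rule for this equation, except that the value of g at the end point is
    computed from the predictor; the predictor is an Euler step, whose error
    tau^2 is multiplied by a further tau. *)
Lemma local_error k (g D cfl : R) : 3 / 2 < g -> 0 < D -> 0 < cfl ->
  exists2 K, 0 < K & forall n eps t tau (W Q : R -> int -> R[i]) del,
    0 < eps <= 1 -> 0 < tau -> tau * (1 + n%:R) ^+ 2 <= cfl ->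
    (forall x, x \in `[t, t + tau] -> hball (g + 7) (W x) D) ->
    (forall x, x \in `[t, t + tau] ->
       hball (g + 7) (fun xi => Q x xi - fourier (trig_sum n (W x) ^+ k.+1) xi) D) ->
    (forall x, x \in `[t, t + tau] ->
       hball (g + 1) (fun xi => Q x xi - fourier (trig_sum n (W x) ^+ k.+1) xi) del) ->
    (forall xi, drvC t (t + tau) (W^~ xi)
       (fun x => airy_sym eps xi * W x xi - k.+1%:R^-1 * (ik xi * Q x xi))) ->
    hball g (fun xi => heun k.+1 n eps tau (cut n (W t)) xi - cut n (W (t + tau)) xi)
      (K * tau * (del + tau ^+ 2)).
Proof.
move=> g32 D0 cfl0.
have [CN CN0 hCN] := @NL_bound k (g + 6) D ltac:(lra).
pose Ca := D + CN + D.
have Ca0 : 0 < Ca by rewrite /Ca; lra.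
have [Cm Cm0 hCm] := @dNL_bound k (g + 3) D ltac:(lra).
have [Cn Cn0 hCn] := @dNL_bound k g D ltac:(lra).
have [C2 C20 hC2] := @d2NL_bound k g D ltac:(lra).
have [Cp Cp0 hCp] := @NL_lip k g (D + cfl * CN) ltac:(lra).
pose Dd := CN + Cm * Ca + Cm * Ca + C2 * Ca * Ca + Cn * (Ca + Cm * Ca).
pose G := CN + Cm * Ca.
have pm : 0 < Cm * Ca by exact: mulr_gt0.
have G0 : 0 < G by rewrite /G; lra.
have Dd0 : 0 < Dd.
  have p2 : 0 < C2 * Ca * Ca by rewrite !mulr_gt0.
  have p3 : 0 < Cn * (Ca + Cm * Ca) by rewrite mulr_gt0 //; lra.
  by rewrite /Dd; lra.
pose K := (1 + cfl * Cn + Cp * cfl) + (Dd + Cp * G).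
have cn0 : 0 < cfl * Cn by exact: mulr_gt0.
have cp0 : 0 < Cp * cfl by exact: mulr_gt0.
have cg0 : 0 < Cp * G by exact: mulr_gt0.
exists K; first by rewrite /K; lra.
move=> n eps t tau W Q del he tau0 htau hW hQ7 hQ1 dW.
have tt : t <= t + tau by rewrite lerDl ltW.
have tin : t \in `[t, t + tau] by rewrite in_itv /= lexx.
have tin2 : t + tau \in `[t, t + tau] by rewrite in_itv /= lexx tt.
have oc x : x \in `]t, t + tau[ -> x \in `[t, t + tau].
  by rewrite !in_itv /= => /andP[/ltW -> /ltW ->].
have del0 : 0 <= del by case: (hQ1 _ tin).
have n1 : 1 <= 1 + n%:R :> R by rewrite lerDl.
have tn : tau * (1 + n%:R) <= cfl.
  apply: le_trans htau; apply: ler_wpM2l; first exact: ltW.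
  by rewrite expr2 ler_peMl //; lra.
have tc : tau <= cfl.
  by apply: le_trans tn; rewrite ler_peMr // ltW.
pose a x := cut n (W x).
have sa x : supp n (a x) by exact: supp_cut.
have ha x : x \in `[t, t + tau] -> hball (g + 7) (a x) D by move=> /hW; exact: hball_cut.
pose r0 x := cut n (fun xi => k.+1%:R^-1 * dif (fun eta => Q x eta - fourier (trig_sum n (W x) ^+ k.+1) eta) xi).
have sr0 x : supp n (r0 x) by exact: supp_cut.
have hr6 x : x \in `[t, t + tau] -> hball (g + 6) (r0 x) D.
  move=> hx; apply: hball_cut; apply: hball_invn; apply: hball_dif.
  by rewrite (_ : g + 6 + 1 = g + 7); [exact: hQ7|ring].
have hr x : x \in `[t, t + tau] -> hball g (r0 x) del.
  by move=> hx; apply: hball_cut; apply: hball_invn; apply: hball_dif; exact: hQ1.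
have hr1 x : x \in `[t, t + tau] -> hball (g + 1) (r0 x) ((1 + n%:R) * del).
  by move=> hx; apply: hball_inverse => //; exact: hr.
pose N x := NL k.+1 n (a x).
have sN x : supp n (N x) by exact: supp_NL.
have hN x : x \in `[t, t + tau] -> hball (g + 6) (N x) CN.
  by move=> /ha h; apply: hCN; rewrite (_ : g + 6 + 1 = g + 7); [exact: h|ring].
pose A1 x xi := airy_sym eps xi * a x xi - N x xi.
pose a1 x xi := A1 x xi - r0 x xi.
have da xi : drvC t (t + tau) (a^~ xi) (a1^~ xi).
  apply: drvC_eq (drvC_cut n dW xi) _ _ => x * //.
  rewrite /a1 /A1 /r0 /N NLE /a trig_sum_cut /cut; case: ifP => _; last by rewrite mulr0 !subrr.
  rewrite /dif; move: (fourier _ xi) => F; rewrite mulrBr mulrBr.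
  by rewrite opprB addrA subrK.
have hL s B c : hball (s + 3) c B -> hball s (fun xi => airy_sym eps xi * c xi) B.
  by move=> h; apply: hball_airy_sym.
have hA1 x : x \in `[t, t + tau] -> hball (g + 4) (A1 x) (D + CN).
  move=> hx; apply: hball_sub.
    by apply: (hL) => //; rewrite (_ : g + 4 + 3 = g + 7); [exact: ha|ring].
  by apply: hball_weaken (hN x hx); lra.
have hA1' x : x \in `[t, t + tau] -> hball (g + 4) (A1 x) Ca.
  by move=> hx; apply: hball_le (hA1 x hx) _; rewrite /Ca; lra.
have ha1 x : x \in `[t, t + tau] -> hball (g + 4) (a1 x) Ca.
  by move=> hx; apply: hball_sub (hA1 x hx) _; apply: hball_weaken (hr6 x hx); lra.
have w4 x : x \in `[t, t + tau] -> hball (g + 3 + 1) (a x) D.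
  by move=> hx; apply: hball_weaken (ha x hx); lra.
have w1 x : x \in `[t, t + tau] -> hball (g + 1) (a x) D.
  by move=> hx; apply: hball_weaken (ha x hx); lra.
have e4 : g + 3 + 1 = g + 4 by ring.
have hM c x : x \in `[t, t + tau] -> hball (g + 4) c Ca -> hball (g + 3) (dNL k n (a x) c) (Cm * Ca).
  by move=> hx hc; apply: hCm; [exact: w4|rewrite e4].
pose A1' x xi := airy_sym eps xi * a1 x xi - dNL k n (a x) (a1 x) xi.
have dN := drvC_NL k n da.
have dA1 xi : drvC t (t + tau) (A1^~ xi) (A1'^~ xi).
  exact: drvC_add (drvC_scale (airy_sym eps xi) (da xi)) (drvC_opp (dN xi)).
have hA1d x : x \in `[t, t + tau] -> hball (g + 1) (A1' x) (Ca + Cm * Ca).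
  move=> hx; apply: hball_sub.
    by apply: (hL) => //; rewrite (_ : g + 1 + 3 = g + 4); [exact: ha1|ring].
  by apply: (@hball_weaken R _ (g + 3)); [lra|exact: hM (ha1 x hx)].
pose ph x xi := phase eps (x - t) xi.
have dph xi : drvC t (t + tau) (ph^~ xi) (fun x => - airy_sym eps xi * ph x xi).
  exact: drvC_phase.
have hph s c B x : hball s c B -> hball s (fun xi => ph x xi * c xi) B by exact: hball_phase.
(* the derivative of [g] splits into [beta], differentiable once more, and
   [rho], which contains the truncation remainder [r0] *)
pose w x xi := ph x xi * a x xi.
pose gg x xi := ph x xi * N x xi.
pose r x xi := ph x xi * r0 x xi.
pose b0 x xi := dNL k n (a x) (A1 x) xi - airy_sym eps xi * N x xi.
pose beta x xi := ph x xi * b0 x xi.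
pose rho x xi := - (ph x xi * dNL k n (a x) (r0 x) xi).
pose b1 x xi := d2NL k n (a x) (a1 x) (A1 x) xi + dNL k n (a x) (A1' x) xi
   - airy_sym eps xi * dNL k n (a x) (a1 x) xi.
pose dl x xi := ph x xi * (b1 x xi - airy_sym eps xi * b0 x xi).
have dw xi : drvC t (t + tau) (w^~ xi) (fun x => - (gg x xi + r x xi)).
  apply: drvC_eq (drvC_mul (dph xi) (da xi)) _ _ => x * //.
  by rewrite /gg /r /a1 /A1; ring.
have dg xi : drvC t (t + tau) (gg^~ xi) (fun x => beta x xi + rho x xi).
  apply: drvC_eq (drvC_mul (dph xi) (dN xi)) _ _ => x * //.
  have e (L u v p q : R[i]) : - L * u * v + u * (p - q) = u * (p - L * v) - u * q by ring.
  by rewrite /a1 dNL_sub; exact: e.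
have db0 xi : drvC t (t + tau) (b0^~ xi) (b1^~ xi).
  exact: drvC_add (drvC_dNL k n da dA1 xi) (drvC_opp (drvC_scale (airy_sym eps xi) (dN xi))).
have db xi : drvC t (t + tau) (beta^~ xi) (dl^~ xi).
  apply: drvC_eq (drvC_mul (dph xi) (db0 xi)) _ _ => x * //.
  by rewrite /dl; ring.
have sw x : supp n (w x) by move=> xi h; rewrite /w sa // mulr0.
have sg x : supp n (gg x) by move=> xi h; rewrite /gg sN // mulr0.
have sb x : supp n (beta x).
  by move=> xi h; rewrite /beta /b0 supp_dNL // sN // mulr0 subr0 mulr0.
have hgg x : x \in `[t, t + tau] -> hball (g + 1) (fun xi => beta x xi + rho x xi) G.
  move=> hx; apply: hball_ext (_ : hball _ (fun xi => ph x xi * (- (airy_sym eps xi * N x xi) + dNL k n (a x) (a1 x) xi)) _).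
    move=> xi; rewrite /a1 dNL_sub.
    have e (l u p q : R[i]) : u * (- l + (p - q)) = u * (p - l) - u * q by ring.
    exact: e.
  apply: hph; apply: hball_add.
    by apply: hball_opp; apply: (hL) => //; apply: hball_weaken (hN x hx); lra.
  by apply: (@hball_weaken R _ (g + 3)); [lra|exact: hM (ha1 x hx)].
have hdl x : x \in `[t, t + tau] -> hball g (dl x) Dd.
  move=> hx; apply: hph.
  have h1 : hball g (fun xi => airy_sym eps xi * (airy_sym eps xi * N x xi)) CN.
    by apply: (hL) => //; apply: (hL) => //; apply: hball_weaken (hN x hx); lra.
  have h2 : hball g (fun xi => airy_sym eps xi * dNL k n (a x) (A1 x) xi) (Cm * Ca).
    by apply: (hL) => //; exact: hM (hA1' x hx).
  have h3 : hball g (fun xi => airy_sym eps xi * dNL k n (a x) (a1 x) xi) (Cm * Ca).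
    by apply: (hL) => //; exact: hM (ha1 x hx).
  have h4 : hball g (d2NL k n (a x) (a1 x) (A1 x)) (C2 * Ca * Ca).
    apply: hC2; first exact: w1.
      by apply: hball_weaken (ha1 x hx); lra.
    by apply: hball_weaken (hA1' x hx); lra.
  have h5 : hball g (dNL k n (a x) (A1' x)) (Cn * (Ca + Cm * Ca)).
    by apply: hCn; [exact: w1|exact: hA1d].
  have h := hball_add (hball_add (hball_sub (hball_sub h1 h2) h3) h4) h5.
  apply: hball_ext h => xi.
  have e (L l m m' p q : R[i]) : L * l - L * m - L * m' + p + q =
    p + q - L * m' - L * (m - l) by ring.
  exact: e.
have hrho x : x \in `[t, t + tau] -> hball g (rho x) (Cn * ((1 + n%:R) * del)).
  move=> hx; apply: hball_opp; apply: hph; apply: hCn; first exact: w1.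
  exact: hr1.
(* the remainder loses one derivative in [rho] and in the predictor; the inverse
   inequality pays for it by [1 + n], and the step restriction by [tau] *)
have nd0 : 0 <= (1 + n%:R) * del by rewrite mulr_ge0 //; lra.
have trap := @trapezoid R n g t tau w gg beta rho dl r del (Cn * ((1 + n%:R) * del)) Dd
  (ltW tau0) del0 (mulr_ge0 (ltW Cn0) nd0) (ltW Dd0) dw dg db sw sg sb
  (fun x hx => hph _ _ _ x (hr x (oc x hx))) (fun x hx => hrho x (oc x hx))
  (fun x hx => hdl x (oc x hx)).
have eul := @euler_quad R n (g + 1) t tau w gg _ r ((1 + n%:R) * del) G
  (ltW tau0) nd0 (ltW G0) dw dg sw sg
  (fun x hx => hph _ _ _ x (hr1 x (oc x hx))) (fun x hx => hgg x (oc x hx)).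
have ph0 xi : ph t xi = 1 by rewrite /ph subrr phase0.
have phN xi : phase eps (- tau) xi * ph (t + tau) xi = 1.
  by rewrite /ph addrAC subrr add0r phaseNK.
pose v xi := phase eps (- tau) xi * euler k.+1 n tau (a t) xi.
have hv : hball (g + 1) (fun xi => a (t + tau) xi - v xi) (tau * ((1 + n%:R) * del + tau * G)).
  apply: hball_ext (hball_phase eps (- tau) eul) => xi.
  rewrite /v /euler /w /gg !ph0 !mul1r -/(N t).
  have e (A p a0 a2 N0 q : R[i]) : A * p = 1 ->
      A * (p * a2 - a0 + q * N0) = a2 - A * (a0 - q * N0).
    by move=> Ap; rewrite -[in RHS](mul1r a2) -{}Ap; ring.
  exact: e (phN xi).
have hv1 : hball (g + 1) v (D + cfl * CN).
  apply: hball_phase; apply: hball_le (_ : hball _ _ (D + tau * CN)) _; last first.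
    by rewrite lerD2l; apply: ler_wpM2r => //; exact: ltW.
  apply: hball_sub; first exact: w1.
  by apply: hball_half; [exact: ltW|apply: hball_weaken (hN t tin); lra].
have wD : hball (g + 1) (a (t + tau)) (D + cfl * CN).
  by apply: hball_le (w1 _ tin2) _; rewrite lerDl mulr_ge0 // ltW.
have hNd := hCp n _ _ _ wD hv1 hv.
have h2 : 0 <= tau / 2 by rewrite divr_ge0 // ltW.
have fin := hball_add (hball_opp (hball_phase eps (- tau) trap)) (hball_half h2 hNd).
apply: hball_le (hball_ext _ fin) _.
  move=> xi; rewrite -/(a t) -/(a (t + tau)).
  rewrite /heun /euler -/(v) -/(N t) -/(N (t + tau)) /w /gg !ph0 !mul1r.
  have q2 : (2^-1)%:C + (2^-1)%:C = 1 :> R[i].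
    by rewrite -rmorphD /= (_ : 2^-1 + 2^-1 = 1 :> R) //; lra.
  have t2 : (tau / 2)%:C = tau%:C * (2^-1)%:C :> R[i] by rewrite -rmorphM.
  rewrite t2.
  have e (A p a0 a2 N0 N2 Nv q tt' : R[i]) : A * p = 1 -> q + q = 1 ->
     - (A * (p * a2 - a0 + tt' * q * (N0 + p * N2))) + tt' * q * (N2 - Nv) =
     q * (A * a0 + (A * (a0 - tt' * N0) - tt' * Nv)) - a2.
    move=> Ap qq.
    have -> : - (A * (p * a2 - a0 + tt' * q * (N0 + p * N2))) + tt' * q * (N2 - Nv) =
       - (A * p) * a2 + A * a0 - tt' * q * (A * N0) - tt' * q * ((A * p) * N2) +
       tt' * q * (N2 - Nv) by ring.
    have -> : q * (A * a0 + (A * (a0 - tt' * N0) - tt' * Nv)) - a2 =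
      (q + q) * (A * a0) - tt' * q * (A * N0) - tt' * q * Nv - a2 by ring.
    by rewrite Ap qq; ring.
  exact: e (phN xi) q2.
set nd := (1 + n%:R) * del in nd0 *.
have P1 : tau * nd <= cfl * del by rewrite /nd mulrA; apply: ler_wpM2r.
have P0 : 0 <= tau * nd by rewrite mulr_ge0 // ltW.
have T0 : 0 <= tau ^+ 2 by exact: sqr_ge0.
have -> : tau * (del + tau * (Cn * nd) + tau ^+ 2 * Dd) +
   tau / 2 * (Cp * (tau * (nd + tau * G))) =
   tau * (del + Cn * (tau * nd) + tau ^+ 2 * Dd + 2^-1 * Cp * (tau * nd + tau ^+ 2 * G)) by field.
rewrite (mulrC K) -[leRHS]mulrA ler_pM2l //.
have b1' : Cn * (tau * nd) <= cfl * Cn * del.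
  by rewrite (mulrC cfl) -mulrA ler_pM2l.
have b2' : Cp * (tau * nd) <= Cp * cfl * del by rewrite -mulrA ler_pM2l.
have b3' : 0 <= Cp * (tau * nd) by rewrite mulr_ge0 // ltW.
have b4' : 0 <= Cp * (tau ^+ 2 * G) by rewrite !mulr_ge0 // ltW.
have b5' : 0 <= (cfl * Cn + Cp * cfl) * tau ^+ 2 by rewrite mulr_ge0 //; lra.
have b6' : 0 <= (Dd + Cp * G) * del by rewrite mulr_ge0 //; lra.
rewrite /K.
have -> : 2^-1 * Cp * (tau * nd + tau ^+ 2 * G) =
  2^-1 * (Cp * (tau * nd)) + 2^-1 * (Cp * (tau ^+ 2 * G)) by ring.
move: b1' b2' b3' b4' b5' b6' T0; clear.
move: (tau * nd) (tau ^+ 2) => X Y c1 c2 c3 c4 c5 c6 Y0; clear -c1 c2 c3 c4 c5 c6 Y0.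
move: Cn Cp Dd G cfl del c1 c2 c3 c4 c5 c6 => a b d e f h *; lra.
Qed.

End Consistency.

(** * The exact solution *)

Section ClassicalSolution.
Context {R : realType}.
Implicit Types (t x a b T tc : R) (f : R -> R) (g w : R -> R -> R).

Definition jcont tc g :=
  {within `[0, tc[ `*` [set: R], continuous (fun p : R * R => g p.1 p.2)}.

Lemma jcont_bound tc T g : T < tc -> jcont tc g ->
  exists2 K, 0 < K & forall t x, 0 <= t <= T -> x \in `[- (pi : R), pi] -> `|g t x| <= K.
Proof.
move=> Ttc cg.
have cK : compact (`[0, T] `*` `[- (pi : R), pi]) by apply: compact_setX; exact: segment_compact.
have {}cg : {within `[0, T] `*` `[- (pi : R), pi], continuous (fun p : R * R => g p.1 p.2)}.
  apply: continuous_subspaceW cg => -[t x] /= [ht _]; split => //.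
  by move: ht => /=; rewrite !in_itv /= => /andP[-> /le_lt_trans]; exact.
have /compact_bounded[K [_ hK]] := continuous_compact cg cK.
exists (`|K| + 1); first by rewrite ltr_pwDr.
move=> t x ht hx; apply: (hK (`|K| + 1)); first by rewrite (le_lt_trans (ler_norm K)) // ltrDl.
by exists (t, x) => //; split => //=; rewrite in_itv.
Qed.

Lemma jcont_space tc g t : 0 <= t < tc -> jcont tc g -> continuous (g t).
Proof.
move=> ht /subspace_continuousP cg x P hP.
have h : nbhs (t, x) (fun q : R * R => (`[0, tc[ `*` [set: R]) q -> P (g q.1 q.2)).
  by apply: (cg (t, x)) => //; split => //=; rewrite in_itv.
have [[U V] /= [hU hV] sub] := h.
apply: filterS hV => y Vy; apply: (sub (t, y) (conj (nbhs_singleton hU) Vy)); split => //=; by rewrite in_itv.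
Qed.

Lemma jcont_time0 tc T g x : T < tc -> jcont tc g -> {within `[0, T], continuous (g^~ x)}.
Proof.
move=> Ttc /subspace_continuousP cg; apply/subspace_continuousP => t ht P hP.
have ht' : 0 <= t < tc.
  by move: ht => /=; rewrite in_itv /= => /andP[-> /le_lt_trans]; exact.
have h : nbhs (t, x) (fun q : R * R => (`[0, tc[ `*` [set: R]) q -> P (g q.1 q.2)).
  by apply: (cg (t, x)) => //; split => //=; rewrite in_itv.
have [[U V] /= [hU hV] sub] := h.
apply: filterS hU => y Uy hyT; apply: (sub (y, x) (conj Uy (nbhs_singleton hV))).
have /andP[y0 yT] : 0 <= y <= T by move: hyT; rewrite /= in_itv.
by split => //=; rewrite in_itv /= y0 (le_lt_trans yT Ttc).
Qed.

Lemma jcont_pow tc g n : jcont tc g -> jcont tc (fun t x => g t x ^+ n).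
Proof.
move=> cg; elim: n => [|n IH] p; first by apply: cvg_cst.
have e : (fun q : R * R => g q.1 q.2 ^+ n.+1) = (fun q => g q.1 q.2 * g q.1 q.2 ^+ n).
  by apply/funext => q; rewrite exprS.
rewrite e.
by apply: cvgM; [exact: cg|exact: IH].
Qed.

Lemma derive1_periodic f p : periodic f p -> periodic (derive1 f) p.
Proof.
by move=> fp x; rewrite /derive1 fp; under eq_fun do rewrite addrA fp.
Qed.

Lemma derive1n_periodic f p n : periodic f p -> periodic (derive1n n f) p.
Proof. by move=> fp; elim: n => // n IH; rewrite derive1nS; exact: derive1_periodic. Qed.

Section Solution.
Variables (k : nat) (eps : R) (u0 : R -> R) (tc : R) (w : R -> R -> R).
Hypothesis sol : classical_solution k eps u0 tc w.

Definition dx j t x := derive1n j (w t) x.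

Lemma dx_cont j : (j <= 3)%N -> jcont tc (dx j).
Proof. exact: (sol_cont sol). Qed.

Lemma dx_derive j t x : (j < 3)%N -> 0 <= t < tc -> is_derive x (1 : R) (dx j t) (dx j.+1 t x).
Proof.
move=> j3 ht; apply: DeriveDef; first exact: (sol_dx sol).
by rewrite -derive1E /dx derive1nS.
Qed.

Lemma dx_end j t : (j <= 3)%N -> 0 <= t < tc -> dx j t pi = dx j t (- pi).
Proof.
move=> j3 ht; have := derive1n_periodic (j) (sol_periodic sol ht) (- pi).
by rewrite mulr2n addrA addNr add0r.
Qed.

(** The time derivative as given by the equation. Unlike the derivative itself,
    this expression makes sense and is continuous up to time 0. *)
Definition flow_rhs t x := - (eps ^+ 2 * dx 3 t x) - k%:R^-1 * (k%:R * w t x ^+ k.-1 * dx 1 t x).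

Lemma pow_derive t x : 0 <= t < tc ->
  is_derive x (1 : R) (fun y => w t y ^+ k) (k%:R * w t x ^+ k.-1 * dx 1 t x).
Proof.
move=> ht; have h := @dx_derive 0 t x isT ht.
rewrite (_ : (fun y => w t y ^+ k) = (dx 0 t) ^+ k); last by rewrite exprfctE.
exact: is_derive_eq (is_deriveX k h) _.
Qed.

Lemma sol_derive_t t x : 0 < t < tc -> is_derive t (1 : R) (w^~ x) (flow_rhs t x).
Proof.
move=> ht; have ht' : 0 <= t < tc by case/andP: ht => /ltW -> ->.
apply: DeriveDef; first exact: (sol_dt sol).
have [_ e] := pow_derive x ht'.
have := sol_eq sol x ht; rewrite !derive1E e => h.
by rewrite /flow_rhs -[LHS]subr0 -{}h /dx; ring.
Qed.

Lemma flow_rhs_cont : jcont tc flow_rhs.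
Proof.
have c0 := @dx_cont 0 isT; have c1 := @dx_cont 1 isT; have c3 := @dx_cont 3 isT.
have cp : jcont tc (fun t x => w t x ^+ k.-1) := jcont_pow (n := k.-1) c0.
move=> p; apply: cvgB.
  by apply: cvgN; apply: cvgM; [exact: cvg_cst|exact: c3].
apply: cvgM; first exact: cvg_cst.
apply: cvgM; last exact: c1.
apply: cvgM; first exact: cvg_cst.
exact: (cp p).
Qed.

Definition pairing phi t := rint (fun x => w t x * phi x).

Lemma w_cont t : 0 <= t < tc -> continuous (w t).
Proof. by move=> ht; exact: jcont_space ht (@dx_cont 0 isT). Qed.

Lemma contM f1 f2 : continuous f1 -> continuous f2 -> continuous (fun x => f1 x * f2 x).
Proof. by move=> c1 c2 x; apply: cvgM; [exact: c1|exact: c2]. Qed.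

(** Differentiation under the integral sign: the time derivative is dominated by
    the maximum of [flow_rhs] on a compact set. *)
Lemma pairing_derive phi t : continuous phi -> 0 < t < tc ->
  is_derive t (1 : R) (pairing phi) (rint (fun x => flow_rhs t x * phi x)).
Proof.
move=> cphi /andP[t0 ttc]; pose T := (t + tc) / 2.
have tT : t < T by rewrite /T; lra.
have Ttc : T < tc by rewrite /T; lra.
have [K K0 hK] := jcont_bound Ttc flow_rhs_cont.
have [_ [L hL]] := rbmeas_cont cphi.
have inI (s : R) : `]0, T[%classic s -> 0 < s < tc.
  by rewrite /= in_itv /= => /andP[-> /lt_trans]; exact.
have wcl (s : R) : 0 < s < tc -> 0 <= s < tc by case/andP => /ltW -> ->.
have d (s : R) x : `]0, T[%classic s ->
    is_derive s (1 : R) (fun r => w r x * phi x) (flow_rhs s x * phi x).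
  move=> /inI hs; have h := sol_derive_t x hs.
  apply: is_derive_eq (@is_deriveM _ _ (w^~ x) (cst (phi x)) s (1 : R) _ _ h (is_derive_cst _ _ _)) _.
  by rewrite scaler0 add0r /GRing.scale /= mulrC.
have It : `]0, T[%classic t by rewrite /= in_itv /= t0.
have intf (s : R) : `]0, T[%classic s ->
    lebesgue_measure.-integrable (@torus R) (EFin \o (fun x => w s x * phi x)).
  by move=> /inI /wcl hs; apply: rbmeas_integrable; apply: rbmeas_cont; apply: contM => //; exact: w_cont.
have derf (s : R) (x : R) : `]0, T[%classic s -> torus x -> derivable (fun r => w r x * phi x) s 1.
  by move=> hs _; case: (d s x hs).
have G0 (x : R) : 0 <= cst (K * `|L|) x by rewrite /= mulr_ge0 // ltW.
have iG : lebesgue_measure.-integrable (@torus R) (EFin \o cst (K * `|L|)).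
  exact: rbmeas_integrable (rbmeas_cst _).
have Gub (s x : R) : `]0, T[%classic s -> torus x ->
    `|partial1of2 (fun r x => w r x * phi x) s x| <= cst (K * `|L|) x.
  move=> hs tx; rewrite partial1of2E; case: (d s x hs) => _ ->.
  rewrite /= normrM; apply: ler_pM => //; last exact: le_trans (hL x tx) (ler_norm _).
  apply: hK; first by move: hs; rewrite /= in_itv /= => /andP[/ltW -> /ltW].
  by move: tx; rewrite /torus /= !in_itv /= => /andP[/ltW -> /ltW].
have h1 := @derivable_under_integral R _ _ lebesgue_measure (fun r x => w r x * phi x)
  torus measurable_torus t 0 T It intf derf _ G0 iG Gub.
have h2 := @differentiation_under_integral R _ _ lebesgue_measure (fun r x => w r x * phi x)
  torus measurable_torus t 0 T It intf derf _ G0 iG Gub.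
apply: DeriveDef; first exact: h1.
rewrite -derive1E [LHS]h2.
by apply: eq_rint => x _; rewrite partial1of2E; case: (d t x It).
Qed.

(** At time 0 there is no derivative, but the equation bounds the time increments
    of the solution uniformly in space. *)
Lemma pairing_within phi T : continuous phi -> T < tc -> {within `[0, T], continuous (pairing phi)}.
Proof.
move=> cphi Ttc.
have [K K0 hK] := jcont_bound Ttc flow_rhs_cont.
have [_ [L hL]] := rbmeas_cont cphi.
pose A := K * `|L| * (2 * pi) + 1.
have A0 : 0 < A by rewrite ltr_pwDr // !mulr_ge0 ?pi_ge0 // ltW.
have lip s t : 0 <= s -> s <= t -> t <= T -> `|pairing phi t - pairing phi s| <= A * (t - s).
  move=> s0 st tT.
  have hs : 0 <= s < tc by rewrite s0 (le_lt_trans (le_trans st tT)).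
  have ht : 0 <= t < tc by rewrite (le_trans s0 st) (le_lt_trans tT).
  have bs := rbmeas_cont (contM (w_cont hs) cphi); have bt := rbmeas_cont (contM (w_cont ht) cphi).
  rewrite /pairing -rintB //.
  apply: (@le_trans _ _ (K * (t - s) * `|L| * (2 * pi))).
    apply: rint_norm; first exact: rbmeasB.
    move=> x tx; rewrite -mulrBl normrM; apply: ler_pM => //.
      apply: (@drv_mvi R s t (w^~ x) (flow_rhs^~ x)) => //.
        split.
          apply: continuous_subspaceW (jcont_time0 (x := x) Ttc (@dx_cont 0 isT)) => r /=.
          by rewrite !in_itv /= => /andP[/(le_trans s0) -> /le_trans]; exact.
        move=> r; rewrite in_itv /= => /andP[sr rt]; apply: sol_derive_t.
        by rewrite (le_lt_trans s0 sr) (lt_trans rt) //; case/andP: ht.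
      move=> r; rewrite in_itv /= => /andP[/ltW sr /ltW rt]; apply: hK.
        by rewrite (le_trans s0 sr) (le_trans rt tT).
      by move: tx; rewrite /torus /= !in_itv /= => /andP[/ltW -> /ltW].
    exact: le_trans (hL x tx) (ler_norm _).
  have e : A * (t - s) = K * (t - s) * `|L| * (2 * pi) + (t - s) by rewrite /A; ring.
  by rewrite e lerDl subr_ge0.
apply/subspace_continuousP => t /= ht; apply/cvgrPdist_le => e e0.
move: ht; rewrite in_itv /= => /andP[t0 tT].
have ne : \forall s \near t, `|t - s| <= e / A  by exists (e / A) => /=; [rewrite divr_gt0|move=> s /= /ltW].
near=> s; rewrite /from_subspace.
have h1 : `|t - s| <= e / A by near: s; apply: cvg_within.
have /andP[s0 sT] : 0 <= s <= T.
  suff : `[0, T]%classic s by rewrite /= in_itv.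
  by near: s; exact: withinT.
have h2 : A * `|t - s| <= e by rewrite mulrC -ler_pdivlMr.
apply: le_trans h2.
case: (leP s t) => st; first by rewrite [`|t - s|]ger0_norm ?subr_ge0 // lip.
by rewrite distrC [`|t - s|]distrC [`|s - t|]gtr0_norm ?subr_gt0 // lip // ltW.
Unshelve. all: by end_near. Qed.

Lemma pairing_drv phi T : continuous phi -> T < tc ->
  drv 0 T (pairing phi) (fun t => rint (fun x => flow_rhs t x * phi x)).
Proof.
move=> cphi Ttc; split; first exact: pairing_within.
by move=> t; rewrite in_itv /= => /andP[t0 tT]; apply: pairing_derive => //; rewrite t0 (lt_trans tT).
Qed.

(** Three integrations by parts move the dispersion onto the test function. *)
Lemma flow_rhs_pairing phi phi1 phi2 phi3 t : 0 <= t < tc ->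
  (forall x : R, is_derive x (1 : R) phi (phi1 x)) ->
  (forall x : R, is_derive x (1 : R) phi1 (phi2 x)) ->
  (forall x : R, is_derive x (1 : R) phi2 (phi3 x)) -> continuous phi3 ->
  phi pi = phi (- pi) -> phi1 pi = phi1 (- pi) -> phi2 pi = phi2 (- pi) ->
  rint (fun x => flow_rhs t x * phi x) =
  eps ^+ 2 * pairing phi3 t + k%:R^-1 * rint (fun x => w t x ^+ k * phi1 x).
Proof.
move=> ht d1 d2 d3 c3 p0 p1 p2.
have c0 := continuous_derive d1; have c1 := continuous_derive d2.
have c2 := continuous_derive d3.
have cx j : (j <= 3)%N -> continuous (dx j t) by move=> j3; exact: jcont_space ht (dx_cont j3).
have cw := w_cont ht.
have cpow n : continuous (fun x => w t x ^+ n).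
  elim: n => [|n IH] x; first exact: cvg_cst.
  have e : (fun y => w t y ^+ n.+1) = (fun y => w t y * w t y ^+ n).
    by apply/funext => y; rewrite exprS.
  by rewrite e; apply: cvgM; [exact: cw|exact: IH].
have cd : continuous (fun x => k%:R * w t x ^+ k.-1 * dx 1 t x).
  apply: contM (cx 1 isT); apply: contM; last exact: cpow.
  by move=> x; exact: cvg_cst.
have e1 := rint_parts (fun x => @dx_derive 2 t x isT ht) d1 (cx 3%N isT) c1 (@dx_end 2 t isT ht) p0.
have e2 := rint_parts (fun x => @dx_derive 1 t x isT ht) d2 (cx 2%N isT) c2 (@dx_end 1 t isT ht) p1.
have e3 := rint_parts (fun x => @dx_derive 0 t x isT ht) d3 (cx 1%N isT) c3 (@dx_end 0 t isT ht) p2.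
have e0 : w t pi ^+ k = w t (- pi) ^+ k by congr (_ ^+ _); exact: (@dx_end 0 t isT ht).
have e4 := rint_parts (fun x => @pow_derive t x ht) d1 cd c1 e0 p0.
have b3 := rbmeas_cont (contM (cx 3%N isT) c0); have bd := rbmeas_cont (contM cd c0).
rewrite (_ : (fun x => flow_rhs t x * phi x) = fun x => (- eps ^+ 2) * (dx 3 t x * phi x) -
  k%:R^-1 * ((k%:R * w t x ^+ k.-1 * dx 1 t x) * phi x)); last first.
  by apply/funext => x; rewrite /flow_rhs; ring.
rewrite rintB; [|exact: rbmeasM (rbmeas_cst _) _..].
by rewrite !rintZ // e4 e1 e2 e3 /pairing !mulrN !opprK mulNr opprK.
Qed.

Definition cosm xi x : R := cos (xi%:~R * (x + pi)).
Definition sinm xi x : R := sin (xi%:~R * (x + pi)).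

Lemma cosm_end xi : cosm xi pi = cosm xi (- pi).
Proof. by rewrite /cosm addNr mulr0 cos0 -mulr2n cos_2pin. Qed.

Lemma sinm_end xi : sinm xi pi = sinm xi (- pi).
Proof. by rewrite /sinm addNr mulr0 sin0 -mulr2n sin_2pin. Qed.

(** True without integrability: both sides are made of the same positive and
    negative parts, and [fine] sends both infinities to 0. *)
Lemma rintN_raw f : rint (fun x => - f x) = - rint f.
Proof.
rewrite /rint /Rintegral integralE [in RHS]integralE.
have -> : (fun x => (- f x)%:E) = (\- (EFin \o f))%E by [].
rewrite funeposN funenegN.
have p0 := @integral_ge0 _ _ R lebesgue_measure torus _ (fun x _ => funepos_ge0 (EFin \o f) x).
have n0 := @integral_ge0 _ _ R lebesgue_measure torus _ (fun x _ => funeneg_ge0 (EFin \o f) x).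
have e (a b : \bar R) : (0%E <= a)%E -> (0%E <= b)%E -> fine (b - a)%E = - fine (a - b)%E.
  by move: a b => [a| |] [b| |] //= _ _; rewrite ?oppr0 ?opprB.
exact: e p0 n0.
Qed.

Lemma fourier_real f xi : fourier (of_real f) xi =
  ((2 * pi)^-1 * rint (fun x => f x * cosm xi x)) +i*
  (- ((2 * pi)^-1 * rint (fun x => f x * sinm xi x))).
Proof.
rewrite fourierE /integralC -/(rint _) -/(rint _).
rewrite (_ : (fun x => complex.Re _) = fun x => f x * cosm xi x); last first.
  by apply/funext => x; rewrite cReM /mode mulrNz mulNr /= mul0r subr0 cosN.
rewrite (_ : (fun x => complex.Im _) = fun x => - (f x * sinm xi x)); last first.
  by apply/funext => x; rewrite cImM /mode mulrNz mulNr /= mul0r addr0 sinN mulrN.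
rewrite rintN_raw.
by apply/eqP; rewrite eq_complex /= !mul0r subr0 addr0 mulrN !eqxx.
Qed.

Definition uhat t := fourier (of_real (w t)).
Definition qhat t := fourier (of_real (fun x => w t x ^+ k)).

Lemma pow_cont t : 0 <= t < tc -> continuous (fun x => w t x ^+ k).
Proof. move=> ht; exact: continuous_derive (fun x => @pow_derive t x ht). Qed.

Lemma scale_derive (c : R) (F F' : R -> R) : (forall x : R, is_derive x (1 : R) F (F' x)) ->
  forall x : R, is_derive x (1 : R) (fun y => c * F y) (c * F' x).
Proof. by move=> dF x; exact: is_deriveZ (dF x). Qed.

Lemma flow_rhs_cos xi t : 0 <= t < tc -> rint (fun x => flow_rhs t x * cosm xi x) =
  eps ^+ 2 * xi%:~R ^+ 3 * pairing (sinm xi) t -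
  k%:R^-1 * xi%:~R * rint (fun x => w t x ^+ k * sinm xi x).
Proof.
move=> ht; set y := xi%:~R.
have d1 := @is_derive_cosm R xi; have ds := @is_derive_sinm R xi.
have d2 := scale_derive (- y) ds.
have d3 := scale_derive (- y) (scale_derive y d1).
have cs := @continuous_sinm R xi.
rewrite (@flow_rhs_pairing _ _ _ _ t ht d1 d2 d3).
- rewrite (_ : pairing _ t = y ^+ 3 * pairing (sinm xi) t); last first.
    rewrite /pairing -rintZ; last exact: rbmeas_cont (contM (w_cont ht) cs).
    by apply: eq_rint => x _; rewrite /sinm -/y; ring.
  rewrite (_ : rint _ = - y * rint (fun x => w t x ^+ k * sinm xi x)); last first.
    rewrite -rintZ; last exact: rbmeas_cont (contM (pow_cont ht) cs).
    by apply: eq_rint => x _; rewrite /sinm -/y; ring.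
  by ring.
- move=> x; apply: cvgM; first exact: cvg_cst.
  by apply: cvgM; [exact: cvg_cst|apply: cvgM; [exact: cvg_cst|exact: cs]].
- exact: cosm_end.
- by congr (_ * _); exact: sinm_end.
- by congr (_ * (_ * _)); exact: cosm_end.
Qed.

Lemma flow_rhs_sin xi t : 0 <= t < tc -> rint (fun x => flow_rhs t x * sinm xi x) =
  - (eps ^+ 2 * xi%:~R ^+ 3 * pairing (cosm xi) t) +
  k%:R^-1 * xi%:~R * rint (fun x => w t x ^+ k * cosm xi x).
Proof.
move=> ht; set y := xi%:~R.
have d1 := @is_derive_sinm R xi; have ds := @is_derive_cosm R xi.
have d2 := scale_derive y ds.
have d3 := scale_derive y (scale_derive (- y) d1).
have cs := @continuous_cosm R xi.
rewrite (@flow_rhs_pairing _ _ _ _ t ht d1 d2 d3).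
- rewrite (_ : pairing _ t = - y ^+ 3 * pairing (cosm xi) t); last first.
    rewrite /pairing -rintZ; last exact: rbmeas_cont (contM (w_cont ht) cs).
    by apply: eq_rint => x _; rewrite /cosm -/y; ring.
  rewrite (_ : rint _ = y * rint (fun x => w t x ^+ k * cosm xi x)); last first.
    rewrite -rintZ; last exact: rbmeas_cont (contM (pow_cont ht) cs).
    by apply: eq_rint => x _; rewrite /cosm -/y; ring.
  by ring.
- move=> x; apply: cvgM; first exact: cvg_cst.
  by apply: cvgM; [exact: cvg_cst|apply: cvgM; [exact: cvg_cst|exact: cs]].
- exact: sinm_end.
- by congr (_ * _); exact: cosm_end.
- by congr (_ * (_ * _)); exact: sinm_end.
Qed.

(** The equation tested against the cosine and the sine of each frequency. *)
Lemma uhat_ode xi T : T < tc -> drvC 0 T (uhat^~ xi)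
  (fun t => airy_sym eps xi * uhat t xi - k%:R^-1 * (ik xi * qhat t xi)).
Proof.
move=> Ttc; set rho : R := (2 * pi)^-1.
have hc := drv_mul (drv_cst 0 T rho) (pairing_drv (@continuous_cosm R xi) Ttc).
have hs := drv_opp (drv_mul (drv_cst 0 T rho) (pairing_drv (@continuous_sinm R xi) Ttc)).
have ki : (k%:R^-1 : R[i]) = (k%:R^-1)%:C by rewrite fmorphV rmorph_nat.
split; [apply: (drv_eq hc)|apply: (drv_eq hs)] => t.
- by rewrite /uhat fourier_real.
- rewrite in_itv /= => /andP[/ltW t0 tT]; have ht : 0 <= t < tc by rewrite t0 (lt_trans tT).
  rewrite [X in rho * X](flow_rhs_cos _ ht) airy_sym_im ki /uhat /qhat !fourier_real /=.
  have e (r l y A B Ck Sk q z : R) : 0 * z + r * (l * A - q * y * Sk) =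
    0 * (r * B) - l * - (r * A) - (q * (0 * (r * Ck) - y * - (r * Sk)) -
    0 * (0 * - (r * Sk) + y * (r * Ck))) by ring.
  exact: e.
- by rewrite /uhat fourier_real.
- rewrite in_itv /= => /andP[/ltW t0 tT]; have ht : 0 <= t < tc by rewrite t0 (lt_trans tT).
  rewrite [X in rho * X](flow_rhs_sin _ ht) airy_sym_im ki /uhat /qhat !fourier_real /=.
  have e (r l y A B Ck Sk q z : R) : - (0 * z + r * (- (l * A) + q * y * Ck)) =
    0 * - (r * B) + l * (r * A) - (q * (0 * - (r * Sk) + y * (r * Ck)) +
    0 * (0 * (r * Ck) - y * - (r * Sk))) by ring.
  exact: e.
Qed.

End Solution.

End ClassicalSolution.

(** * Sobolev norms and Sobolev balls *)

Section SobolevNorm.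
Context {R : realType}.
Implicit Types (f : R -> R[i]) (s K : R).

Lemma esum_leP (a : int -> R) K :
  (\esum_(x in [set: int]) (a x)%:E <= K%:E)%E <-> l1le a K.
Proof.
split=> [h r ur|h].
  rewrite -lee_fin -sumEFin; apply: le_trans h; apply: esum_ge.
  by exists [set` r]; [split => //; apply/finite_seqP; exists r|rewrite fsbig_seq].
apply: ge_ereal_sup => _ [A [fA _] <-].
rewrite fsbig_finite //; rewrite sumEFin lee_fin; apply: h; exact: finmap.fset_uniq.
Qed.

Lemma sobolev_hball s f K : 0 <= K -> (sobolev_norm s f <= K%:E)%E <-> hball s (fourier f) K.
Proof.
move=> K0; rewrite /sobolev_norm.
have -> : K%:E = sqrte (K ^+ 2)%:E by rewrite /sqrte sqrtr_sqr ger0_norm.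
rewrite lee_sqrt ?lee_fin ?sqr_ge0 // esum_leP.
have e : (fun x : int => (1 + x%:~R ^+ 2) `^ s * normc (fourier f x) ^+ 2) =
    fun x => (wt s x * normc (fourier f x)) ^+ 2.
  by apply/funext => x; rewrite exprMn wt_sqr.
by rewrite e; split => [h|[_ h]].
Qed.

End SobolevNorm.

(** * Truncation of the frequencies *)

Section Tails.
Context {R : realType}.
Implicit Types (h : R -> R) (s D : R).

Lemma normc_powB (M : R) j : 0 <= M -> exists2 C, 0 < C &
  forall a b : R[i], normc a <= M -> normc b <= M ->
    normc (a ^+ j - b ^+ j) <= C * normc (a - b).
Proof.
move=> M0; elim: j => [|j [C C0 IH]].
  exists 1 => // a b _ _; rewrite !expr0 subrr ComplexField.Normc.normc0 mul1r.
  exact: normc_ge0.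
exists (M ^+ j + M * C + 1); first by rewrite ltr_pwDr // addr_ge0 ?exprn_ge0 // mulr_ge0 // ltW.
move=> a b ha hb'.
have -> : a ^+ j.+1 - b ^+ j.+1 = (a - b) * a ^+ j + b * (a ^+ j - b ^+ j) by rewrite !exprS; ring.
apply: le_trans (normcD _ _) _; rewrite !ComplexField.Normc.normcM normcX.
have d0 := normc_ge0 (a - b).
have h1 : normc (a - b) * normc a ^+ j <= M ^+ j * normc (a - b).
  by rewrite mulrC; apply: ler_wpM2r => //; apply: lerXn2r => //; exact: normc_ge0.
have h2 : normc b * normc (a ^+ j - b ^+ j) <= M * (C * normc (a - b)).
  by apply: ler_pM => //; try exact: normc_ge0; exact: IH.
by move: h1 h2 d0; move: (normc (a - b)) => X h1 h2 d0; nra.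
Qed.

(** For two partial sums this is the Lipschitz bound of the power map in H^s. One
    of them tends to the function uniformly, hence in all coefficients of the
    power, and balls of H^s are closed under such limits. *)
Lemma power_tail s D j : 3 / 2 < s -> exists2 K, 0 < K &
  forall h h' n B, (forall x : R, is_derive x (1 : R) h (h' x)) -> continuous h' ->
    hball s (fourier (of_real h)) D ->
    hball s (fun xi => fourier (of_real h) xi - cut n (fourier (of_real h)) xi) B ->
    hball s (fun xi => fourier (of_real (fun x => h x ^+ j)) xi -
      fourier (trig_sum n (fourier (of_real h)) ^+ j) xi) (K * B).
Proof.
move=> s32; have s12 : 1 / 2 < s by lra.
have [K K0 hK] := @fball_powB R s D j s12.
have [L L0 hL] := @trig_approx R s s32.
exists K => // h h' n B dh ch; set W := fourier (of_real h) => hW hT.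
have D0 := hball_ge0 hW; have B0 := hball_ge0 hT.
apply: hball_lim; first by rewrite mulr_ge0 // ltW.
move=> e e0.
have rh : rbmeas h := rbmeas_cont (continuous_derive dh).
have bh : bmeas (of_real h) := bmeas_real rh.
have [_ [H hH]] := rh.
pose M := `|H| + L * D.
have LD0 : 0 <= L * D by rewrite mulr_ge0 // ltW.
have M0 : 0 <= M by rewrite addr_ge0.
have [C C0 hC] := normc_powB j M0.
pose p := maxn n (Num.bound (2 * C * (L * D) / e)).
have bf x : torus x -> normc (of_real h x) <= `|H|.
  by move=> tx; rewrite normc_real; exact: le_trans (hH x tx) (ler_norm _).
have bp x : torus x -> normc (trig_sum p W x) <= M.
  move=> tx; have -> : trig_sum p W x = of_real h x - (of_real h x - trig_sum p W x) by ring.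
  apply: le_trans (normcB _ _) (lerD (bf x tx) _).
  apply: le_trans (hL h h' D dh ch hW x p tx) _.
  by rewrite ler_pdivrMr // ler_peMr // ler1n.
exists (fourier (trig_sum p W ^+ j - trig_sum n W ^+ j)).
  apply: hK; [exact: is_trig_trig|exact: is_trig_trig|exact: fball_trig|exact: fball_trig|].
  rewrite /fball; apply: hball_coef hT => xi.
  rewrite (fourierB xi (bmeas_trig p W) (bmeas_trig n W)) !fourier_trig /cut.
  case: leqP => hp; case: leqP => hn //.
    by have := leq_trans hn (leq_maxl n (Num.bound (2 * C * (L * D) / e))); rewrite leqNgt hp.
  by rewrite subrr ComplexField.Normc.normc0 normc_ge0.
move=> xi.
have bhj : bmeas (of_real (fun x => h x ^+ j)).
  have := bmeasX j bh; congr bmeas; apply/funext => x; by rewrite /of_real rmorphXn.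
rewrite (fourierB xi (bmeas_pow p W j) (bmeas_pow n W j)).
have e3 (x y z : R[i]) : x - y - (z - y) = x - z by ring.
rewrite e3.
rewrite -fourierB //; last exact: bmeas_pow.
pose e1 := C * (L * D / p.+1%:R).
apply: (@le_trans _ _ (2 * e1)).
  apply: normc_fourier_le; first by apply: bmeasB => //; exact: bmeas_pow.
  move=> x tx; rewrite /of_real rmorphXn exprfctE.
  apply: le_trans (hC _ _ _ _) _.
  - by apply: le_trans (bf x tx) _; rewrite lerDl.
  - exact: bp.
  - by rewrite ler_pM2l //; exact: hL dh ch hW _ _ _.
rewrite /e1 !mulrA ler_pdivrMr // -ler_pdivrMl //.
set X := 2 * C * (L * D) / e.
have X0 : 0 <= X by rewrite divr_ge0 ?mulr_ge0 // ltW.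
have XE : e^-1 * (2 * C * L * D) = X by rewrite /X mulrC !mulrA.
rewrite XE; apply: le_trans (ltW (archi_boundP X0)) _.
by rewrite ler_nat; apply: leq_trans (leqnSn _); exact: leq_maxr.
Qed.

Lemma hball_tail s r n W D : 0 <= r -> hball (s + r) W D ->
  hball s (fun xi => W xi - cut n W xi) (((1 + n%:R) `^ (- r) : R) * D).
Proof.
move=> r0; apply: hball_dom; first exact: powR_ge0.
move=> xi; rewrite /cut; case: leqP => h.
  rewrite subrr ComplexField.Normc.normc0 mulr0.
  apply: mulr_ge0; first exact: powR_ge0.
  by apply: mulr_ge0; [exact: wt_ge0|exact: normc_ge0].
rewrite subr0 mulrA; apply: ler_wpM2r; first exact: normc_ge0.
have n1 : 0 < 1 + n%:R :> R by rewrite ltr_pwDl.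
rewrite wtD mulrCA ler_peMr ?wt_ge0 // powRN mulrC ler_pdivlMr ?powR_gt0 // mul1r.
rewrite /wt; apply: ge0_ler_powR; rewrite // ?nnegrE ?jb_ge0 ?(ltW n1) //.
apply: le_trans (jb_norm xi); rewrite addrC natr1.
by rewrite -intr_norm ler_nat.
Qed.

End Tails.

(** * Convergence in terms of coefficients *)

Section Convergence.
Context {R : realType}.
Implicit Types (a b c : int -> R[i]) (g D cfl : R).

Lemma phase_conj (eps x : R) xi : phase eps x (- xi) = conjc (phase eps x xi).
Proof. by rewrite /phase expi_conj mulrNz; congr expi; ring. Qed.

Lemma real_euler k n (tau : R) c : real_seq c -> real_seq (euler k n tau c).
Proof.
move=> rc xi; rewrite /euler rc (real_NL k n rc) conjcB conjcM.
by rewrite conjc_real.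
Qed.

Lemma real_phase (eps x : R) c : real_seq c -> real_seq (fun xi => phase eps x xi * c xi).
Proof. by move=> rc xi; rewrite phase_conj rc conjcM. Qed.

Lemma real_heun k n (eps tau : R) c : real_seq c -> real_seq (heun k n eps tau c).
Proof.
move=> rc xi; rewrite /heun conjcM conjc_real; congr (_ * _).
have h1 := real_phase eps (- tau) rc.
have h2 := real_euler k n tau (real_phase eps (- tau) (real_euler k n tau rc)).
rewrite [LHS](congr2 +%R (h1 xi) (h2 xi)).
by rewrite [RHS](rmorphD (@conjc R)).
Qed.

Lemma supp_phase n (eps x : R) c : supp n c -> supp n (fun xi => phase eps x xi * c xi).
Proof. by move=> sc xi h; rewrite sc // mulr0. Qed.

Lemma supp_heun k n (eps tau : R) c : supp n c -> supp n (heun k n eps tau c).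
Proof.
move=> sc xi h; rewrite /heun sc // mulr0 add0r.
rewrite supp_euler ?mulr0 //; apply: supp_phase; exact: supp_euler.
Qed.

Lemma cfl_le n (tau cfl : R) : 0 < tau -> tau * (1 + n%:R) ^+ 2 <= cfl -> tau <= cfl.
Proof.
move=> t0; apply: le_trans; rewrite ler_peMr ?(ltW t0) // expr_ge1 //.
by rewrite lerDl.
Qed.

(** The free flow is an isometry and each Euler step amplifies differences by
    1 + O(tau). The second Euler step starts at the image of [a] under the first,
    which therefore must be bounded in H^(g + 1): hence the norm H^(g + 2) for
    [a]. The bound [B <= 1] keeps the image of [b] in a fixed ball. *)
Lemma heun_stable (k : nat) g cfl D : 3 / 2 < g -> 0 < cfl -> 0 < D ->
  exists2 K, 0 < K & forall n eps tau a b B, supp n a -> supp n b -> real_seq b ->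
    hball (g + 2) a D -> hball g b D -> hball g (fun xi => a xi - b xi) B -> B <= 1 ->
    0 < tau -> tau * (1 + n%:R) ^+ 2 <= cfl ->
    hball g (fun xi => heun k.+1 n eps tau a xi - heun k.+1 n eps tau b xi) ((1 + K * tau) * B).
Proof.
move=> g32 c0 D0.
have [P P0 hP] := @NL_bound R k (g + 1) D ltac:(lra).
have [K1 K10 hK1] := @euler_stable R k g cfl D g32 c0.
pose D2 := D + cfl * P; pose D3 := D2 + (1 + K1 * cfl).
have [K2 K20 hK2] := @euler_stable R k g cfl D3 g32 c0.
have c1 := ltW c0; have k1 := ltW K10; have k2 := ltW K20; have p0 := ltW P0.
exists (K1 + K2 + K1 * K2 * cfl).
  by rewrite ltr_wpDr ?addr_gt0 // !mulr_ge0.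
move=> n eps tau a b B sa sb rb ha hb' hab B1 t0 ht.
have tc := cfl_le t0 ht; have B0 := hball_ge0 hab.
have ha1 : hball (g + 1) a D by apply: hball_weaken ha; lra.
have h1 := hK1 n tau a b B sa sb rb ha1 hb' hab t0 ht.
set Ea := euler k.+1 n tau a in h1 *; set Eb := euler k.+1 n tau b in h1 *.
have hEa : hball (g + 1) Ea D2.
  apply: hball_le (hball_sub ha1 (hball_half (ltW t0) (hP n a _))) _.
    by rewrite (_ : g + 1 + 1 = g + 2) //; ring.
  by rewrite lerD2l; apply: ler_wpM2r.
have hEb : hball g Eb D3.
  have h : hball g Ea D2 by apply: hball_weaken hEa; lra.
  apply: hball_le (hball_ext _ (hball_sub h h1)) _; first by move=> xi; ring.
  rewrite lerD2l -[leRHS]mulr1; apply: ler_pM => //; first by rewrite addr_ge0 // mulr_ge0 // ltW.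
  by rewrite lerD2l; apply: ler_wpM2l.
have hA : hball (g + 1) (fun xi => phase eps (- tau) xi * Ea xi) D3.
  apply: hball_phase; apply: hball_le hEa _.
  by rewrite lerDl addr_ge0 // mulr_ge0.
have h2 := hK2 n tau _ _ _ (supp_phase eps (- tau) (supp_euler k.+1 tau sa))
  (supp_phase eps (- tau) (supp_euler k.+1 tau sb))
  (real_phase eps (- tau) (real_euler k.+1 n tau rb)) hA (hball_phase eps (- tau) hEb)
  (hball_ext _ (hball_phase eps (- tau) h1)) t0 ht.
have {}h2 := h2 (fun xi => mulrBr _ _ _).
have h0 := hball_phase eps (- tau) hab.
have hh : 0 <= 2^-1 :> R by rewrite invr_ge0.
apply: hball_le (hball_ext _ (hball_half hh (hball_add h0 h2))) _.
  move=> xi; rewrite /heun -/Ea -/Eb.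
  have e (q p u v y z : R[i]) : q * (p * (u - v) + (y - z)) = q * (p * u + y) - q * (p * v + z) by ring.
  exact: e.
have h3 : K1 * K2 * tau * tau * B <= K1 * K2 * cfl * tau * B.
  apply: ler_wpM2r => //; apply: ler_wpM2r; first exact: ltW.
  by apply: ler_wpM2l => //; rewrite mulr_ge0.
have h4 : 0 <= (K1 + K2) * tau * B by rewrite !mulr_ge0 ?addr_ge0 // ltW.
have h5 : 0 <= K1 * K2 * cfl * tau * B by rewrite !mulr_ge0 // ltW.
have -> : 2^-1 * (B + (1 + K2 * tau) * ((1 + K1 * tau) * B)) =
  B + 2^-1 * ((K1 + K2) * tau * B) + 2^-1 * (K1 * K2 * tau * tau * B) by field.
have -> : (1 + (K1 + K2 + K1 * K2 * cfl) * tau) * B = B + (K1 + K2) * tau * B + K1 * K2 * cfl * tau * B by ring.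
move: h3 h4 h5; move: (K1 * K2 * tau * tau * B) (K1 * K2 * cfl * tau * B) ((K1 + K2) * tau * B).
move=> x y z; clear; lra.
Qed.

(** Discrete Gronwall with a bootstrap: as the final bound is at most 1, at every
    step the numerical solution is still in the ball where the stability estimate
    holds. *)
Theorem coefficient_convergence (k : nat) g cfl D T : 3 / 2 < g -> 0 < cfl -> 0 < D -> 0 < T ->
  exists2 K, 0 < K & forall n eps tau (W Q : R -> int -> R[i]) c del B,
    0 < eps <= 1 -> 0 < tau -> tau * (1 + n%:R) ^+ 2 <= cfl ->
    (forall x, x \in `[0, T] -> hball (g + 7) (W x) D) ->
    (forall x, x \in `[0, T] ->
       hball (g + 7) (fun xi => Q x xi - fourier (trig_sum n (W x) ^+ k.+1) xi) D) ->
    (forall x, x \in `[0, T] ->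
       hball (g + 1) (fun xi => Q x xi - fourier (trig_sum n (W x) ^+ k.+1) xi) del) ->
    (forall xi, drvC 0 T (W^~ xi)
       (fun x => airy_sym eps xi * W x xi - k.+1%:R^-1 * (ik xi * Q x xi))) ->
    supp n c -> real_seq c -> hball g (fun xi => cut n (W 0) xi - c xi) B ->
    K * (B + (del + tau ^+ 2)) <= 1 ->
    forall j, j%:R * tau <= T ->
    hball g (fun xi => cut n (W (j%:R * tau)) xi - iter j (heun k.+1 n eps tau) c xi)
      (K * (B + (del + tau ^+ 2))).
Proof.
move=> g32 c0 D0 T0.
have [L L0 hL] := @local_error R k g D cfl g32 D0 c0.
have [S S0 hS] := @heun_stable k g cfl (D + 1) g32 c0 ltac:(lra).
pose X := expR (S * T).
have X0 : 0 < X := expR_gt0 _.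
exists (X * (1 + L * T)); first by rewrite mulr_gt0 // ltr_pwDl // ltW // mulr_gt0.
move=> n eps tau W Q c del B heps t0 ht hW hQ hQ1 dW sc rc hB small.
have B0 := hball_ge0 hB.
have del0 : 0 <= del.
  by apply: (@hball_ge0 _ (g + 1)); apply: (hQ1 0); rewrite in_itv /= lexx ltW.
set dt := del + tau ^+ 2 in small *.
have dt0 : 0 <= dt by rewrite addr_ge0 // sqr_ge0.
have tau0 := ltW t0.
(* a supersolution: rho (j + 1) >= (1 + S tau) rho j + L tau dt *)
pose rho j := (1 + S * tau) ^+ j * (B + j%:R * (L * tau * dt)).
have s1 : 1 <= 1 + S * tau by rewrite lerDl mulr_ge0 // ltW.
have rhoX j : j%:R * tau <= T -> rho j <= X * (1 + L * T) * (B + dt).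
  move=> jT.
  have h1 : (1 + S * tau) ^+ j <= X.
    apply: le_trans (_ : expR (S * tau) ^+ j <= _).
      apply: lerXn2r; rewrite ?nnegrE ?expR_ge0 //; first exact: le_trans ler01 s1.
      exact: expR_ge1Dx.
    rewrite -expRM_natl ler_expR mulrCA; apply: ler_wpM2l => //; exact: ltW.
  have h2 : j%:R * (L * tau * dt) <= L * T * dt.
    rewrite (_ : j%:R * (L * tau * dt) = L * (j%:R * tau) * dt); last by ring.
    by apply: ler_wpM2r => //; apply: ler_wpM2l => //; exact: ltW.
  rewrite -mulrA; apply: ler_pM => //.
  - by rewrite exprn_ge0 // (le_trans ler01).
  - by rewrite addr_ge0 // !mulr_ge0 // ltW.
  - have : 0 <= L * T * B by rewrite !mulr_ge0 // ltW.
    by move: h2; move: (j%:R * _) => y; nra.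
suff main j : j%:R * tau <= T ->
    hball g (fun xi => cut n (W (j%:R * tau)) xi - iter j (heun k.+1 n eps tau) c xi) (rho j) /\
    (supp n (iter j (heun k.+1 n eps tau) c) /\ real_seq (iter j (heun k.+1 n eps tau) c)).
  by move=> j jT; apply: hball_le (rhoX j jT); case: (main j jT).
elim: j => [|j IH] jT.
  split; last by [].
  apply: hball_le (_ : hball _ _ B) _; first by rewrite mul0r.
  by rewrite /rho expr0 mul1r mul0r addr0.
have jT' : j%:R * tau <= T by apply: le_trans jT; apply: ler_wpM2r => //; rewrite ler_nat.
have [h [sj rj]] := IH jT'.
set cj := iter j (heun k.+1 n eps tau) c in h sj rj *.
split; last by rewrite iterS -/cj; split; [exact: supp_heun|exact: real_heun].
set t := j%:R * tau in h jT' *.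
have tE : j.+1%:R * tau = t + tau by rewrite -natr1 mulrDl mul1r.
have tt0 : 0 <= t by rewrite mulr_ge0.
have sub x : x \in `[t, t + tau] -> x \in `[0, T].
  rewrite !in_itv /= => /andP[a1 a2]; rewrite (le_trans tt0 a1) /=.
  by apply: le_trans a2 _; rewrite -tE.
have loc := hL n eps t tau W Q del heps t0 ht (fun x hx => hW x (sub x hx))
  (fun x hx => hQ x (sub x hx)) (fun x hx => hQ1 x (sub x hx))
  (fun xi => drvC_sub tt0 (eq_ind _ (fun z => z <= T) jT _ tE) (dW xi)).
have tin : t \in `[0, T] by rewrite in_itv /= tt0.
have r1 : rho j <= 1 := le_trans (rhoX j jT') small.
have wD : hball (g + 2) (cut n (W t)) (D + 1).
  apply: hball_cut; apply: hball_le (_ : hball _ _ D) _; last lra.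
  by apply: hball_weaken (hW t tin); lra.
have cD : hball g cj (D + 1).
  have hw : hball g (cut n (W t)) D by apply: hball_cut; apply: hball_weaken (hW t tin); lra.
  apply: hball_le (hball_ext _ (hball_sub hw h)) _; first by move=> xi; ring.
  by rewrite lerD2l.
have st := hS n eps tau _ _ _ (@supp_cut R n (W t)) sj rj wD cD h r1 t0 ht.
rewrite tE iterS -/cj.
apply: hball_le (hball_ext _ (hball_sub st loc)) _.
  move=> xi; rewrite /=.
  have e (x y z : R[i]) : x - y - (x - z) = z - y by ring.
  exact: e.
rewrite -/dt /rho exprS -(natr1 j).
set q := (1 + S * tau) ^+ j.
have q1 : 1 <= (1 + S * tau) * q by rewrite -exprS exprn_ege1.
have z0 : 0 <= L * tau * dt by rewrite !mulr_ge0 // ltW.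
have -> : (1 + S * tau) * q * (B + (j%:R + 1) * (L * tau * dt)) =
  (1 + S * tau) * (q * (B + j%:R * (L * tau * dt))) + (1 + S * tau) * q * (L * tau * dt) by ring.
by rewrite lerD2l ler_peMl.
Qed.

End Convergence.

(** * The scheme in terms of coefficients *)

Section Translation.
Context {R : realType}.
Implicit Types (c : int -> R[i]) (f : R -> R[i]) (eps tau t x : R).

Lemma trig_derive n c x :
  is_derive x (1 : R) (fun y => complex.Re (trig_sum n c y)) (complex.Re (trig_sum n (dif c) x)) /\
  is_derive x (1 : R) (fun y => complex.Im (trig_sum n c y)) (complex.Im (trig_sum n (dif c) x)).
Proof.
under eq_fun do rewrite trig_sumE.
under [X in _ /\ is_derive _ _ X _]eq_fun do rewrite trig_sumE.
rewrite trig_sumE; elim: (win n) => [|xi r [IH1 IH2]].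
  rewrite big_nil; under eq_fun do rewrite big_nil.
  under [X in _ /\ is_derive _ _ X _]eq_fun do rewrite big_nil.
  by split; exact: is_derive_cst.
rewrite big_cons; under eq_fun do rewrite big_cons cReD cReM.
under [X in _ /\ is_derive _ _ X _]eq_fun do rewrite big_cons cImD cImM.
have hc := @is_derive_cosm R xi x; have hs := @is_derive_sinm R xi x.
have hZ (a : R) F dF : is_derive x (1 : R) F dF -> is_derive x (1 : R) (fun y => a * F y) (a * dF).
  by move=> h; exact: is_deriveZ h.
split.
  apply: is_derive_eq (is_deriveD (is_deriveB (hZ (complex.Re (c xi)) _ _ hc)
    (hZ (complex.Im (c xi)) _ _ hs)) IH1) _.
  by rewrite cReD /dif !cReM !cImM /=; ring.
apply: is_derive_eq (is_deriveD (is_deriveD (hZ (complex.Re (c xi)) _ _ hs)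
    (hZ (complex.Im (c xi)) _ _ hc)) IH2) _.
rewrite cImD /dif; move: (complex.Im (\sum_(j <- r) _)) => I.
by rewrite (cImM (ik xi * c xi)) (cReM (ik xi)) (cImM (ik xi)) /=; ring.
Qed.

Lemma derivC_trig n c : Defs.derivC (trig_sum n c) = trig_sum n (dif c).
Proof.
apply/funext => x; have [[_ h1] [_ h2]] := trig_derive n c x.
by rewrite /Defs.derivC !derive1E h1 h2; case: (trig_sum n (dif c) x).
Qed.

(** The partial sums that define the multiplier are eventually constant. *)
Lemma airy_trig eps t n c :
  airy eps t (trig_sum n c) = trig_sum n (fun xi => phase eps t xi * c xi).
Proof.
apply/funext => x; rewrite /airy /fourier_multiplier /limC.
pose s m := trig_sum m (fun xi => expi (- (t * eps ^+ 2 * xi%:~R ^+ 3)) * fourier (trig_sum n c) xi) x.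
have e m : (n <= m)%N -> s m = trig_sum n (fun xi => phase eps t xi * c xi) x.
  move=> nm; rewrite (trig_sum_widen _ nm) /s; congr (_ x); apply: trig_sum_ext => xi _.
  rewrite fourier_trig; case: ifP; last by rewrite mulr0.
  by move=> _; congr (expi _ * _); ring.
rewrite (@lim_near_cst _ _ _ _ _ (complex.Re (trig_sum n (fun xi => phase eps t xi * c xi) x))).
- rewrite (@lim_near_cst _ _ _ _ _ (complex.Im (trig_sum n (fun xi => phase eps t xi * c xi) x))).
  + by case: (trig_sum n _ x).
  + exact: Rhausdorff.
  + by exists n => // m nm; exact: (congr1 (fun z : R[i] => complex.Im z) (e m nm)).
- exact: Rhausdorff.
- by exists n => // m nm; exact: (congr1 (fun z : R[i] => complex.Re z) (e m nm)).
Qed.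

(** The power of a trigonometric polynomial is again one, of a higher degree; this
    is why the result is stated through its coefficients on the band. *)
Lemma nonlin_trig k eps t n c :
  is_trig (nonlin k eps t (trig_sum n c)) /\
  forall xi, (`|xi| <= n)%N -> fourier (nonlin k eps t (trig_sum n c)) xi =
    phase eps t xi * NL k n (fun eta => phase eps (- t) eta * c eta) xi.
Proof.
set d := fun eta => phase eps (- t) eta * c eta.
have [m [e E]] : is_trig (trig_sum n d ^+ k) by apply: is_trigX; exact: is_trig_trig.
have h : nonlin k eps t (trig_sum n c) =
    trig_sum m (fun xi => k%:R^-1 * (phase eps t xi * dif e xi)).
  apply/funext => x; rewrite /nonlin airy_trig -/d.
  have -> : (fun y => trig_sum n d y ^+ k) = trig_sum n d ^+ k by apply/funext => y; rewrite exprfctE.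
  by rewrite E derivC_trig airy_trig -trig_sumZ.
rewrite h; split; first exact: is_trig_trig.
move=> xi hxi; rewrite /NL hxi E !fourier_trig; case: ifP => _; last by rewrite !mulr0.
rewrite /dif.
have i (p q r s : R[i]) : p * (q * (r * s)) = q * (p * r * s) by ring.
exact: i.
Qed.

Lemma proj_nonlin k eps t N c :
  Defs.proj N (nonlin k eps t (trig_sum N./2 c)) = trig_sum N./2 (fun xi => phase eps t xi *
    NL k N./2 (fun eta => phase eps (- t) eta * c eta) xi).
Proof.
rewrite /Defs.proj; apply: trig_sum_ext => xi h.
by rewrite (nonlin_trig _ _ _ _ _).2.
Qed.

Lemma lawson_stage_trig k eps tau N t c :
  lawson_stage k eps tau N t (trig_sum N./2 (fun xi => phase eps t xi * c xi)) =
  trig_sum N./2 (fun xi => phase eps t xi * euler k N./2 tau c xi).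
Proof.
apply/funext => x; rewrite /lawson_stage proj_nonlin trig_sumZ trig_sumB.
congr (trig_sum _ _ x); apply/funext => xi.
rewrite (_ : (fun eta => phase eps (- t) eta * (phase eps t eta * c eta)) = c); last first.
  by apply/funext => eta; rewrite mulrA phaseNK mul1r.
by rewrite /euler mulrBr mulrCA.
Qed.

Lemma phaseD eps t t' xi : phase eps (t + t') xi = phase eps t xi * phase eps t' xi.
Proof. by rewrite /phase mulrDr expiD. Qed.

(** The phases of the scheme cancel: seen from time [t + tau], the first stage is
    the free flow of an Euler step, and only the phase over one step remains. *)
Lemma lawson_step_trig k eps tau N t c :
  lawson_step k eps tau N t (t + tau) (trig_sum N./2 (fun xi => phase eps t xi * c xi)) =
  trig_sum N./2 (fun xi => phase eps (t + tau) xi * heun k N./2 eps tau c xi).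
Proof.
apply/funext => x; rewrite /lawson_step lawson_stage_trig.
set v := trig_sum _ _; set v1 := trig_sum _ _.
have -> : Defs.proj N (fun y => nonlin k eps t v y + nonlin k eps (t + tau) v1 y) =
    trig_sum N./2 (fun xi => phase eps t xi * NL k N./2 c xi + phase eps (t + tau) xi *
      NL k N./2 (fun eta => phase eps (- tau) eta * euler k N./2 tau c eta) xi).
  rewrite /Defs.proj; apply: trig_sum_ext => xi h.
  have [t1 e1] := nonlin_trig k eps t N./2 (fun xi => phase eps t xi * c xi).
  have [t2 e2] := nonlin_trig k eps (t + tau) N./2 (fun xi => phase eps t xi * euler k N./2 tau c xi).
  have E := etrans (fourierD xi (is_trig_bm t1) (is_trig_bm t2)) (congr2 +%R (e1 xi h) (e2 xi h)).
  apply: (etrans E); clear e1 e2 E t1 t2.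
  have q1 : (fun eta => phase eps (- t) eta * (phase eps t eta * c eta)) = c.
    by apply/funext => eta; rewrite mulrA phaseNK mul1r.
  have q2 : (fun eta => phase eps (- (t + tau)) eta * (phase eps t eta * euler k N./2 tau c eta)) =
      (fun eta => phase eps (- tau) eta * euler k N./2 tau c eta).
    apply/funext => eta; rewrite mulrA -phaseD.
    by rewrite (_ : - (t + tau) + t = - tau) //; ring.
  by rewrite q1 q2.
rewrite trig_sumZ trig_sumB; congr (trig_sum _ _ x); apply/funext => xi.
have q2 : (2^-1)%:C + (2^-1)%:C = 1 :> R[i].
  by rewrite -rmorphD /= (_ : 2^-1 + 2^-1 = 1 :> R) //; lra.
have t2 : (tau / 2)%:C = tau%:C * (2^-1)%:C :> R[i] by rewrite -rmorphM.
have p1 : phase eps (t + tau) xi * phase eps (- tau) xi = phase eps t xi.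
  by rewrite -phaseD; congr phase; ring.
rewrite /heun /euler t2 -p1.
move: q2.
have i (P A z N1 N2 q T : R[i]) : q + q = 1 -> P * A * z - T * q * (P * A * N1 + P * N2) =
    P * (q * (A * z + (A * (z - T * N1) - T * N2))).
  move=> qq; rewrite (_ : P * (q * (A * z + (A * (z - T * N1) - T * N2))) =
    (q + q) * (P * A * z) - T * q * (P * A * N1 + P * N2)); last by ring.
  by rewrite qq mul1r.
exact: i.
Qed.

Lemma lawson_rk_trig k eps tau N (u0 : R -> R) j :
  lawson_rk k eps tau N u0 j = trig_sum N./2 (fun xi => phase eps (j%:R * tau) xi *
    iter j (heun k N./2 eps tau) (cut N./2 (fourier (interp (2 * N) (of_real u0)))) xi).
Proof.
elim: j => [|j IH].
  rewrite /= /Defs.proj; apply: trig_sum_ext => xi h.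
  by rewrite mul0r phase0 mul1r cut_id.
by rewrite /= IH -natr1 mulrDl mul1r lawson_step_trig.
Qed.

Lemma numerical_solution_trig k eps tau N (u0 : R -> R) j :
  numerical_solution k eps tau N u0 j = trig_sum N./2
    (iter j (heun k N./2 eps tau) (cut N./2 (fourier (interp (2 * N) (of_real u0))))).
Proof.
rewrite /numerical_solution lawson_rk_trig airy_trig; congr trig_sum.
by apply/funext => xi; rewrite mulrA phaseNK mul1r.
Qed.

(** The interpolant has the frequencies -N, ..., N - 1, which contain the band. *)
Lemma cut_interp N f : ~~ odd N -> (0 < N)%N ->
  cut N./2 (fourier (interp (2 * N) f)) = cut N./2 (discrete_fourier (2 * N) f).
Proof.
move=> oN N0.
have e : interp (2 * N) f = trig_sum N (fun xi => if (xi < N%:Z) then discrete_fourier (2 * N) f xi else 0).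
  apply/funext => x; rewrite /interp /trig_sum big_ord_recr /=.
  (* the frequency N belongs to the symmetric window but not to the interpolant *)
  have -> : (N.*2%:Z - N%:Z < N%:Z) = false by lia.
  rewrite mul0r addr0 mul2n doubleK; apply: eq_bigr => i _.
  by rewrite ifT //; have := ltn_ord i; lia.
apply/funext => xi; rewrite /cut e fourier_trig; case: leqP => // h.
by rewrite !ifT //; lia.
Qed.

Lemma real_discrete_fourier L (h : R -> R) : real_seq (discrete_fourier L (of_real h)).
Proof.
move=> xi; rewrite /discrete_fourier conjcM conjc_inv conjc_nat; congr (_ * _).
rewrite (big_morph _ (rmorphD (@conjc R)) (rmorph0 _)); apply: eq_bigr => j _.
by rewrite [RHS]conjcM conjc_real expi_conj mulrNz mulNr opprK.
Qed.

Lemma real_cut n c : real_seq c -> real_seq (cut n c).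
Proof. by move=> rc xi; rewrite /cut abszN rc; case: ifP => // _; rewrite conjc0. Qed.

End Translation.

(** * The interpolated initial datum *)

Section Aliasing.
Context {R : realType}.
Implicit Types (c d : int -> R[i]) (f : R -> R[i]) (L n j : nat).

Lemma mode_node xi L j : mode xi (node L j : R) = mode xi (node L 1) ^+ j.
Proof.
have e i : xi%:~R * (node L i + pi) = i%:R * (xi%:~R * (2 * pi / L%:R)) :> R.
  by rewrite /node; move: (L%:R^-1) => q; ring.
rewrite /mode !e mul1r; elim: j => [|j IH]; first by rewrite mul0r expi0.
by rewrite -natr1 mulrDl mul1r expiD IH exprSr.
Qed.

Lemma expi_eq1 (x : R) : expi (2 * x) = 1 -> sin x = 0.
Proof.
move=> /(congr1 (@complex.Re R)) /=; rewrite mulrDl mul1r cosD -!expr2 cos2sin2 => h.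
have : sin x ^+ 2 = 0 by lra.
by move/eqP; rewrite sqrf_eq0 => /eqP.
Qed.

(** The nodes turn a mode into the powers of an L-th root of unity. *)
Lemma sum_mode_node xi L : (0 < L)%N -> (`|xi| < L)%N ->
  \sum_(j < L) mode xi (node L j) = (xi == 0)%:R * L%:R :> R[i].
Proof.
move=> L0 xL; case: eqP => [->|/eqP x0].
  by under eq_bigr do rewrite mode0; rewrite sumr_const card_ord mul1r.
rewrite mul0r; under eq_bigr do rewrite mode_node.
set z := mode xi (node L 1).
have Ln : L%:R != 0 :> R by rewrite pnatr_eq0 -lt0n.
have zL : z ^+ L = 1.
  rewrite -mode_node /mode /node (_ : xi%:~R * _ = xi%:~R * (pi *+ 2)); last by field.
  by rewrite /expi cos_2pin sin_2pin.
have z1 : z != 1.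
  apply/eqP => z1.
  pose y : R := pi * (xi%:~R / L%:R).
  have s0 : sin y = 0.
    apply: expi_eq1; rewrite -z1 /z /mode /node /y; congr expi; field; exact: Ln.
  have y0 : `|y| != 0 by rewrite normr_eq0 !mulf_neq0 ?invr_neq0 ?intr_eq0 // gt_eqF // pi_gt0.
  have yp : `|y| < pi.
    rewrite normrM (ger0_norm (pi_ge0 _)) gtr_pMr ?pi_gt0 // normf_div ltr_pdivrMr ?normr_gt0 //.
    by rewrite mul1r -intr_norm normr_nat ltr_nat.
  have yp0 : 0 < `|y| by rewrite lt_neqAle eq_sym y0 normr_ge0.
  have [k k0 hk] := sin_lower yp0 yp.
  have := hk y (lexx _); rewrite s0 normr0 => h.
  by move: (mulr_gt0 k0 yp0); rewrite ltNge h.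
apply/eqP; have := subrX1 z L; rewrite zL subrr => /esym/eqP.
by rewrite mulf_eq0 subr_eq0 (negPf z1).
Qed.

Lemma discrete_fourierE L f xi :
  discrete_fourier L f xi = L%:R^-1 * \sum_(j < L) f (node L j) * mode (- xi) (node L j).
Proof. by congr (_ * _); apply: eq_bigr => j _; rewrite /mode mulrNz mulNr. Qed.

Lemma discrete_fourierB L f g xi :
  discrete_fourier L (fun x => f x - g x) xi = discrete_fourier L f xi - discrete_fourier L g xi.
Proof.
by rewrite /discrete_fourier -mulrBr -sumrB; congr (_ * _); apply: eq_bigr => j _; rewrite mulrBl.
Qed.

(** No two frequencies of the window agree modulo L. *)
Lemma discrete_fourier_trig L n c xi : (n.*2 < L)%N -> (`|xi| <= n)%N ->
  discrete_fourier L (trig_sum n c) xi = c xi.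
Proof.
move=> nL hx; have L0 : (0 < L)%N by apply: leq_ltn_trans nL.
have Ln : L%:R != 0 :> R[i] by rewrite pnatr_eq0 -lt0n.
rewrite discrete_fourierE.
under eq_bigr do rewrite trig_sumE mulr_suml.
rewrite exchange_big /= big_seq (eq_bigr (fun eta => (eta == xi)%:R * (c xi * L%:R))).
  rewrite -big_seq (bigD1_seq xi) ?mem_win ?win_uniq //= eqxx mul1r big1 ?addr0.
    by rewrite mulrC mulfK.
  by move=> eta /negPf ->; rewrite mul0r.
move=> eta; rewrite mem_win => he.
under eq_bigr do rewrite -mulrA -modeD.
rewrite -mulr_sumr sum_mode_node //; last by lia.
rewrite subr_eq0; case: eqP => [->|_]; first by rewrite !mul1r.
by rewrite !mul0r mulr0.
Qed.

Lemma node_pairing L n f d : (0 < L)%N ->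
  \sum_(j < L) conjc (trig_sum n d (node L j)) * f (node L j) =
  L%:R * \sum_(xi <- win n) conjc (d xi) * discrete_fourier L f xi.
Proof.
move=> L0; have Ln : L%:R != 0 :> R[i] by rewrite pnatr_eq0 -lt0n.
under eq_bigr do rewrite trig_sumE (big_morph _ (rmorphD (@conjc R)) (rmorph0 _)) mulr_suml.
rewrite exchange_big mulr_sumr; apply: eq_bigr => xi _.
rewrite discrete_fourierE mulrCA (mulrA L%:R) mulfV // mul1r mulr_sumr.
apply: eq_bigr => j _; rewrite [X in X * _](conjcM (d xi)) mode_conj.
by rewrite -mulrA (mulrC (mode _ _)).
Qed.

(** The nodal inner product of f with its discrete partial sum S and that of S
    with itself are equal, and Re <S, f> <= (|S|^2 + |f|^2) / 2. *)
Lemma discrete_bessel L n f M : (n.*2 < L)%N -> 0 <= M ->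
  (forall j, (j < L)%N -> normc (f (node L j)) <= M) ->
  \sum_(xi <- win n) normc (discrete_fourier L f xi) ^+ 2 <= M ^+ 2.
Proof.
move=> nL M0 hM; have L0 : (0 < L)%N by apply: leq_ltn_trans nL.
set Q := (\sum_(xi <- win n) _); pose d := discrete_fourier L f; pose S := trig_sum n d.
have sQ (e : int -> R[i]) : (forall xi, xi \in win n -> e xi = d xi) ->
    \sum_(xi <- win n) conjc (d xi) * e xi = Q%:C.
  move=> he; rewrite rmorph_sum /=; rewrite [LHS]big_seq [RHS]big_seq.
  by apply: eq_bigr => xi /he ->; exact: conj_mul.
have LC : L%:R = (L%:R)%:C :> R[i] by rewrite rmorph_nat.
have e1 : complex.Re (\sum_(j < L) conjc (S (node L j)) * f (node L j)) = L%:R * Q.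
  by rewrite node_pairing // sQ // LC -rmorphM.
have e2 : complex.Re (\sum_(j < L) conjc (S (node L j)) * S (node L j)) = L%:R * Q.
  rewrite node_pairing // sQ ?LC -?rmorphM // => xi; rewrite mem_win => h.
  exact: discrete_fourier_trig.
have Re_sum (F : 'I_L -> R[i]) : complex.Re (\sum_(j < L) F j) = \sum_(j < L) complex.Re (F j).
  by apply: (big_morph _ (@cReD R)).
have le (z w : R[i]) : complex.Re (conjc z * w) <= 2^-1 * (complex.Re (conjc z * z) + normc w ^+ 2).
  rewrite conj_mul [complex.Re _%:C]/= !normc_sqr; case: z => a b; case: w => u v /=.
  have := sqr_ge0 (a - u); have := sqr_ge0 (b - v); nra.
have h : L%:R * Q <= 2^-1 * (L%:R * Q + L%:R * M ^+ 2).
  rewrite -{1}e1 -e2 !Re_sum.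
  apply: le_trans (_ : \sum_(j < L) 2^-1 * (complex.Re (conjc (S (node L j)) * S (node L j)) +
    normc (f (node L j)) ^+ 2) <= _); first by apply: ler_sum => j _; exact: le.
  rewrite -mulr_sumr big_split /=; apply: ler_wpM2l => //; apply: lerD => //.
  apply: le_trans (_ : \sum_(j < L) M ^+ 2 <= _); last by rewrite sumr_const card_ord mulr_natl.
  by apply: ler_sum => j _; rewrite ler_pXn2r ?nnegrE ?normc_ge0 // hM.
have Lp : 0 < L%:R :> R by rewrite ltr0n.
rewrite -(ler_pM2l Lp); move: h; move: (L%:R * Q) (L%:R * M ^+ 2) => a b; lra.
Qed.

Lemma real_fourier (h : R -> R) : bmeas (of_real h) -> real_seq (fourier (of_real h)).
Proof.
move=> bh xi; rewrite -[in RHS](opprK xi) -fourier_conj //; apply: eq_fourier => x _.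
by rewrite /of_real conjc_real.
Qed.

(** The l^1 norm of the discarded coefficients bounds all the differences of
    partial sums, and these converge by inversion. *)
Lemma projection_sup (s : R) : 3 / 2 < s -> exists2 A, 0 < A &
  forall h h' n B D, (forall x : R, is_derive x (1 : R) h (h' x)) -> continuous h' ->
    hball s (fourier (of_real h)) D ->
    hball 1 (fun xi => fourier (of_real h) xi - cut n (fourier (of_real h)) xi) B ->
    forall x, torus x -> normc (of_real h x - trig_sum n (fourier (of_real h)) x) <= A * B.
Proof.
move=> s32; have [A A0 hA] := @trig_approx R s s32.
have [A1 A10 hA1] := @hball_l1 R 1 0 ltac:(lra).
exists A1 => // h h' n B D dh ch; set W := fourier (of_real h) => hW hT x tx.
have D0 := hball_ge0 hW; have AD : 0 <= A * D by rewrite mulr_ge0 // ltW.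
have near p : (n <= p)%N -> normc (trig_sum p W x - trig_sum n W x) <= A1 * B.
  move=> np; rewrite (trig_sum_widen W np) trig_sumB trig_sumE.
  apply: le_trans (normc_sum _ _) _.
  apply: le_trans (hA1 _ _ hT (win p) (win_uniq p)); apply: ler_sum => xi _.
  by rewrite ComplexField.Normc.normcM normc_mode mulr1 wt0 mul1r.
apply/ler_addgt0Pr => e e0.
pose p := maxn n (Num.bound (A * D / e)).
have -> : of_real h x - trig_sum n W x =
  (trig_sum p W x - trig_sum n W x) + (of_real h x - trig_sum p W x) by ring.
apply: le_trans (normcD _ _) _; apply: lerD; first by apply: near; exact: leq_maxl.
apply: le_trans (hA h h' D dh ch hW x p tx) _.
rewrite ler_pdivrMr // -ler_pdivrMl // mulrC.
have X0 : 0 <= A * D / e by rewrite divr_ge0 // ltW.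
apply: le_trans (ltW (archi_boundP X0)) _.
by rewrite ler_nat; apply: leq_trans (leqnSn _); exact: leq_maxr.
Qed.

(** Reaches the node -pi, which is not in the open torus. *)
Lemma continuous_end_le (phi : R -> R) M : continuous phi ->
  (forall x, torus x -> phi x <= M) -> phi (- pi) <= M.
Proof.
move=> cphi hM; apply/ler_addgt0Pr => e e0.
have /cvgrPdist_le/(_ e e0)[dl /= dl0 hdl] := cphi (- pi).
have p0 := pi_gt0 R.
pose r := Num.min (dl / 2) pi; pose x : R := - pi + r.
have r0 : 0 < r by rewrite lt_min divr_gt0.
have [r1 r2] : r <= dl / 2 /\ r <= pi by rewrite !ge_min !lexx orbT.
have tx : torus x by rewrite /torus /= in_itv /= /x; apply/andP; split; lra.
have near : `|- pi - x| < dl.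
  by rewrite (_ : - pi - x = - r) ?normrN ?gtr0_norm //; [lra|rewrite /x; ring].
by have := hdl x near; rewrite ler_norml => /andP[_ h]; have := hM x tx; lra.
Qed.

Lemma normc_real_part (z : R[i]) : conjc z = z -> normc z = `|complex.Re z|.
Proof.
case: z => a b /(congr1 (@complex.Im R)) /= h.
have b0 : b = 0 by lra.
by rewrite b0 expr0n addr0 sqrtr_sqr.
Qed.

(** Discrete coefficients of trigonometric polynomials are exact, so the error is
    the discrete transform of h - P_n h. By the discrete Bessel inequality its l^2
    norm is at most the supremum of h - P_n h, hence at most a multiple of the
    H^1 norm of the tail, of size (1 + n)^(1 - g - m); the H^g norm on the band
    costs (1 + n)^g. *)
Lemma aliasing (g m : R) : 3 / 2 < g -> 1 <= m -> exists2 K, 0 < K &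
  forall h h' L n D, (n.*2 < L)%N ->
    (forall x : R, is_derive x (1 : R) h (h' x)) -> continuous h' ->
    hball (g + m) (fourier (of_real h)) D ->
    hball g (fun xi => cut n (fourier (of_real h)) xi - cut n (discrete_fourier L (of_real h)) xi)
      (K * (1 + n%:R) `^ (1 - m) * D).
Proof.
move=> g32 m1; have [A A0 hA] := @projection_sup (g + m) ltac:(lra).
exists A => // h h' L n D nL dh ch; set W := fourier (of_real h) => hW.
have D0 := hball_ge0 hW.
have n1 : 0 < 1 + n%:R :> R by rewrite ltr_pwDl.
pose B := ((1 + n%:R) `^ (- (g + m - 1)) : R) * D.
have hT : hball 1 (fun xi => W xi - cut n W xi) B.
  by apply: hball_tail; [lra|rewrite (_ : 1 + (g + m - 1) = g + m) //; ring].
have B0 := hball_ge0 hT; have AB : 0 <= A * B by rewrite mulr_ge0 // ltW.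
have hsup := hA h h' n B D dh ch hW hT.
have bh : bmeas (of_real h) := bmeas_real (rbmeas_cont (continuous_derive dh)).
have rW := real_fourier bh.
pose f x := of_real h x - trig_sum n W x.
have fE x : normc (f x) = `|h x - complex.Re (trig_sum n W x)|.
  rewrite normc_real_part; first by rewrite /f cReD /= [complex.Re (- _)]raddfN.
  by rewrite /f conjcB trig_sum_conj // conjc_real.
have cf : continuous (fun x => normc (f x)).
  have fe : (fun x => normc (f x)) = (fun x => `|h x - complex.Re (trig_sum n W x)|).
    by apply/funext => x; exact: fE.
  rewrite fe => x; apply: cvg_norm; apply: cvgB.
    exact: (continuous_derive dh).
  exact: (continuous_derive (fun y => (trig_derive n W y).1)).
have L0 : (0 < L)%N by apply: leq_ltn_trans nL.
have nodes j : (j < L)%N -> normc (f (node L j)) <= A * B.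
  move=> jL; case: j jL => [|j] jL.
    rewrite /node mulr0 mul0r addr0; exact: (continuous_end_le cf hsup).
  apply: hsup; rewrite /torus /= in_itv /= /node.
  have p0 := pi_gt0 R; have Lp : 0 < L%:R :> R by rewrite ltr0n.
  rewrite ltrDl divr_gt0 ?mulr_gt0 //=.
  have p2 : 0 < (pi : R) *+ 2 by rewrite mulr2n addr_gt0.
  by rewrite -ltrBrDl opprK ltr_pdivrMr // -mulr2n mulr_natl (ltr_pM2l p2) ltr_nat.
have bes := discrete_bessel nL AB nodes.
have h0 : hball 0 (cut n (discrete_fourier L f)) (A * B).
  split=> // r ur; apply: le_trans bes.
  rewrite (bigID (fun xi : int => `|xi| <= n)%N) /= [X in _ + X]big1 ?addr0; last first.
    by move=> xi /negPf xn; rewrite /cut xn ComplexField.Normc.normc0 mulr0 expr0n.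
  rewrite -big_filter (eq_big_seq (fun xi => normc (discrete_fourier L f xi) ^+ 2)); last first.
    by move=> xi; rewrite mem_filter => /andP[xn _]; rewrite wt0 mul1r cut_id.
  apply: ler_sum_sub; [exact: filter_uniq| |by move=> xi; exact: sqr_ge0].
  by move=> xi; rewrite mem_filter mem_win => /andP[].
have -> : A * (1 + n%:R) `^ (1 - m) * D = (1 + n%:R) `^ g * (A * B).
  rewrite (_ : 1 - m = g + - (g + m - 1)); last by ring.
  rewrite powRD; last by rewrite (gt_eqF n1) implybT.
  have e (a p q d : R) : a * (p * q) * d = p * (a * (q * d)) by ring.
  exact: e.
apply: hball_dom h0; first exact: powR_ge0.
move=> xi; rewrite wt0 mul1r /cut; case: leqP => xn; last first.
  by rewrite subr0 ComplexField.Normc.normc0 !mulr0.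
have -> : W xi - discrete_fourier L (of_real h) xi = - discrete_fourier L f xi.
  by rewrite discrete_fourierB (discrete_fourier_trig _ nL) // opprB.
rewrite normcN; apply: ler_wpM2r; first exact: normc_ge0.
rewrite /wt; apply: ge0_ler_powR; rewrite ?nnegrE ?jb_ge0 ?(ltW n1) //; first lra.
apply: le_trans (jb_le1D xi) _; rewrite lerD2l.
by rewrite -intr_norm ler_nat.
Qed.

End Aliasing.

(** * The theorem *)

Lemma half_bounds N : (2 <= N)%N ->
  [/\ (N./2.+1 <= N)%N, (N <= N./2.+1 * 2)%N & (N./2.*2 < 2 * N)%N].
Proof. by move=> N2; have := odd_double_half N; case: (odd N) => /=; split; lia. Qed.

Lemma supp_iter_heun (R : realType) k nn (eps tau : R) n (c : int -> R[i]) :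
  supp nn c -> supp nn (iter n (heun k nn eps tau) c).
Proof. by move=> sc; elim: n => //= n IH; exact: supp_heun. Qed.

Theorem theorem4p1 (R : realType) (k : nat) (gamma m T M c : R)
    (hk : (2 <= k)%N) (hgamma : 3 / 2 < gamma) (hm : 7 <= m)
    (hT : 0 < T) (hM : 1 < M) (hc : 0 < c) :
  exists (N2 : nat) (tau2 C : R),
    [/\ (0 < N2)%N, 0 < tau2, 0 < C &
      forall (u0 : R -> R) (tc : R) (u : R -> R -> R -> R),
        periodic u0 (pi *+ 2) ->
        T < tc ->
        (forall eps : R, 0 < eps <= 1 ->
           classical_solution k eps u0 tc (u eps)) ->
        (forall eps : R, 0 < eps <= 1 ->
           regular_up_to T gamma m M (u eps)) ->
        forall (eps tau : R) (N n : nat),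
          0 < eps <= 1 ->
          ~~ odd N -> (N2 <= N)%N ->
          0 < tau <= tau2 ->
          tau <= c * N%:R ^- 2 ->
          n%:R <= T / tau ->
          (sobolev_norm gamma
             (fun x => ((u eps (n%:R * tau) x)%:C
                        - numerical_solution k eps tau N u0 n x)%R)
           <= (C * (tau ^+ 2 + N%:R `^ (1 - m)))%R%:E)%E].
Proof.
case: k hk => // k hk.
pose D0 := M - 1.
have D00 : 0 < D0 by rewrite /D0; lra.
have [K7 K70 hK7] := @power_tail R (gamma + 7) D0 k.+1 ltac:(lra).
have [K1 K10 hK1] := @power_tail R (gamma + 1) D0 k.+1 ltac:(lra).
have [Ka Ka0 hKa] := @aliasing R gamma m hgamma ltac:(lra).
pose D := D0 * (1 + K7).
have D1 : 0 < D by rewrite mulr_gt0 // ltr_wpDr // ltW.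
have DE : D = D0 + K7 * D0 by rewrite /D; ring.
have KD : K7 * D0 <= D by rewrite DE lerDr ltW.
have DD : D0 <= D by rewrite DE lerDl mulr_ge0 // ltW.
have [K K0 hK] := @coefficient_convergence R k gamma c D T hgamma hc D1 hT.
(* [P] converts powers of 1 + N/2 into powers of N *)
pose P : R := 2 `^ (m - 1).
have P0 : 0 < P by rewrite powR_gt0.
pose A := (Ka + K1) * D0 * P.
have A0 : 0 < A by rewrite !mulr_gt0 // addr_gt0.
(* half of the smallness needed for the bootstrap is taken from N and half from
   tau *)
pose N2 := maxn 2 (Num.bound (2 * K * A)).
pose tau2 := Num.min 1 (2 * K)^-1.
exists N2, tau2, (K * (A + 1) + D0 * P); split.
- by rewrite leq_max.
- by rewrite lt_min ltr01 invr_gt0 mulr_gt0.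
- by rewrite addr_gt0 // mulr_gt0 // ltr_wpDr // ltW.
move=> u0 tc u _ Ttc hsol hreg eps tau N n heps oN hN /andP[t0 ht2] ht hn.
have sol := hsol eps heps; have [_ _ [_ hu] _ _] := hreg eps heps.
have N2' : (2 <= N)%N by apply: leq_trans hN; exact: leq_maxl.
have Np : 0 < N%:R :> R by rewrite ltr0n (leq_trans _ N2').
have [nn1 nn2 nn3] := half_bounds N2'; set nn := N./2 in nn1 nn2 nn3.
have nnE : 1 + nn%:R = nn.+1%:R :> R by rewrite addrC natr1.
have cfl : tau * (1 + nn%:R) ^+ 2 <= c.
  rewrite -ler_pdivlMr; last by rewrite exprn_gt0 // ltr_pwDl.
  apply: le_trans ht _; apply: ler_wpM2l; first exact: ltW.
  rewrite lef_pV2 ?posrE ?exprn_gt0 // ?ltr_pwDl // lerXn2r ?nnegrE ?addr_ge0 //.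
  by rewrite nnE ler_nat.
have rate : (1 + nn%:R) `^ (1 - m) <= P * N%:R `^ (1 - m) :> R.
  have n1 : 0 < 1 + nn%:R :> R by rewrite ltr_pwDl.
  have hN2 : N%:R <= 2 * (1 + nn%:R) :> R by rewrite nnE -natrM ler_nat mulnC.
  rewrite (_ : 1 - m = - (m - 1)); last by ring.
  rewrite !powRN ler_pdivlMr ?powR_gt0 // mulrC ler_pdivrMr ?powR_gt0 //.
  rewrite /P -powRM ?(ltW n1) //.
  by apply: ge0_ler_powR; rewrite ?nnegrE ?mulr_ge0 ?(ltW n1) //; lra.
have ntT : n%:R * tau <= T by rewrite -ler_pdivlMr.
have nt0 : 0 <= n%:R * tau by rewrite mulr_ge0 // ltW.
pose w := u eps; pose W t := fourier (of_real (w t)).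
have inT t : t \in `[0, T] -> 0 <= t < tc.
  by rewrite in_itv /= => /andP[-> /le_lt_trans]; exact.
have dw t : t \in `[0, T] -> forall x : R, is_derive x (1 : R) (w t) (dx w 1 t x).
  by move=> /inT tT x; exact: (dx_derive sol (j := 0) x isT tT).
have cw t : t \in `[0, T] -> continuous (dx w 1 t).
  by move=> /inT tT; exact: jcont_space tT (dx_cont sol (j := 1) isT).
have hW t : t \in `[0, T] -> hball (gamma + m) (W t) D0.
  by rewrite in_itv /= => tT; apply/sobolev_hball; [exact: ltW|exact: (hu t tT).2].
have hWs s t : s <= gamma + m -> t \in `[0, T] -> hball s (W t) D0.
  by move=> sg tT; exact: hball_weaken (hW t tT).
pose Q t := fourier (of_real (fun x => w t x ^+ k.+1)).
have hQ7 t : t \in `[0, T] ->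
    hball (gamma + 7) (fun xi => Q t xi - fourier (trig_sum nn (W t) ^+ k.+1) xi) D.
  move=> tT; have h7 : hball (gamma + 7) (W t) D0 by apply: hWs => //; lra.
  apply: hball_le (hK7 (w t) _ nn D0 (dw t tT) (cw t tT) h7 _) _.
    apply: hball_coef h7 => xi; rewrite /cut; case: ifP => _; last by rewrite subr0.
    by rewrite subrr ComplexField.Normc.normc0 normc_ge0.
  exact: KD.
pose del := K1 * ((1 + nn%:R) `^ (1 - m) * D0).
have hQ1 t : t \in `[0, T] ->
    hball (gamma + 1) (fun xi => Q t xi - fourier (trig_sum nn (W t) ^+ k.+1) xi) del.
  move=> tT; apply: (hK1 (w t) _ nn _ (dw t tT) (cw t tT)).
    by apply: hWs => //; lra.
  rewrite (_ : 1 - m = - (m - 1)); last by ring.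
  apply: hball_tail; first lra.
  by apply: hWs => //; lra.
have h0 : (0 : R) \in `[0, T] by rewrite in_itv /= lexx ltW.
have u0E : of_real u0 = of_real (w 0).
  by apply/funext => x; rewrite /of_real /w (sol_init sol).
pose c0 := cut nn (discrete_fourier (2 * N) (of_real u0)).
have hB : hball gamma (fun xi => cut nn (W 0) xi - c0 xi) (Ka * (1 + nn%:R) `^ (1 - m) * D0).
  by rewrite /c0 u0E; exact: (hKa (w 0) _ _ _ _ nn3 (dw 0 h0) (cw 0 h0) (hW 0 h0)).
pose X : R := N%:R `^ (1 - m).
have X0 : 0 < X by rewrite powR_gt0.
pose B := Ka * (1 + nn%:R) `^ (1 - m) * D0.
have total : B + (del + tau ^+ 2) <= A * X + tau ^+ 2.
  rewrite addrA lerD2r /B /del /A.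
  have -> : Ka * (1 + nn%:R) `^ (1 - m) * D0 + K1 * ((1 + nn%:R) `^ (1 - m) * D0) =
    (Ka + K1) * D0 * (1 + nn%:R) `^ (1 - m) by ring.
  by rewrite -[leRHS]mulrA ler_pM2l // mulr_gt0 // addr_gt0.
have [kge age dge pge xge] : [/\ 0 <= K, 0 <= A, 0 <= D0, 0 <= P & 0 <= X] by split; exact: ltW.
have small : K * (B + (del + tau ^+ 2)) <= 1.
  have tau1 : tau <= 1 by apply: le_trans ht2 _; rewrite ge_min lexx.
  have tauK : 2 * K * tau <= 1.
    rewrite mulrC -ler_pdivlMr ?mulr_gt0 // mul1r; apply: le_trans ht2 _.
    by rewrite ge_min lexx orbT.
  have XN : X <= N%:R^-1.
    rewrite -(powR_inv1 (ltW Np)) /X; apply: ler_powR; first by rewrite ler1n (leq_trans _ N2').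
    by lra.
  have KA : 2 * (K * A * X) <= 1.
    have a1 : 0 <= 2 * K * A by apply: mulr_ge0 => //; apply: mulr_ge0.
    have a2 : 2 * K * A <= N%:R.
      apply: le_trans (ltW (archi_boundP a1)) _; rewrite ler_nat.
      by apply: leq_trans hN; exact: leq_maxr.
    rewrite (mulrA 2 (K * A) X) (mulrA 2 K A); apply: le_trans (ler_wpM2l a1 XN) _.
    by rewrite ler_pdivrMr // mul1r.
  apply: le_trans (ler_wpM2l (ltW K0) total) _.
  have t1 : K * tau ^+ 2 <= K * tau.
    by rewrite ler_pM2l // expr2 ger_pMr.
  have e (x y z : R) : 2 * (K * x * y) <= 1 -> 2 * K * tau <= 1 -> K * z <= K * tau ->
    K * (x * y + z) <= 1 by lra.
  exact: e KA tauK t1.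
have conv := hK nn eps tau W Q c0 del B heps t0 cfl.
have {}conv := conv (fun t tT => hball_le (hWs (gamma + 7) t ltac:(lra) tT) DD).
have {}conv := conv hQ7 hQ1 (fun xi => uhat_ode sol xi Ttc).
have {}conv := conv (@supp_cut R nn _) (real_cut nn (real_discrete_fourier _ _)) hB small n ntT.
have tin : n%:R * tau \in `[0, T] by rewrite in_itv /= nt0.
have tl : hball gamma (fun xi => W (n%:R * tau) xi - cut nn (W (n%:R * tau)) xi)
    ((1 + nn%:R) `^ (- (m - 1)) * D0).
  by apply: hball_tail; [lra|apply: hWs => //; lra].
have C0 : 0 <= (K * (A + 1) + D0 * P) * (tau ^+ 2 + X).
  apply: mulr_ge0; last by rewrite addr_ge0 ?sqr_ge0.
  by apply: addr_ge0; apply: mulr_ge0 => //; exact: addr_ge0.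
apply/sobolev_hball => //; rewrite numerical_solution_trig cut_interp //; last exact: leq_trans N2'.
have bw : bmeas (of_real (w (n%:R * tau))) := bmeas_real (rbmeas_cont (continuous_derive (dw _ tin))).
apply: hball_le (hball_ext _ (hball_add tl conv)) _.
  move=> xi; rewrite [RHS](fourierB xi bw (bmeas_trig nn (iter n (heun k.+1 nn eps tau) c0))).
  rewrite (fourier_supp (supp_iter_heun k.+1 eps tau n (@supp_cut R nn _))).
  have e (x y z : R[i]) : x - y + (y - z) = x - z by ring.
  exact: e.
have tl1 : (1 + nn%:R) `^ (- (m - 1)) * D0 <= P * X * D0.
  by rewrite (_ : - (m - 1) = 1 - m) ?ler_wpM2r // ?ltW //; ring.
have tl2 := ler_wpM2l (ltW K0) total.
apply: le_trans (lerD tl1 tl2) _.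
have s0 : 0 <= tau ^+ 2 := sqr_ge0 _.
have p1 : 0 <= K * A * tau ^+ 2 by apply: mulr_ge0 => //; exact: mulr_ge0.
have p2 : 0 <= K * X by exact: mulr_ge0.
have p3 : 0 <= D0 * P * tau ^+ 2 by apply: mulr_ge0 => //; exact: mulr_ge0.
have e (d p x a q t : R) : 0 <= q * a * t -> 0 <= q * x -> 0 <= d * p * t ->
  p * x * d + q * (a * x + t) <= (q * (a + 1) + d * p) * (t + x) by lra.
exact: e p1 p2 p3.
Qed.
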